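(* Let $p$ be an odd prime, $q:=3^p$, and $G=\mathrm{PSL}(2,3^p)$. Let $x\in G$ be a non-identity element. Then $|x|=2$, or $|x|=3$, or $|x|\ne 2$ and $|x|$ divides $q-1$, or $|x|\neq 2$ and $|x|$ divides $q+1$. Every maximal subgroup of $G$ is isomorphic to one of $C_3^p\rtimes C_{(q-1)/2}$, $D_{q-1}$, $D_{q+1}$, $A_4$, and $\mathrm{Sol}_G(x)$ is the union of the maximal subgroups of $G$ containing $x$. The numbers of maximal subgroups of $G$ of each type that contain $x$, the isomorphism types of their pairwise intersections, and $|\mathrm{Sol}_G(x)|$ are as follows. (1) If $|x|=2$: $0$ isomorphic to $C_3^p\rtimes C_{(q-1)/2}$, $(q+1)/2$ isomorphic to $D_{q-1}$, $(q+3)/2$ isomorphic to $D_{q+1}$, $(q+1)/4$ isomorphic to $A_4$; the intersection of any two distinct maximal subgroups containing $x$ is isomorphic to $C_2$ or $C_2^2$; and $|\mathrm{Sol}_G(x)|=q(q+1)$. (2) If $|x|=3$: $1$ isomorphic to $C_3^p\rtimes C_{(q-1)/2}$, $0$ isomorphic to $D_{q-1}$, $0$ isomorphic to $D_{q+1}$, $q/3$ isomorphic to $A_4$; the intersection of any two distinct maximal subgroups containing $x$ is isomorphic to $C_3$; and $|\mathrm{Sol}_G(x)|=q(q+5)/2$. (3) If $|x|\neq 2$ and $|x|$ divides $q-1$: $2$ isomorphic to $C_3^p\rtimes C_{(q-1)/2}$, $1$ isomorphic to $D_{q-1}$, $0$ isomorphic to $D_{q+1}$, $0$ isomorphic to $A_4$;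 the intersection of any two distinct maximal subgroups containing $x$ is isomorphic to $C_{(q-1)/2}$; and $|\mathrm{Sol}_G(x)|=q(q-1)$. (4) If $|x|\neq 2$ and $|x|$ divides $q+1$: $0$ isomorphic to $C_3^p\rtimes C_{(q-1)/2}$, $0$ isomorphic to $D_{q-1}$, $1$ isomorphic to $D_{q+1}$, $0$ isomorphic to $A_4$; and $|\mathrm{Sol}_G(x)|=q+1$.
   Context: For a finite group $G$ and $x\in G$, the solubilizer of $x$ is the set $\mathrm{Sol}_G(x)=\{y\in G\mid \langle x,y\rangle \text{ is soluble}\}$. $|x|$ is the order of $x$. $C_n$ is the cyclic group of order $n$, $C_r^k$ is the direct product of $k$ copies of $C_r$, $D_{2n}$ is the dihedral group of order $2n$ (so $D_{q\pm1}$ has order $q\pm 1$), and $A_4$ is the alternating group of degree $4$. The maximal subgroup denoted $C_3^p\rtimes C_{(q-1)/2}$ is the normalizer of a Sylow $3$-subgroup (Borel subgroup), of order $q(q-1)/2$. *)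

(* Defs.v *)
From mathcomp Require Import all_boot all_order all_algebra.
From mathcomp Require Import all_fingroup all_solvable all_field.

Set Implicit Arguments.
Unset Strict Implicit.
Unset Printing Implicit Defensive.

Import GroupScope.

Section ProjectiveSpecialLinear.

Variable F : finFieldType.

Definition SL2 : {set {'GL_2[F]}} := [set u | (\det (GLval u) == 1)%R].

Lemma SL2_group_set : group_set SL2.
Proof.
apply/group_setP; split=> [|u v]; first by rewrite inE GL_1E det1.
by rewrite !inE GL_ME det_mulmx => /eqP-> /eqP->; rewrite GRing.mulr1.
Qed.

Canonical SL2_group := Group SL2_group_set.

Definition PSL2 : {group coset_of 'Z(SL2)} := (SL2 / 'Z(SL2))%G.

End ProjectiveSpecialLinear.

(* C_r^k, the external direct product of k copies of the cyclic group C_r.   *)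
Definition Cpow (r k : nat) : {set {dffun forall i : 'I_k, 'Z_r}} :=
  setXn (fun _ : 'I_k => Zp r).

Section Solubilizer.

Variable gT : finGroupType.
Implicit Types (G H M N : {group gT}) (x y : gT).

Definition Sol G x : {set gT} := [set y in G | solvable <<[set x; y]>>].

Definition max_over G x : {set {group gT}} :=
  [set M : {group gT} | maximal M G & x \in M].

(* H is isomorphic to the normaliser in G of a Sylow 3-subgroup P, where P   *)
(* is C_3^p and its normaliser splits over P with complement C_((3^p-1)/2).  *)
Definition borel_type (p : nat) G H : bool :=
  [exists P : {group gT}, exists K : {group gT},
    [&& P \in 'Syl_3(G), P \isog Cpow 3 p, K \isog Zp ((3 ^ p - 1) %/ 2),
        P ><| K == 'N_G(P) & H \isog 'N_G(P)]].

Definition A4_type H : bool := H \isog 'Alt_('I_4).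

Definition dihedral_type (m : nat) H : bool := H \isog 'D_m.

Definition count_max G x (T : {group gT} -> bool) : nat :=
  #|[set M in max_over G x | T M]|.

Definition meets_in G x (T : {set gT} -> bool) : Prop :=
  forall M N, M \in max_over G x -> N \in max_over G x -> M != N ->
    T (M :&: N).

End Solubilizer.

(* Main.v *)
(* Put q = 3^p = 8e + 3 and G = PSL(2,q).  The conjugates of the Sylow 3-subgroup,
   of a split torus (cyclic of order (q-1)/2) and of a nonsplit torus (cyclic of
   order (q+1)/2) intersect trivially, and counting elements shows that they
   partition G.  For H <= G, the sets of H-conjugates of the nontrivial
   intersections of H with the blocks split H minus 1, and comparing cardinals
   (Dickson's class equation) leaves only subgroups normalising a block or a Sylow
   2-subgroup, which is a four-group.  So the maximal subgroups are exactly the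
   normalisers of the blocks and of the four-groups, they are soluble while G is
   not, and the numbers of those containing x follow by double counting.  Away
   from a common subset (elements of square 1, <x>, or the torus of x) the maximal
   subgroups containing x are disjoint, which gives the order of Sol_G(x). *)

(* As p is odd, q is congruent to 3 modulo 8: -1 is not a square, (q-1)/2 is odd and (q+1)/2 is
   twice an odd number. Hence the involutions lie in the nonsplit tori, one in each, and form a
   single class. The primality of p excludes the subfield subgroups: besides the normalisers, the
   class equation leaves room for groups with the numerical parameters of PSL(2, 3^f) where f
   divides p. Then f = p gives G itself, and f = 1 gives A_4, which normalises a four-group.
   Matrices serve only to establish the facts gathered in [psl2_data]; both kinds of torus satisfy
   the same axioms [torus]. The four kinds of normaliser have distinct orders, none dividing
   another. This yields their maximality, and lets the order of a maximal subgroup decide its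
   isomorphism type, so that counting by type becomes counting the subgroups that are normalised. *)
Require Import Defs.
From mathcomp Require Import all_boot all_order all_algebra.
From mathcomp Require Import all_fingroup all_solvable all_field.
From mathcomp Require Import zify ring.

Set Implicit Arguments.
Unset Strict Implicit.
Unset Printing Implicit Defensive.

Import GroupScope.

(** * Cyclic groups inverted by their normaliser *)

Section Torus.

Variable gT : finGroupType.
Implicit Types (G A B H : {group gT}) (g x y : gT).

(** The axioms fit split and nonsplit tori alike. Centralisers are only asked to normalise A,
    because the involution of a nonsplit torus is centralised by the whole normaliser. *)
Record torus G A : Prop := Torus {
  torus_sub : A \subset G;
  torus_cyclic : cyclic A;
  torus_cent : {in A^#, forall a, 'C_G[a] \subset 'N(A)};
  torus_invol : {in 'N_G(A) :\: A, forall y, y ^+ 2 = 1};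
  torus_proper : ~~ ('N_G(A) \subset A) }.

Lemma torusJ G A g : torus G A -> g \in G -> torus G (A :^ g)%G.
Proof.
case=> sAG cycA cA iA pA Gg; have GE := conjGid Gg; split=> /=.
- by rewrite -GE conjSg.
- by rewrite cyclicJ.
- move=> b /setD1P[nt /imsetP[a Aa defb]]; rewrite {b}defb in nt *.
  rewrite normJ cent1J -{1}GE -conjIg conjSg; apply: cA.
  by rewrite !inE Aa andbT; apply: contraNneq nt => ->; rewrite conj1g.
- move=> y; rewrite normJ -{1}GE -conjIg -conjDg => /imsetP[z Nz ->].
  by rewrite -conjXg iA ?conj1g.
- by rewrite normJ -{1}GE -conjIg conjSg.
Qed.

Section TorusTheory.

Variables G A : {group gT}.
Hypotheses (tA : torus G A) (A_gt2 : 2 < #|A|).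

Lemma torus_abelian : abelian A.
Proof. exact: cyclic_abelian (torus_cyclic tA). Qed.

Lemma torus_sub_norm : A \subset 'N_G(A).
Proof. by rewrite subsetI (torus_sub tA) normG. Qed.

(** Both y and y * a lie outside A, so both have square 1, and y a y a = 1 says that y inverts a. *)
Lemma torus_inv y a : y \in 'N_G(A) -> y \notin A -> a \in A -> a ^ y = a^-1.
Proof.
move=> Ny nAy Aa; have iA := torus_invol tA.
have /eqP : (y * a) ^+ 2 = 1.
  apply: iA; rewrite inE groupMr // nAy /= groupM //.
  exact: (subsetP torus_sub_norm).
have y2 : y ^+ 2 = 1 by apply: iA; rewrite inE nAy.
have yV : y^-1 = y by apply/eqP; rewrite eq_invg_mul -expg2 y2.
rewrite expg2 => /eqP yaya; rewrite conjgE yV.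
apply: (mulIg a); rewrite mulVg -yaya -!mulgA //.
Qed.

(** For a generator c of A, c ^ g commutes with a ^ g in A and hence normalises A. Outside A it
    would have order at most 2, against [A_gt2]; so c ^ g is in A. *)
Lemma torus_ti : {in A^# & G, forall a g, a ^ g \in A -> g \in 'N(A)}.
Proof.
move=> a g /setD1P[nta Aa] Gg Aag.
have [c defA] := cyclicP (torus_cyclic tA).
have Gc : c \in G by rewrite (subsetP (torus_sub tA)) // defA cycle_id.
have ntag : a ^ g != 1 by rewrite conjg_eq1.
have Nc : c ^ g \in 'N_G(A).
  rewrite inE groupJ //=; apply: (subsetP (torus_cent tA (x := a ^ g) _)).
    by rewrite !inE ntag Aag.
  rewrite inE groupJ //=; apply/cent1P; rewrite /commute -!conjMg.
  congr (_ ^ _); apply: (centsP torus_abelian) => //.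
  by rewrite defA cycle_id.
have Ac : c ^ g \in A.
  apply: contraLR A_gt2 => nAc; rewrite -leqNgt defA -orderE.
  have /eqP : (c ^ g) ^+ 2 = 1 by apply: (torus_invol tA); rewrite inE nAc.
  by rewrite -conjXg conjg_eq1 -order_dvdn => /dvdn_leq->.
by rewrite inE; rewrite {1}defA -cycleJ cycle_subG.
Qed.

Lemma torus_cent_sub a : a \in A -> a ^+ 2 != 1 -> 'C_G[a] \subset A.
Proof.
move=> Aa a2; apply/subsetP=> y Cy; have /setIP[Gy cay] := Cy.
have nt : a \in A^# by rewrite !inE Aa andbT; apply: contraNneq a2 => ->; rewrite expg1n.
apply: contraR a2 => nAy.
have Ny : y \in 'N_G(A) by rewrite inE Gy (subsetP (torus_cent tA nt)).
have := torus_inv Ny nAy Aa; move/cent1P: cay => cay.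
by rewrite conjgE -cay mulKg expg2 => /eqP; rewrite eq_sym eq_invg_mul.
Qed.

(** Two elements of the normaliser outside A both invert a generator c, so their quotient
    centralises c; since c ^+ 2 is not 1, the quotient lies in A. *)
Lemma card_torus_norm : #|'N_G(A)| = (2 * #|A|)%N.
Proof.
have [y Ny nAy] := subsetPn (torus_proper tA).
have [c defA] := cyclicP (torus_cyclic tA).
have Ac : c \in A by rewrite defA cycle_id.
have c2 : c ^+ 2 != 1.
  by rewrite -order_dvdn gtnNdvd // orderE -defA.
have -> : 'N_G(A) = A :|: A :* y.
  apply/setP=> z; rewrite in_setU; apply/idP/orP=> [Nz | [Az|/rcosetP[a Aa ->]]].
  - have [Az|nAz] := boolP (z \in A); [by left | right].
    rewrite mem_rcoset; apply: (subsetP (torus_cent_sub Ac c2)).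
    have Nzy : z * y^-1 \in 'N_G(A) by rewrite groupM ?groupV.
    rewrite inE (subsetP _ _ Nzy) ?subsetIl //=; apply/cent1P/esym/commgP/conjg_fixP.
    by rewrite conjgM (torus_inv Nz) // (torus_inv _ _ _) ?groupV // invgK.
  - exact: (subsetP torus_sub_norm).
  - by rewrite groupM //; exact: (subsetP torus_sub_norm).
rewrite cardsU card_rcoset (_ : _ :&: _ = set0) ?cards0 ?subn0 ?mul2n ?addnn //.
apply/setP=> z; rewrite !inE; apply/negbTE; apply: contra nAy => /andP[Az].
by rewrite mem_rcoset groupMl // groupV.
Qed.

(** For c a generator of A and y outside A, the involutions y and y * c generate a group containing
    A properly, hence of order at least twice that of A: it is the whole normaliser. *)
Lemma torus_norm_isog : 'N_G(A) \isog 'D_(2 * #|A|).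
Proof.
have [y Ny nAy] := subsetPn (torus_proper tA).
have [c defA] := cyclicP (torus_cyclic tA).
have Ac : c \in A by rewrite defA cycle_id.
have nAyc : y * c \notin A by rewrite groupMr.
have Nyc : y * c \in 'N_G(A) by rewrite groupM // (subsetP torus_sub_norm).
have inv z : z \in 'N_G(A) -> z \notin A -> #[z] = 2.
  move=> Nz nAz; apply: nt_prime_order => //; first by apply: (torus_invol tA); rewrite inE nAz.
  by apply: contraNneq nAz => ->.
have ne : y != y * c.
  rewrite -{1}[y]mulg1 (inj_eq (mulgI _)); apply: contraTneq A_gt2 => c1.
  by rewrite defA -c1 cycle1 cards1.
have := involutions_gen_dihedral (inv _ Ny nAy) (inv _ Nyc nAyc) ne.
suff -> : <<[set y; y * c]>> = 'N_G(A) by rewrite card_torus_norm.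
apply/eqP; rewrite eqEsubset gen_subG; apply/andP; split.
  by apply/subsetP=> z /set2P[] ->.
pose E := [group of <<[set y; y * c]>>]; rewrite -[<<_>>]/(gval E).
have Ey : y \in E by rewrite mem_gen ?set21.
have Eyc : y * c \in E by rewrite mem_gen ?set22.
have sAE : A \subset E by rewrite defA cycle_subG -[c](mulKg y) groupM ?groupV.
have sEN : E \subset 'N_G(A).
  by rewrite gen_subG; apply/subsetP=> z /set2P[] ->.
have : #|A| %| #|E| by rewrite cardSg.
case/dvdnP=> k oE; have : #|A| < #|E|.
  by rewrite proper_card // properE sAE; apply/subsetPn; exists y.
rewrite oE => l2.
suff : #|'N_G(A)| <= #|E| by move=> l3; have /eqP<- : gval E == 'N_G(A) by rewrite eqEcard sEN.
by move: l2; rewrite card_torus_norm oE -{1}[#|A|]mul1n ltn_mul2r leq_mul2r => /andP[_ ->]; rewrite orbT.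
Qed.

End TorusTheory.

End Torus.

Lemma card_Alt4 : #|'Alt_('I_4)| = 12.
Proof. by apply/eqP; rewrite -(eqn_pmul2l (isT : 0 < 2)) card_Alt card_ord. Qed.

(** * Groups of order 12 with four Sylow 3-subgroups *)

Section Alt4.

Variables (gT : finGroupType) (N : {group gT}).
Hypotheses (oN : #|N| = 12) (nSyl : #|'Syl_3(N)| = 4).
Implicit Types (S : {group gT}) (g x : gT).

Let pt (i : 'I_4) : {group gT} := enum_val (cast_ord (esym nSyl) i).

Let pt_inj : injective pt.
Proof. by move=> i j /enum_val_inj/cast_ord_inj. Qed.

Let pt_syl i : 3.-Sylow(N) (pt i).
Proof. by have := enum_valP (cast_ord (esym nSyl) i); rewrite inE. Qed.

Let ix S : 'I_4 := cast_ord nSyl (enum_rank_in (enum_valP (cast_ord (esym nSyl) ord0)) S).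

Let ixK S : 3.-Sylow(N) S -> pt (ix S) = S.
Proof. by move=> sylS; rewrite /pt /ix cast_ordK enum_rankK_in // inE. Qed.

(** The conjugation action on the Sylow 3-subgroups, numbered by [pt]. An element outside N need not
    permute them, whence the default 1; [syl_permP] is stated on N. *)
Let syl_perm g : {perm 'I_4} :=
  odflt 1 [pick s : {perm 'I_4} | [forall i, pt (s i) == (pt i :^ g)%G]].

Let syl_permP g i : g \in N -> pt (syl_perm g i) = (pt i :^ g)%G.
Proof.
move=> Ng; rewrite /syl_perm; case: pickP => [s /forallP/(_ i)/eqP // | no].
have sylJ j : 3.-Sylow(N) (pt j :^ g)%G by rewrite pHallJ.
have inj : injective (fun j => ix (pt j :^ g)%G).
  move=> j k /(congr1 pt); rewrite !ixK // => /(congr1 val) /= /(can_inj (conjsgK g)) E.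
  by apply/pt_inj/val_inj.
by have /negP[] := no (perm inj); apply/forallP=> j; rewrite permE ixK.
Qed.

Let syl_permM : {in N &, {morph syl_perm : g k / g * k}}.
Proof.
move=> g k Ng Nk; apply/permP=> i; apply: pt_inj.
rewrite permM !syl_permP ?groupM //; apply: val_inj => /=.
by rewrite conjsgM.
Qed.

Canonical syl_morphism := Morphism syl_permM.

Let card_pt i : #|pt i| = 3.
Proof. by rewrite (card_Hall (pt_syl i)) oN p_part. Qed.

Let norm_pt i : 'N_N(pt i) = pt i.
Proof.
apply/esym/eqP; rewrite eqEcard subsetI normG (pHall_sub (pt_syl i)) card_pt /=.
have := divg_index N 'N_N(pt i); rewrite -(card_Syl (pt_syl i)) nSyl oN.
by rewrite setIA setIid => <-.
Qed.

(** The Sylow 3-subgroups are self-normalising, so an element of the kernel lies in all of them; if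
    nontrivial, it would generate each of them. *)
Let syl_inj : 'injm syl_morphism.
Proof.
apply/subsetP=> g /morphpreP[Ng /set1P/= fg1].
have gpt i : g \in pt i.
  rewrite -norm_pt inE Ng; apply/normP.
  by have /(congr1 val)/= <- := syl_permP i Ng; rewrite fg1 perm1.
have ne : pt ord0 != pt ord_max by rewrite (inj_eq pt_inj).
apply: contraR ne => ntg; apply/eqP/val_inj=> /=.
have gen i : <[g]> = pt i.
  apply/eqP; rewrite eqEcard cycle_subG gpt card_pt /=.
  have : #[g] %| 3 by rewrite -(card_pt i) order_dvdG.
  rewrite -[#|_|]/#[g]; have : #[g] != 1%N by rewrite order_eq1 -in_set1.
  by case: #[g] => [|[|[|]]].
by rewrite -!gen.
Qed.

(** Elements of order 3 act as even permutations, so the inverse image of the alternating group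
    contains all four Sylow 3-subgroups of N. Its order is divisible by 3 and, being divisible by
    the number of its Sylow 3-subgroups, by 4. *)
Lemma isog_Alt4 : N \isog 'Alt_('I_4).
Proof.
have sNA : N \subset syl_morphism @*^-1 'Alt_('I_4).
  set A := [group of N :&: syl_morphism @*^-1 'Alt_('I_4)].
  have sAN : A \subset N := subsetIl _ _.
  have sub S : S \in 'Syl_3(N) -> S \subset A.
    rewrite inE => sylS; have sSN := pHall_sub sylS; rewrite subsetI sSN.
    apply/subsetP=> x Sx; have Nx := subsetP sSN x Sx.
    apply/morphpreP; split=> //; rewrite Alt_even.
    have x3 : x ^+ 3 = 1.
      apply/eqP; rewrite -order_dvdn (dvdn_trans (order_dvdG Sx)) //.
      by rewrite (card_Hall sylS) oN p_part.
    have : odd_perm (syl_morphism (x ^+ 3)) = false by rewrite x3 morph1 odd_perm1.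
    by rewrite morphX // !expgS mulg1 !odd_permM addbb addbF => ->.
  have oA : (#|A|`_3 = 3)%N.
    have d3 : #|pt ord0| %| #|A| by rewrite cardSg // sub // inE pt_syl.
    have p12 : (12`_3 = 3)%N by rewrite p_part.
    have p3 : (3`_3 = 3)%N by rewrite p_part.
    have up : (#|A|`_3 %| 12`_3)%N by rewrite -oN partn_dvd ?cardSg.
    have low : (3`_3 %| #|A|`_3)%N by rewrite partn_dvd // -{1}(card_pt ord0).
    by apply/eqP; rewrite eqn_dvd -{2}p12 up -{1}p3 low.
  have SylA : 'Syl_3(A) = 'Syl_3(N).
    apply/setP=> S; apply/idP/idP=> SS.
      move: SS; rewrite !inE !pHallE oA oN p_part => /andP[sSA /eqP->].
      by rewrite (subset_trans sSA sAN).
    by have sSA := sub S SS; move: SS; rewrite !inE => /(pHall_subl sSA sAN).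
  have d4 : 4 %| #|A| by rewrite -nSyl -SylA card_Syl_dvd.
  have d3 : 3 %| #|A| by rewrite -oA dvdn_part.
  have d12 : 12 %| #|A| by rewrite (@Gauss_dvd 4 3) // d4.
  have sNA : N \subset A by have /eqP<- : gval A == N; rewrite // eqEcard sAN oN dvdn_leq.
  exact: subset_trans sNA (subsetIr _ _).
have sim : syl_morphism @* N \subset 'Alt_('I_4) by rewrite sub_morphim_pre.
have -> : 'Alt_('I_4) = syl_morphism @* N :> {set _}.
  by apply/esym/eqP; rewrite eqEcard sim card_injm // card_Alt4 oN.
exact: sub_isog.
Qed.

End Alt4.

(** * Elementary abelian groups, unions of sets, arithmetic *)

Section Cpow.

Variables (r k : nat).
Hypothesis r_pr : prime r.

Let oZp : #|Zp r| = r.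
Proof. by rewrite card_Zp ?prime_gt0. Qed.

Lemma Cpow_abelem : r.-abelem (Cpow r k).
Proof.
apply/abelemP=> //; split.
  apply/centsP=> x _ y _; apply/ffunP=> i; rewrite !ffunE.
  exact: Zp_mulgC.
move=> x /setXnP Zx; apply/ffunP=> i.
have -> n : (x ^+ n) i = x i ^+ n by elim: n => [|n IHn]; rewrite ?expgS !ffunE // IHn.
by rewrite ffunE; apply/eqP; rewrite -order_dvdn -[X in _ %| X]oZp order_dvdG.
Qed.

Lemma card_Cpow : #|Cpow r k| = (r ^ k)%N.
Proof.
by rewrite cardsXn (eq_bigr (fun _ => r)) ?prod_nat_const ?card_ord // => i _; rewrite oZp.
Qed.

End Cpow.

Lemma card_bigcup_common (I T : finType) (S : {set I}) (F : I -> {set T}) (C : {set T}) :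
    C \subset \bigcup_(i in S) F i ->
    {in S &, forall i j, i != j -> F i :&: F j \subset C} ->
  #|\bigcup_(i in S) F i| = (#|C| + \sum_(i in S) #|F i :\: C|)%N.
Proof.
move=> sC disj; rewrite -(cardsID C) (setIidPr sC); congr (_ + _)%N.
rewrite -sum1_card (eq_bigr (fun i => \sum_(x in F i :\: C) 1)); last by move=> i _; rewrite sum1_card.
rewrite (exchange_big_dep (mem (\bigcup_(i in S) F i :\: C))) /=; last first.
  by move=> i x Si /setDP[Fx nCx]; rewrite inE nCx; apply/bigcupP; exists i.
apply: eq_bigr => x /setDP[/bigcupP[i Si Fx] nCx].
rewrite (bigD1 i) /=; last by rewrite Si inE nCx.
rewrite big1 ?addn0 // => j /andP[/andP[Sj /setDP[Fjx _]] ne].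
by have /negP[] := nCx; apply: (subsetP (disj _ _ Sj Si ne)); rewrite inE Fjx.
Qed.

Lemma Zp_cyclic r : cyclic (Zp r).
Proof.
rewrite /Zp; case: ifP => _; last exact: cyclic1.
by apply/cyclicP; exists Zp1; exact: Zp_cycle.
Qed.

(** Modulo 3^f - 1, the power 3^p reduces to 3^(p mod f), which is at most 3^f - 1 and so congruent
    to 1 only if p mod f = 0. *)
Lemma pow3_pred_dvd f p : 0 < f -> 3 ^ f - 1 %| 3 ^ p - 1 -> f %| p.
Proof.
move=> f0; rewrite -eqn_mod_dvd ?expn_gt0 // /dvdn.
have M : (3 ^ f = 1 %[mod 3 ^ f - 1])%N by apply/eqP; rewrite eqn_mod_dvd ?expn_gt0.
have lt : 3 ^ (p %% f) < 3 ^ f by rewrite ltn_exp2l // ltn_mod.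
have f3 : 2 < 3 ^ f by rewrite -[3]/(3 ^ 1)%N leq_exp2l.
rewrite {1}(divn_eq p f) expnD [(p %/ f * f)%N]mulnC expnM -modnMml -modnXm M modnXm modnMml.
rewrite exp1n mul1n (modn_small (m := 1)); last by lia.
have [->|ne] := eqVneq (3 ^ (p %% f))%N (3 ^ f - 1)%N; first by rewrite modnn.
rewrite modn_small; last by lia.
by rewrite -[X in _ == X]/(3 ^ 0)%N eqn_exp2l.
Qed.

(* The last case of the class equation: r is the order of a Sylow 3-subgroup R of H,
   t = |N_H(R) : R|, m0 is the number of Sylow 3-subgroups, n is the order of the
   block of H containing the involutions, m1 and m2 are the indices of the
   normalisers in H of the split torus of order t and of that block. *)
Lemma dickson_arith r t m0 n m1 m2 :
  (r * m0 = 2 * m1 -> n * m2 = t * m1 -> m2 + m0 = m1 + 1 ->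
   2 * t + 1 <= r -> r < m0 -> 0 < t -> m0 = r + 1 /\ 2 * t + 1 = r)%N.
Proof.
move=> e1 e2 e3 lt ltm t0.
(* This is the result of eliminating m1 and m2 from the three equations. *)
have E : (n * ((r - 2) * m0 + 2) = t * r * m0)%N.
  have : (2 * m2 = (r - 2) * m0 + 2)%N by rewrite mulnBl; nia.
  by move=> <-; rewrite mulnCA e2 -mulnA e1; ring.
have /dvdnP[d Ed] : m0 %| 2 * n.
  rewrite -(@dvdn_addr (n * ((r - 2) * m0))); last by rewrite mulnA dvdn_mull.
  by rewrite [(2 * n)%N]mulnC -mulnDr E dvdn_mull.
have m00 : 0 < m0 by lia.
have E2 : (d * ((r - 2) * m0 + 2) = 2 * t * r)%N.
  apply/eqP; rewrite -(eqn_pmul2r m00) mulnAC -Ed -mulnA E; apply/eqP; ring.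
have dpos : 0 < d by case: d Ed E2 => // _; rewrite mul0n => /esym/eqP; rewrite !muln_eq0; lia.
(* The chain 2 t r <= (r - 1) r = (r - 2)(r + 1) + 2 <= (r - 2) m0 + 2 <= 2 t r closes up, so that
   all its members are equal. *)
have le1 : (2 * t * r <= (r - 1) * r)%N by rewrite leq_mul2r; apply/orP; right; lia.
have le2 : ((r - 2) * (r + 1) + 2 <= (r - 2) * m0 + 2)%N.
  by rewrite leq_add2r leq_mul2l; apply/orP; right; lia.
have e4 : ((r - 2) * (r + 1) + 2 = (r - 1) * r)%N.
  by case: r lt {e1 E E2 ltm le1 le2} => [|[|r]] lt; [lia| lia |rewrite !subSS !subn0; ring].
have le3 : ((r - 2) * m0 + 2 <= d * ((r - 2) * m0 + 2))%N by rewrite leq_pmull.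
have r3 : 2 < r by lia.
have e5 : ((r - 2) * m0 + 2 = (r - 2) * (r + 1) + 2)%N by lia.
have e6 : (2 * t * r = (r - 1) * r)%N by lia.
split.
  by move/eqP: e5; rewrite eqn_add2r eqn_pmul2l ?subn_gt0 // => /eqP.
by move/eqP: e6; rewrite eqn_pmul2r; [move/eqP; lia | lia].
Qed.

(** * Families of conjugate subgroups *)

Section ConjugateFamilies.

Variable gT : finGroupType.
Implicit Types (G A B H : {group gT}) (g x y : gT).

Definition conjs G A : {set {group gT}} := orbit 'JG G A.

Lemma conjsP G A B : reflect (exists2 g, g \in G & B = (A :^ g)%G) (B \in conjs G A).
Proof.
by apply: (iffP imsetP) => -[g Gg ->]; exists g.
Qed.

Lemma conjs_refl G A : A \in conjs G A.
Proof. exact: orbit_refl. Qed.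

Lemma conjsJ G A B g : B \in conjs G A -> g \in G -> (B :^ g)%G \in conjs G A.
Proof.
case/conjsP=> h Gh -> Gg; apply/conjsP; exists (h * g); rewrite ?groupM //.
by apply: val_inj; rewrite /= conjsgM.
Qed.

Lemma card_conjs G A : #|conjs G A| = #|G : 'N_G(A)|.
Proof. by rewrite card_orbit astab1JG. Qed.

Lemma conjs_trans G A B C :
  B \in conjs G A -> C \in conjs G A -> exists2 g, g \in G & C = (B :^ g)%G.
Proof.
move=> /conjsP[g Gg ->] /conjsP[h Gh ->]; exists (g^-1 * h); first by rewrite groupM ?groupV.
by apply: val_inj; rewrite /= -conjsgM mulKVg.
Qed.

Lemma conjs_norm_card G A B : B \in conjs G A -> #|'N_G(B)| = #|'N_G(A)|.
Proof.
by case/conjsP=> g Gg ->; rewrite normJ -{1}(conjGid Gg) -conjIg cardJg.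
Qed.

Lemma conjs_card G A B : B \in conjs G A -> #|B| = #|A|.
Proof. by case/conjsP=> g Gg ->; rewrite cardJg. Qed.

Lemma conjs_sub G A B : A \subset G -> B \in conjs G A -> B \subset G.
Proof. by move=> sAG /conjsP[g Gg ->]; rewrite /= -(conjGid Gg) conjSg. Qed.

Lemma conjs_ti G A0 :
    {in A0^# & G, forall a g, a ^ g \in A0 -> g \in 'N(A0)} ->
  forall A B a, A \in conjs G A0 -> B \in conjs G A0 ->
    a \in A -> a \in B -> a != 1 -> A = B.
Proof.
move=> ti A B a /conjsP[g Gg ->] /conjsP[h Gh ->] /= /imsetP[b Ab ->].
rewrite mem_conjg -conjgM conjg_eq1 => Abg ntb.
have /normP Ngh : g * h^-1 \in 'N(A0) by apply: ti Abg; rewrite ?inE ?ntb ?groupM ?groupV.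
by apply: val_inj; rewrite /= -[in RHS]Ngh -conjsgM mulgKV.
Qed.

End ConjugateFamilies.

(* The facts about G = PSL(2,q) used in the sequel; e is such that q = 8e + 3, so
   that (q-1)/2 = 4e + 1 and (q+1)/2 = 4e + 2.  P0 is a Sylow 3-subgroup, K0 a split
   torus normalising it and D0 a nonsplit torus. *)
Record psl2_data (gT : finGroupType) (G P0 K0 D0 : {group gT}) (p e : nat) : Prop := Psl2Data {
  psl_p : prime p;
  psl_e : 2 < e;
  psl_q : (3 ^ p = 8 * e + 3)%N;
  psl_oG : #|G| = (3 ^ p * (4 * e + 1) * (8 * e + 4))%N;
  psl_abelP : 3.-abelem P0;
  psl_oP : #|P0| = (3 ^ p)%N;
  psl_defNP : P0 ><| K0 = 'N_G(P0);
  psl_centP : {in P0^#, forall a, 'C_G[a] \subset P0};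
  psl_torK : torus G K0;
  psl_oK : #|K0| = (4 * e + 1)%N;
  psl_torD : torus G D0;
  psl_oD : #|D0| = (4 * e + 2)%N }.

(** * The partition of G and the subgroups of G *)

Section Dickson.

Variables (gT : finGroupType) (G P0 K0 D0 : {group gT}) (p e : nat).
Hypothesis data : psl2_data G P0 K0 D0 p e.
Implicit Types (A B C H M N P K D V W S : {group gT}) (g x y t u : gT).
Implicit Types F : {set {group gT}}.

Local Notation q := (3 ^ p)%N.
Local Notation PP := (conjs G P0).
Local Notation KK := (conjs G K0).
Local Notation DD := (conjs G D0).
Local Notation VV := 'Syl_2(G).

Let p_pr := psl_p data.
Let e_gt2 := psl_e data.
Let defq := psl_q data.
Let oG := psl_oG data.

Lemma PP_abelem P : P \in PP -> 3.-abelem P.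
Proof. by case/conjsP=> g _ ->; rewrite abelemJ (psl_abelP data). Qed.

Lemma PP_card P : P \in PP -> #|P| = q.
Proof. by move/conjs_card->; exact: psl_oP data. Qed.

Lemma sub_P0_G : P0 \subset G.
Proof.
by case/sdprod_context: (psl_defNP data) => /andP[/subset_trans-> //]; rewrite subsetIl.
Qed.

Lemma PP_sub P : P \in PP -> P \subset G.
Proof. exact: conjs_sub sub_P0_G. Qed.

Lemma card_norm_P0 : #|'N_G(P0)| = (q * (4 * e + 1))%N.
Proof. by rewrite -(sdprod_card (psl_defNP data)) (psl_oP data) (psl_oK data). Qed.

Lemma PP_card_norm P : P \in PP -> #|'N_G(P)| = (q * (4 * e + 1))%N.
Proof. by move/conjs_norm_card->; exact: card_norm_P0. Qed.

Lemma PP_cent P : P \in PP -> {in P^#, forall a, 'C_G[a] \subset P}.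
Proof.
case/conjsP=> g Gg -> b /setD1P[nt /imsetP[a Aa defb]]; rewrite {b}defb in nt *.
rewrite cent1J -{1}(conjGid Gg) -conjIg conjSg (psl_centP data) // !inE Aa andbT.
by apply: contraNneq nt => ->; rewrite conj1g.
Qed.

Lemma KK_torus K : K \in KK -> torus G K.
Proof. by case/conjsP=> g Gg ->; apply: torusJ (psl_torK data) Gg. Qed.

Lemma DD_torus D : D \in DD -> torus G D.
Proof. by case/conjsP=> g Gg ->; apply: torusJ (psl_torD data) Gg. Qed.

Lemma KK_card K : K \in KK -> #|K| = (4 * e + 1)%N.
Proof. by move/conjs_card->; exact: psl_oK data. Qed.

Lemma DD_card D : D \in DD -> #|D| = (4 * e + 2)%N.
Proof. by move/conjs_card->; exact: psl_oD data. Qed.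

(** P0 is abelian, so P0 ^ g centralises a ^ g, an element of P0 whose centraliser lies in P0. *)
Lemma P0_ti : {in P0^# & G, forall a g, a ^ g \in P0 -> g \in 'N(P0)}.
Proof.
move=> a g /setD1P[nta Aa] Gg Aag.
have cP : abelian P0 := abelem_abelian (psl_abelP data).
rewrite inE; apply: subset_trans (psl_centP data (x := a ^ g) _); last first.
  by rewrite !inE conjg_eq1 nta.
rewrite subsetI -{1}(conjGid Gg) conjSg sub_P0_G /= cent1J conjSg.
by apply: subset_trans cP _; rewrite -cent_set1 centS ?sub1set.
Qed.

Lemma K0_gt2 : 2 < #|K0|.
Proof. by rewrite (psl_oK data); lia. Qed.

Lemma D0_gt2 : 2 < #|D0|.
Proof. by rewrite (psl_oD data); lia. Qed.

Lemma K_gt2 K : K \in KK -> 2 < #|K|.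
Proof. by move/KK_card->; lia. Qed.

Lemma D_gt2 D : D \in DD -> 2 < #|D|.
Proof. by move/DD_card->; lia. Qed.

Definition blocks : {set {group gT}} := PP :|: (KK :|: DD).

Lemma PP_block P : P \in PP -> P \in blocks.
Proof. by rewrite inE => ->. Qed.
Lemma KK_block K : K \in KK -> K \in blocks.
Proof. by rewrite !inE => ->; rewrite orbT. Qed.
Lemma DD_block D : D \in DD -> D \in blocks.
Proof. by rewrite !inE => ->; rewrite !orbT. Qed.

Lemma co_q_half : coprime q (4 * e + 1).
Proof.
rewrite coprimeXl // prime_coprime //; apply/negP=> d3.
have : 3 %| 2 * (4 * e + 1) by rewrite dvdn_mull.
have : 3 %| q by rewrite dvdn_exp // prime_gt0.
by rewrite defq; lia.
Qed.

Lemma co_q_half' : coprime q (4 * e + 2).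
Proof.
rewrite coprimeXl // prime_coprime //; apply/negP=> d3.
have : 3 %| q by rewrite dvdn_exp // prime_gt0.
by rewrite defq; lia.
Qed.

Lemma co_halves : coprime (4 * e + 1) (4 * e + 2).
Proof. by rewrite (_ : 4 * e + 2 = (4 * e + 1).+1)%N ?coprimenS //; lia. Qed.

(** Blocks of different kinds have coprime orders; those of one kind are conjugates of a trivial
    intersection subgroup. *)
Lemma blocks_ti A B a :
  A \in blocks -> B \in blocks -> a \in A -> a \in B -> a != 1 -> A = B.
Proof.
have tiP := conjs_ti P0_ti.
have tiK := conjs_ti (torus_ti (psl_torK data) K0_gt2).
have tiD := conjs_ti (torus_ti (psl_torD data) D0_gt2).
have co (X Y : {group gT}) : coprime #|X| #|Y| -> a \in X -> a \in Y -> a != 1 -> X = Y.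
  move=> coXY Xa Ya /negP[]; rewrite -order_eq1 -dvdn1 -(eqnP coXY).
  by rewrite dvdn_gcd !order_dvdG.
case/setUP=> [PA|/setUP[] PA] /setUP[PB|/setUP[] PB].
- exact: tiP.
- by apply: co; rewrite (PP_card PA) (KK_card PB) co_q_half.
- by apply: co; rewrite (PP_card PA) (DD_card PB) co_q_half'.
- by apply: co; rewrite (KK_card PA) (PP_card PB) coprime_sym co_q_half.
- exact: tiK.
- by apply: co; rewrite (KK_card PA) (DD_card PB) co_halves.
- by apply: co; rewrite (DD_card PA) (PP_card PB) coprime_sym co_q_half'.
- by apply: co; rewrite (DD_card PA) (KK_card PB) coprime_sym co_halves.
exact: tiD.
Qed.

Lemma blocksJ A g : A \in blocks -> g \in G -> (A :^ g)%G \in blocks.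
Proof.
by move=> cA Gg; rewrite !inE; case/setUP: cA => [|/setUP[]] /conjsJ-> //; rewrite ?orbT.
Qed.

Lemma blocks_sub A : A \in blocks -> A \subset G.
Proof.
by case/setUP=> [/PP_sub //|/setUP[/KK_torus|/DD_torus] /torus_sub].
Qed.

Lemma blocks_nt A : A \in blocks -> 1 < #|A|.
Proof.
case/setUP=> [/PP_card->|/setUP[/KK_card->|/DD_card->]]; rewrite ?defq; lia.
Qed.

Lemma blocks_norm A a g :
  A \in blocks -> a \in A -> a != 1 -> g \in G -> a ^ g \in A -> g \in 'N(A).
Proof.
move=> cA Aa nta Gg Aag; apply/normP.
by rewrite -[LHS]/(gval (A :^ g)%G) (@blocks_ti (A :^ g)%G A (a ^ g)) ?blocksJ ?memJ_conjg ?conjg_eq1.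
Qed.

Section Support.

Variable H : {group gT}.
Hypothesis sHG : H \subset G.

Definition supp A := class_support (H :&: A)^# H.

Lemma supp_normedTI A : A \in blocks -> H :&: A != 1 -> normedTI (H :&: A)^# H 'N_H(A).
Proof.
move=> cA nt; apply/normedTI_memJ_P; split; rewrite ?subsetIl //.
  by rewrite setD_eq0 subG1.
move=> a g /setD1P[nta /setIP[Ha Aa]] Hg.
rewrite in_setD1 !in_setI conjg_eq1 nta groupJ //= Hg; apply/idP/idP=> [Aag|Ng].
  by apply: (@blocks_norm A a) => //; rewrite (subsetP sHG).
by rewrite memJ_norm.
Qed.

Lemma card_supp A : A \in blocks -> 1 < #|H :&: A| ->
  #|supp A| = (#|H :&: A|.-1 * #|H : 'N_H(A)|)%N.
Proof.
move=> cA n1; rewrite (card_support_normedTI (supp_normedTI cA _)).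
  by rewrite [in RHS](cardsD1 1) group1.
by rewrite -cardG_gt1.
Qed.

Lemma suppP A y : reflect (exists2 g, g \in H & (y != 1) && (y \in A :^ g) && (y \in H)) (y \in supp A).
Proof.
apply: (iffP imset2P) => [[a g /setD1P[nt /setIP[Ha Aa]] Hg ->]|[g Hg /andP[/andP[nt Ay] Hy]]].
  by exists g; rewrite // conjg_eq1 nt memJ_conjg Aa groupJ.
exists (y ^ g^-1) g; rewrite ?conjgKV // !inE conjg_eq1 nt groupJ ?groupV //=.
by rewrite -mem_conjg.
Qed.

Lemma supp_sub A : supp A \subset H^#.
Proof. by apply/subsetP=> y /suppP[g _ /andP[/andP[nt _] Hy]]; rewrite !inE nt. Qed.

(** By [blocks_ti] a common element forces an H-conjugate of A to equal an H-conjugate of B. *)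
Lemma supp_eq A B y : A \in blocks -> B \in blocks ->
  y \in supp A -> y \in supp B -> supp A = supp B.
Proof.
move=> cA cB /suppP[g Hg /andP[/andP[nt Ay] _]] /suppP[h Hh /andP[/andP[_ By] _]].
have Gg := subsetP sHG g Hg; have Gh := subsetP sHG h Hh.
have /(congr1 val) /= AB : (A :^ g)%G = (B :^ h)%G by apply: (@blocks_ti _ _ y); rewrite ?blocksJ.
apply/setP=> z; apply/suppP/suppP=> [] [k Hk Pz].
  exists (h * g^-1 * k); rewrite ?groupM ?groupV //.
  by rewrite !conjsgM -AB conjsgK.
exists (g * h^-1 * k); rewrite ?groupM ?groupV //.
by rewrite !conjsgM AB conjsgK.
Qed.

Lemma supp_self A y : y \in A -> y \in H -> y != 1 -> y \in supp A.
Proof. by move=> Ay Hy nt; apply/suppP; exists 1; rewrite ?group1 // conjsg1 nt Ay Hy. Qed.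

End Support.

Lemma KK_card_norm K : K \in KK -> #|'N_G(K)| = (8 * e + 2)%N.
Proof.
by move=> KKK; rewrite (card_torus_norm (KK_torus KKK)) ?K_gt2 // (KK_card KKK); lia.
Qed.

Lemma DD_card_norm D : D \in DD -> #|'N_G(D)| = (8 * e + 4)%N.
Proof.
by move=> DDD; rewrite (card_torus_norm (DD_torus DDD)) ?D_gt2 // (DD_card DDD); lia.
Qed.

Lemma card_PP : #|PP| = (8 * e + 4)%N.
Proof.
rewrite card_conjs -divgS ?subsetIl // oG PP_card_norm ?conjs_refl // mulKn //.
by rewrite defq; lia.
Qed.

Lemma card_KK : #|KK| = (q * (4 * e + 2))%N.
Proof.
rewrite card_conjs -divgS ?subsetIl // oG KK_card_norm ?conjs_refl //.
rewrite (_ : _ * _ = q * (4 * e + 2) * (8 * e + 2))%N ?mulnK //; first by lia.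
by ring.
Qed.

Lemma card_DD : #|DD| = (q * (4 * e + 1))%N.
Proof.
by rewrite card_conjs -divgS ?subsetIl // oG DD_card_norm ?conjs_refl // mulnK //; lia.
Qed.

(* The number of elements covered is computed from the orders of the three kinds of
   blocks and of their normalisers, and turns out to be the order of G. *)
Lemma blocks_cover x : x \in G -> x != 1 -> exists2 A, A \in blocks & x \in A.
Proof.
move=> Gx ntx; have cP := PP_block (conjs_refl G P0).
have cK := KK_block (conjs_refl G K0); have cD := DD_block (conjs_refl G D0).
have oA (A : {group gT}) : A \in blocks -> #|supp G A| = (#|A|.-1 * #|G : 'N_G(A)|)%N.
  move=> cA; have GA : G :&: A = A by apply/setIidPr; exact: (blocks_sub cA).
  by rewrite card_supp ?GA // blocks_nt.
have dis (A B : {group gT}) : A \in blocks -> B \in blocks -> #|A| != #|B| -> supp G A :&: supp G B = set0.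
  move=> cA cB; apply: contraNeq => /set0Pn[y /setIP[/suppP[g Gg /andP[/andP[nt Ay] _]]]].
  case/suppP=> h Gh /andP[/andP[_ By] _].
  have := @blocks_ti (A :^ g)%G (B :^ h)%G y.
  move/(_ (blocksJ cA Gg) (blocksJ cB Gh) Ay By nt).
  by move/(congr1 (fun C : {group gT} => #|C|)); rewrite /= !cardJg => ->.
have: x \in supp G P0 :|: (supp G K0 :|: supp G D0).
  have -> : supp G P0 :|: (supp G K0 :|: supp G D0) = G^#.
    apply/eqP; rewrite eqEcard !subUset !supp_sub /=.
    have dPK : supp G P0 :&: supp G K0 = set0.
      by apply: dis => //; rewrite (psl_oP data) (psl_oK data) defq; lia.
    have dPD : supp G P0 :&: supp G D0 = set0.
      by apply: dis => //; rewrite (psl_oP data) (psl_oD data) defq; lia.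
    have dKD : supp G K0 :&: supp G D0 = set0.
      by apply: dis => //; rewrite (psl_oK data) (psl_oD data); lia.
    rewrite !cardsU setIUr dPK dPD dKD setU0 cards0 !subn0.
    rewrite !oA // -!card_conjs card_PP card_KK card_DD (psl_oP data) (psl_oK data) (psl_oD data).
    rewrite -(leq_add2l 1) -[1 + #|G^#|]/(true + _) -{1}(group1 G) -cardsD1 oG defq.
    have -> : (8 * e + 3).-1 = (8 * e + 2)%N by lia.
    have -> : (4 * e + 1).-1 = (4 * e)%N by lia.
    have -> : (4 * e + 2).-1 = (4 * e + 1)%N by lia.
    by rewrite leq_eqVlt; apply/orP; left; apply/eqP; ring.
  by rewrite !inE ntx.
case/setUP=> [|/setUP[]] /suppP[g Gg /andP[/andP[_ Ax] _]].
- by exists (P0 :^ g)%G; rewrite ?blocksJ.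
- by exists (K0 :^ g)%G; rewrite ?blocksJ.
- by exists (D0 :^ g)%G; rewrite ?blocksJ.
Qed.

(** * The class equation of a subgroup, and subgroups of order prime to 3 *)

Section Classify.

Variable H : {group gT}.
Hypothesis sHG : H \subset G.
Local Notation supp := (supp H).
Local Notation h := #|H|.

(* Pairwise disjoint supports of blocks, picked one after the other until they
   exhaust H; four of them are always enough. *)
Fixpoint chain (s : seq {group gT}) : bool :=
  if s is A :: s' then
    [&& A \in blocks, 1 < #|H :&: A|, all (fun B => [disjoint supp A & supp B]) s' & chain s']
  else true.

Lemma chain_blocks s : chain s -> {subset s <= blocks}.
Proof.
elim: s => //= A s IHs /and4P[cA _ _ /IHs sub] B; rewrite inE => /predU1P[-> //|]; exact: sub.
Qed.

Lemma card_chain s : chain s -> #|\bigcup_(A <- s) supp A| = \sum_(A <- s) #|supp A|.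
Proof.
elim: s => [|A s IHs] /=; first by rewrite !big_nil cards0.
case/and4P=> _ _ dA /IHs{}IHs; rewrite !big_cons cardsU IHs (_ : _ :&: _ = set0) ?cards0 ?subn0 //.
apply/eqP; rewrite setI_eq0 bigcup_seq; apply/bigcup_disjointP=> B sB.
exact: (allP dA).
Qed.

Lemma chain_le s : chain s -> \sum_(A <- s) #|supp A| < h.
Proof.
move=> cs; rewrite -card_chain // [h](cardsD1 1) group1 ltnS subset_leq_card //.
by rewrite bigcup_seq; apply/bigcupsP=> A _; exact: supp_sub.
Qed.

(** A nontrivial element of H outside the supports lies in some block. Supports that meet coincide,
    so the support of this block is disjoint from the others. *)
Lemma chain_ext s : chain s ->
  (\sum_(A <- s) #|supp A|).+1 = h \/ exists B, chain (B :: s).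
Proof.
move=> cs; have [y|E] := pickP (mem (H^# :\: \bigcup_(A <- s) supp A)); last first.
  left; rewrite -card_chain // [h](cardsD1 1) group1 add1n; congr _.+1.
  apply/eqP; rewrite eqn_leq !subset_leq_card //.
    by apply/subsetP=> y Hy; have := E y; rewrite /= !inE in Hy *; rewrite Hy andbT => /negbFE.
  by rewrite bigcup_seq; apply/bigcupsP=> A _; exact: supp_sub.
case/setDP=> Hy nsy; right.
have /setD1P[nty Hy'] := Hy; have [B cB By] := blocks_cover (subsetP sHG y Hy') nty.
exists B; rewrite /= cB cs andbT /=; apply/andP; split.
  by rewrite cardG_gt1; apply/trivgPn; exists y; rewrite ?inE ?Hy'.
apply/allP=> A sA; rewrite disjoint_sym -setI_eq0; apply: contraR nsy => /set0Pn[z /setIP[zA zB]].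
rewrite bigcup_seq; apply/bigcupP; exists A => //.
by rewrite (supp_eq sHG (chain_blocks cs sA) cB zA zB) supp_self.
Qed.

(** The product of ['N_H(A)] and A lies in ['N_G(A)], of order twice that of A, so the index of
    [H :&: A] in ['N_H(A)] is at most 2. *)
Lemma card_torus_norm_sub A : torus G A -> 2 < #|A| ->
  #|'N_H(A)| = #|H :&: A| \/ #|'N_H(A)| = (2 * #|H :&: A|)%N.
Proof.
move=> tA A2; have sHN : H :&: A \subset 'N_H(A) by rewrite setIS ?normG.
have /dvdnP[k oN] : #|H :&: A| %| #|'N_H(A)| by rewrite cardSg.
have : #|'N_H(A) * A| <= 2 * #|A|.
  rewrite -(card_torus_norm tA A2) subset_leq_card // mul_subG ?setSI //.
  exact: torus_sub_norm tA.
rewrite -(leq_pmul2r (cardG_gt0 (H :&: A))); have := mul_cardG 'N_H(A) A.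
rewrite -setIA (setIidPr (normG A)) => <-; rewrite oN.
rewrite (_ : k * #|H :&: A| * #|A| = k * (#|A| * #|H :&: A|))%N; last by ring.
rewrite -mulnA leq_pmul2r ?muln_gt0 ?cardG_gt0 // => k2.
have : 0 < k * #|H :&: A| by rewrite -oN.
rewrite muln_gt0 => /andP[k0 _]; move: oN.
by case: k k0 k2 => [|[|[|]]] //; rewrite ?mul1n; [left|right].
Qed.

Lemma index1_norm A : #|H : 'N_H(A)| = 1%N -> H \subset 'N(A).
Proof. by move/eqP; rewrite indexg_eq1 subsetI => /andP[]. Qed.

(* The share of a torus A in the class equation of H: x is the size of its support,
   m = |H : N_H(A)| and a = |H :&: A| m.  The first disjunction tells whether an
   element of H inverts A, the second whether H :&: A has order 2 (order 3 is
   excluded).  All the constraints are linear in x, m, a and |H|. *)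
Definition class_shape (x m a : nat) :=
  [/\ x + m = a, a = h \/ 2 * a = h, 2 * m = a \/ 4 * m <= a & 0 < m]%N.

Lemma torus_shape A : A \in KK :|: DD -> 1 < #|H :&: A| ->
  let m := #|H : 'N_H(A)| in
  class_shape #|supp A| m (#|H :&: A| * m).
Proof.
move=> tA n1 m; have cA : A \in blocks by rewrite inE tA orbT.
have [tT A2] : torus G A /\ 2 < #|A|.
  by case/setUP: tA => tA; split;
    [exact: KK_torus | exact: K_gt2 | exact: DD_torus | exact: D_gt2].
have hm : (#|'N_H(A)| * m = h)%N by rewrite Lagrange ?subsetIl.
(* As 3 divides q = 8e + 3, it divides e, hence neither 4e + 1 nor 4e + 2. *)
have n3 : #|H :&: A| != 3%N.
  apply/eqP=> n3; have : #|H :&: A| %| #|A| by rewrite cardSg ?subsetIr.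
  have d3 : 3 %| q by rewrite dvdn_exp // prime_gt0.
  by rewrite n3; move: d3; rewrite defq; case/setUP: tA => [/KK_card|/DD_card] ->; lia.
have m0 : 0 < m by rewrite indexg_gt0.
rewrite card_supp // -/m; split=> //.
- by case: #|H :&: A| n1 => // n _; rewrite mulSn addnC.
- by rewrite -hm; case: (card_torus_norm_sub tT A2) => ->; [left | right; rewrite mulnA].
- have [->|n2] := eqVneq #|H :&: A| 2%N; [by left | right].
  by rewrite leq_pmul2r //; lia.
Qed.

(** Only tori meet H nontrivially, and by [class_shape] each support has at least h / 4 elements:
    four of them do not fit into the h - 1 nontrivial elements. When at most three exhaust H, the
    linear constraints force some index m to be 1, so that H normalises the corresponding torus. *)
Lemma classify_no3 : ~~ (3 %| h) -> exists2 A, A \in blocks & H \subset 'N(A).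
Proof.
move=> h3; have tor B : B \in blocks -> 1 < #|H :&: B| -> B \in KK :|: DD.
  case/setUP=> // PB; rewrite ltnNge => /negP[]; rewrite -trivg_card_le1; apply/eqP.
  apply: coprime_TIg; rewrite (PP_card PB) coprime_sym coprimeXl //.
  by rewrite prime_coprime.
have done1 A : A \in blocks -> #|H : 'N_H(A)| = 1%N -> exists2 A, A \in blocks & H \subset 'N(A).
  by move=> cA m1; exists A => //; exact: index1_norm.
case: (@chain_ext [::]) => //.
  rewrite big_nil => /esym/eqP; rewrite -trivg_card1 => /eqP->.
  by exists P0; rewrite ?sub1G // PP_block ?conjs_refl.
case=> A1 c1; have /and4P[cA1 n1 _ _] := c1.
have [] := torus_shape (tor _ cA1 n1) n1.
set m1 := #|H : _|; set a1 := (_ * m1)%N => x1 ha1 hm1 m1_0.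
case: (chain_ext c1).
  by rewrite !big_cons big_nil => hh; apply: (done1 A1); rewrite // -/m1; lia.
case=> A2 c2; have /and4P[cA2 n2 _ _] := c2.
have [] := torus_shape (tor _ cA2 n2) n2.
set m2 := #|H : _|; set a2 := (_ * m2)%N => x2 ha2 hm2 m2_0.
case: (chain_ext c2).
  rewrite !big_cons big_nil => hh.
  have : (m1 == 1%N) || (m2 == 1%N) by lia.
  by case/orP=> /eqP; exact: done1.
case=> A3 c3; have /and4P[cA3 n3 _ _] := c3.
have [] := torus_shape (tor _ cA3 n3) n3.
set m3 := #|H : _|; set a3 := (_ * m3)%N => x3 ha3 hm3 m3_0.
case: (chain_ext c3).
  rewrite !big_cons big_nil => hh.
  have : [\/ m1 = 1%N, m2 = 1%N | m3 = 1%N].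
    have : (m1 == 1%N) || (m2 == 1%N) || (m3 == 1%N).
      move: hh x1 ha1 hm1 m1_0 x2 ha2 hm2 m2_0 x3 ha3 hm3 m3_0.
      by clearbody a1 a2 a3; clear; lia.
    by case/orP=> [/orP[]|] /eqP; [constructor 1|constructor 2|constructor 3].
  by case; exact: done1.
case=> A4 c4; have /and4P[cA4 n4 _ _] := c4.
have [] := torus_shape (tor _ cA4 n4) n4.
set m4 := #|H : _|; set a4 := (_ * m4)%N => x4 ha4 hm4 m4_0.
have := chain_le c4; rewrite !big_cons big_nil => hh.
move: hh x1 ha1 hm1 m1_0 x2 ha2 hm2 m2_0 x3 ha3 hm3 m3_0 x4 ha4 hm4 m4_0.
by clearbody a1 a2 a3 a4; clear; lia.
Qed.

End Classify.

Lemma PP_Syl : PP = 'Syl_3(G).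
Proof.
have sylP0 : 3.-Sylow(G) P0.
  rewrite pHallE sub_P0_G /=.
  rewrite (psl_oP data) oG -mulnA mulnC partnM ?expn_gt0 //; last by lia.
  have q3 : 3.-nat q by rewrite pnatX pnat_id.
  rewrite (part_pnat_id q3) part_p'nat ?mul1n // p'natE //.
  have : 3 %| q by rewrite dvdn_exp // prime_gt0.
  rewrite defq => d3; apply/negP; rewrite Euclid_dvdM // => /orP[]; lia.
apply/setP=> P; rewrite inE; apply/conjsP/idP=> [[g Gg ->]|sylP]; first by rewrite pHallJ.
by have [g Gg defP] := Sylow_trans sylP0 sylP; exists g => //; apply: val_inj.
Qed.

Lemma PP_norm_split P : P \in PP -> exists2 K, K \in KK & P ><| K = 'N_G(P).
Proof.
case/conjsP=> g Gg ->; exists (K0 :^ g)%G; first by rewrite conjsJ ?conjs_refl.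
rewrite /= normJ -{1}(conjGid Gg) -conjIg -(psl_defNP data).
by apply/esym; apply: sdprodJ.
Qed.

Lemma PP_norm_sol P : P \in PP -> solvable 'N_G(P).
Proof.
move=> PPP; have [K KKK defN] := PP_norm_split PPP.
have /sdprod_context[nPN _ _ _ _] := defN.
rewrite (series_sol nPN) (abelian_sol (abelem_abelian (PP_abelem PPP))) /=.
rewrite -(isog_sol (sdprod_isog defN)).
by rewrite abelian_sol // cyclic_abelian // (torus_cyclic (KK_torus KKK)).
Qed.

Lemma KK_Hall P K : P \in PP -> P ><| K = 'N_G(P) -> 3^'.-Hall('N_G(P)) K.
Proof.
move=> PPP defN; have sPN : P \subset 'N_G(P) by rewrite subsetI normG PP_sub.
have sylP : 3.-Sylow(G) P by move: PPP; rewrite PP_Syl inE.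
rewrite -(compl_pHall K (pHall_subl sPN (subsetIl _ _) sylP)).
exact: sdprod_compl.
Qed.

(** * Sylow 3-subgroups of a subgroup of order divisible by 3 *)

Section Classify.

Variable H : {group gT}.
Hypothesis sHG : H \subset G.
Local Notation supp := (supp H).
Local Notation h := #|H|.

Hypothesis h3 : 3 %| h.

Lemma sylow_block : exists2 P, P \in PP & 3.-Sylow(H) (H :&: P).
Proof.
have [S sylS] := Sylow_exists 3 H.
have [P sylP sSP] := Sylow_superset (subset_trans (pHall_sub sylS) sHG) (pHall_pgroup sylS).
exists P; first by rewrite PP_Syl inE.
suff -> : H :&: P = S by [].
apply: (sub_pHall sylS); rewrite ?subsetIl //.
  exact: pgroupS (subsetIr _ _) (pHall_pgroup sylP).
by rewrite subsetI (pHall_sub sylS).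
Qed.

Variable P : {group gT}.
Hypotheses (PPP : P \in PP) (sylHP : 3.-Sylow(H) (H :&: P)).

Local Notation r := #|H :&: P|.
Local Notation m0 := #|H : 'N_H(P)|.

Let cP : P \in blocks := PP_block PPP.

Lemma r_gt1 : 1 < r.
Proof.
rewrite (card_Hall sylHP) p_part (ltn_exp2l 0) // logn_gt0 mem_primes h3 cardG_gt0 //.
Qed.

(** [H :&: B] is a 3-group, so some H-conjugate of the Sylow subgroup [H :&: P] contains it. Thus
    Sylow 3-subgroups of G contribute a single support to the class equation. *)
Lemma supp_PP B : B \in PP -> 1 < #|H :&: B| -> supp B = supp P.
Proof.
move=> PPB; rewrite cardG_gt1 => /trivgPn[y HBy nty].
have p3 : 3.-group (H :&: B).
  by apply: pgroupS (subsetIr _ _) _; exact: abelem_pgroup (PP_abelem PPB).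
have [k Hk sub] := Sylow_subJ sylHP (subsetIl _ _) p3.
have cB := PP_block PPB.
have /setIP[Hy By] := HBy; apply: (supp_eq sHG cB cP (y := y)).
  exact: supp_self.
apply/suppP; exists k; rewrite ?nty ?Hy ?andbT //.
by have := subsetP sub y HBy; rewrite conjIg => /setIP[].
Qed.

Lemma norm_PP_sub : 'N_H(H :&: P) = 'N_H(P).
Proof.
have := supp_normedTI sHG cP; rewrite -cardG_gt1 => /(_ r_gt1) /and3P[_ _ /eqP<-].
by rewrite normD1.
Qed.

(** The integer t is the order of a Hall 3'-subgroup T of ['N_H(P)]. The image of ['N_H(P)] in
    ['N_G(P)] modulo P gives the divisibility. T acts on [H :&: P] without fixed points, so t
    divides r - 1; as r and t are odd the quotient is even, whence 2t <= r - 1. *)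
Lemma PP_quo : exists t : nat, [/\ #|'N_H(P)| = (r * t)%N, t %| 4 * e + 1, 2 * t + 1 <= r & 0 < t]%N.
Proof.
have sHN : H :&: P \subset 'N_H(P) by rewrite setIS ?normG.
have /dvdnP[t oN] : r %| #|'N_H(P)| by rewrite cardSg.
have t0 : 0 < t by have := cardG_gt0 'N_H(P); rewrite oN muln_gt0 => /andP[].
have dt : t %| 4 * e + 1.
  have nN : 'N_H(P) \subset 'N(P) by rewrite subsetIr.
  have : #|'N_H(P) <*> P| %| #|'N_G(P)|.
    by rewrite cardSg // join_subG setSI //= subsetI normG PP_sub.
  rewrite (PP_card_norm PPP) norm_joinEl //.
  have := mul_cardG 'N_H(P) P; rewrite -setIA (setIidPr (normG P)) oN (PP_card PPP).
  move=> E; have -> : #|'N_H(P) * P| = (q * t)%N.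
    by apply/eqP; rewrite -(eqn_pmul2r (cardG_gt0 (H :&: P))) -E; apply/eqP; ring.
  by rewrite dvdn_pmul2l ?expn_gt0.
exists t; split=> //; first by rewrite mulnC.
have [t1|t1] := leqP t 1.
  have -> : t = 1%N by lia.
  have := r_gt1; rewrite (card_Hall sylHP) p_part.
  by case: logn => // n _; rewrite expnS; have := expn_gt0 3 n; lia.
have solN := solvableS (setSI 'N(P) sHG) (PP_norm_sol PPP).
have [T hallT] := Hall_exists 3^' solN.
have oT : #|T| = t.
  rewrite (card_Hall hallT) oN partnM ?cardG_gt0 // part_pnat_id.
    by rewrite part_p'nat ?muln1 // pnatNK; exact: pHall_pgroup sylHP.
  rewrite p'natE //; apply/negP=> d3; have := co_q_half.
  move/(coprime_dvdl (_ : 3 %| q)); rewrite dvdn_exp ?prime_gt0 // => /(_ isT).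
  by rewrite prime_coprime // (dvdn_trans d3).
have nTP : T \subset 'N(P) by rewrite (subset_trans (pHall_sub hallT)) ?subsetIr.
have sTH : T \subset H by rewrite (subset_trans (pHall_sub hallT)) ?subsetIl.
have reg : semiregular (H :&: P) T.
  move=> y /setD1P[nty Ty]; apply/trivgP/subsetP=> u /setIP[/setIP[Hu Pu] cuy].
  rewrite inE; apply: contraNT nty => ntu.
  have Py : y \in P.
    apply: (subsetP (PP_cent PPP (x := u) _)); first by rewrite in_setD1 ntu.
    by rewrite in_setI (subsetP sHG) ?(subsetP sTH) //= cent1C.
  have /coprime_TIg TI : coprime #|T| #|P|.
    by rewrite oT (coprime_dvdl dt) // (PP_card PPP) coprime_sym co_q_half.
  by rewrite -in_set1 -[[set 1]]/(1 : {set gT}) -TI inE Ty.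
have nT : T \subset 'N(H :&: P) by rewrite normsI // (subset_trans sTH) ?normG.
have := regular_norm_dvd_pred nT reg; rewrite oT => /dvdnP[k rk].
have r0 := cardG_gt0 (H :&: P).
have odd_r : odd r by rewrite (card_Hall sylHP) p_part oddX orbT.
have odd_t : odd t by apply: dvdn_odd dt _; rewrite oddD oddM.
have r1 : r = (k * t).+1 by rewrite -rk prednK.
case: k rk r1 => [|[|k]] _ r1; rewrite r1 ?mul0n ?mul1n.
- by have := r_gt1; rewrite r1.
- by move: odd_r; rewrite r1 mul1n /= odd_t.
by rewrite addn1 ltnS leq_mul2r orbT.
Qed.

(* S = H :&: P acts freely by conjugation on the other Sylow 3-subgroups of H. *)
Lemma PP_number : m0 = 1%N \/ r < m0.
Proof.
have N1 : m0 = #|'Syl_3(H)|.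
  by rewrite -norm_PP_sub (card_Syl sylHP).
have [m1|ne] := eqVneq m0 1%N; [by left | right].
have [S Syl_S neS] : exists2 S : {group gT}, S \in 'Syl_3(H) & S != (H :&: P)%G.
  have : 0 < #|'Syl_3(H) :\ (H :&: P)%G|.
    have := cardsD1 (H :&: P)%G 'Syl_3(H); rewrite inE sylHP -N1.
    have : 0 < m0 by rewrite indexg_gt0.
    by move: ne; case: (m0) => [|[|k]] //= _ _; rewrite add1n => -[<-].
  by case/card_gt0P=> S /setD1P[]; exists S.
rewrite inE in Syl_S.
have [k Hk defS] := Sylow_trans sylHP Syl_S.
have oS : #|orbit 'JG (H :&: P) S| = r.
  rewrite card_orbit astab1JG; suff -> : 'N_(H :&: P)(S) = 1 by rewrite indexg1.
  apply/trivgP/subsetP=> y /setIP[HPy Ny]; rewrite inE; apply: contraR neS => nty.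
  have Sy : y \in S.
    have nS3 : S <*> <[y]> \subset H by rewrite join_subG (pHall_sub Syl_S) cycle_subG; case/setIP: HPy.
    have p3 : 3.-group (S <*> <[y]>).
      rewrite norm_joinEr ?cycle_subG // pgroupM (pHall_pgroup Syl_S) /=.
      by apply: pgroupS (pHall_pgroup sylHP); rewrite cycle_subG.
    have E : S <*> <[y]> = S := sub_pHall Syl_S p3 (joing_subl _ _) nS3.
    have : y \in S <*> <[y]> by rewrite -cycle_subG joing_subr.
    by rewrite E.
  have /setIP[Hy Py] := HPy.
  have E : P = (P :^ k)%G.
    apply: (blocks_ti cP (blocksJ cP (subsetP sHG k Hk)) Py _ nty).
    by move: Sy; rewrite defS conjIg => /setIP[].
  by apply/eqP/val_inj; rewrite /= defS conjIg conjGid // {2}E.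
rewrite N1 -oS [X in _ < X](cardsD1 (H :&: P)%G) inE sylHP add1n ltnS subset_leq_card //.
apply/subsetP=> B /conjsP[y HPy ->]; rewrite !inE.
have /setIP[Hy _] := HPy.
rewrite pHallJ // Syl_S andbT; apply: contra neS => /eqP/(congr1 val)/= E.
by apply/eqP/val_inj; rewrite /= -[LHS](conjsgK y) E conjGid ?groupV.
Qed.

End Classify.

(** * The class equation of a subgroup of order divisible by 3 *)

Section Classify.

Variable H : {group gT}.
Hypothesis sHG : H \subset G.
Local Notation supp := (supp H).
Local Notation chain := (chain H).
Local Notation h := #|H|.

Hypothesis h3 : 3 %| h.

Variable P : {group gT}.
Hypotheses (PPP : P \in PP) (sylHP : 3.-Sylow(H) (H :&: P)).

Local Notation r := #|H :&: P|.
Local Notation m0 := #|H : 'N_H(P)|.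

Let cP : P \in blocks := PP_block PPP.
Let r1 : 1 < r := r_gt1 h3 sylHP.

Lemma chain_P : chain [:: P].
Proof. by rewrite /= cP r1. Qed.

(** P is picked first, so it stays last in the chain. All Sylow 3-subgroups meeting H nontrivially
    have its support, so a block added later is a torus. *)
Lemma chain_tor s B : chain (rcons s P) -> chain (B :: rcons s P) -> B \in KK :|: DD.
Proof.
move=> _ /= /and4P[cB n1 dB _]; case/setUP: cB => // PPB.
have := allP dB P; rewrite mem_rcons mem_head => /(_ isT).
rewrite (supp_PP sHG PPP sylHP PPB n1) -setI_eq0 setIid => /eqP s0.
have := card_supp sHG cP r1; rewrite s0 cards0 => /esym/eqP.
by rewrite muln_eq0 -subn1 subn_eq0 leqNgt r1 eqn0Ngt indexg_gt0.
Qed.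

Lemma supp_card : (#|supp P| + m0 = r * m0)%N.
Proof. by rewrite card_supp // -subn1 mulnBl mul1n subnK // leq_pmull // ltnW. Qed.

(** The support of P takes 8 of the 12 elements. A Sylow 2-subgroup of H avoids it, hence equals its
    complement in H, which H normalises. *)
Lemma sylow2_normal12 : h = 12 -> m0 = 4%N -> r = 3%N ->
  exists2 V : {group gT}, V \in 'Syl_2(G) & H \subset 'N(V).
Proof.
move=> h12 m4 r3; have [V sylV] := Sylow_exists 2 H.
have oV : #|V| = 4%N by rewrite (card_Hall sylV) h12 p_part.
exists V.
  rewrite inE pHallE (subset_trans (pHall_sub sylV)) //= oV oG.
  rewrite (_ : _ * _ = 4 * (q * (4 * e + 1) * (2 * e + 1)))%N; last by ring.
  rewrite partnM //; last by rewrite !muln_gt0 expn_gt0 !addn_gt0 !orbT.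
  rewrite [X in (_ * X)%N]part_p'nat ?muln1; first by rewrite p_part.
  rewrite p'natE //.
  by rewrite dvdn2 negbK !oddM oddX orbT !addn1 /= !oddM.
suff -> : V :=: H :\: supp P.
  have nsupp : H \subset 'N(supp P).
    exact: class_support_norm.
  by rewrite normsD ?normG.
apply/eqP; rewrite eqEcard oV; apply/andP; split.
  apply/subsetP=> y Vy; rewrite inE (subsetP (pHall_sub sylV)) // andbT.
  apply/negP=> /suppP[k Hk /andP[/andP[nty Py] _]].
  move: nty; rewrite -order_eq1 -dvdn1 => /negP[].
  have <- : gcdn 4 q = 1%N by apply/eqP; apply: (@coprimeXl 2 2); rewrite coprimeXr.
  rewrite dvdn_gcd -oV order_dvdG //=.
  by rewrite -(PP_card PPP) -(cardJg P k) order_dvdG.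
have s0 : supp P \subset H by apply: subset_trans (supp_sub H P) (subD1set _ _).
by rewrite cardsD (setIidPr s0) h12 leq_subLR; have := supp_card; rewrite m4 r3 => ->.
Qed.

Lemma classify_div3 : H :!=: G ->
  (exists2 A, A \in blocks & H \subset 'N(A)) \/
  (exists2 V : {group gT}, V \in 'Syl_2(G) & H \subset 'N(V)).
Proof.
move=> neHG.
have [t [oN dt le_t t0]] := PP_quo sHG h3 PPP sylHP.
have hm : (r * t * m0 = h)%N by rewrite -oN Lagrange ?subsetIl.
have x0 := supp_card.
have m0_gt0 : 0 < m0 by rewrite indexg_gt0.
have [m1|lt_m0] := PP_number sHG h3 PPP sylHP.
  by left; exists P => //; exact: index1_norm.
have [f rE] : exists f, r = (3 ^ f)%N by exists (logn 3 h); rewrite (card_Hall sylHP) p_part.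
have rmod : r = 3%N \/ 8 < r.
  move: r1; rewrite rE; case: f {rE} => [|[|f]] // _; [by left | right].
  by change (3 ^ 2 <= 3 ^ f.+2)%N; rewrite leq_exp2l.
(* If t = 1, the support of P leaves m0 elements of H, the identity included. One torus support must
   fill the rest; as it has at least h / 4 elements, r = 3, and the constraints then give h = 12. *)
have [t1|t1] := leqP t 1.
  have t_1 : t = 1%N by lia.
  rewrite t_1 muln1 in hm.
  have hr : (3 * m0 = h /\ r = 3 \/ 9 * m0 <= h)%N.
    case: rmod => hr; [left | right]; first by rewrite -hm hr.
    by rewrite -hm leq_mul2r hr orbT.
  rewrite hm in x0.
  case: (chain_ext sHG chain_P).
    by rewrite big_cons big_nil; lia.
  case=> A1 c1; have tA1 := chain_tor (s := [::]) chain_P c1.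
  have /and4P[cA1 n1 _ _] := c1.
  have [] := torus_shape sHG tA1 n1.
  move: #|H : 'N_H(A1)| => n_m1; move: (_ * n_m1)%N => a1 x1 ha1 hm1 m1_0.
  case: (chain_ext sHG c1).
    rewrite !big_cons big_nil => hh.
    have [h12 [m4 r3]] : h = 12 /\ m0 = 4%N /\ r = 3%N.
      have hh12 : h = 12 by clear -x0 hr hh x1 ha1 hm1 m1_0 lt_m0 r1; lia.
      by clear -hh12 hr lt_m0 r1; lia.
    by right; apply: sylow2_normal12.
  case=> A2 c2; have tA2 := chain_tor (s := [:: A1]) c1 c2.
  have /and4P[cA2 n2 _ _] := c2.
  have [] := torus_shape sHG tA2 n2.
  move: #|H : 'N_H(A2)| => n_m2; move: (_ * n_m2)%N => a2 x2 ha2 hm2 m2_0.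
  have := chain_le c2; rewrite !big_cons big_nil => hh.
  by clear -x0 hr hh x1 ha1 hm1 m1_0 x2 ha2 hm2 m2_0 lt_m0 r1; lia.
(* For t > 1 the second block is known: a Hall 3'-subgroup of ['N_H(P)] has order t and lies in a
   split torus K normalising P. *)
have [K KKK [sKN oHK]] : exists2 K, K \in KK & K \subset 'N_G(P) /\ #|H :&: K| = t.
  have solN := PP_norm_sol PPP.
  have [T hallT] := Hall_exists 3^' (solvableS (setSI 'N(P) sHG) solN).
  have oT : #|T| = t.
    rewrite (card_Hall hallT) oN partnM ?cardG_gt0 // part_p'nat ?mul1n.
      rewrite part_pnat_id // p'natE //; apply/negP=> d3; have := co_q_half.
      move/(coprime_dvdl (_ : 3 %| q)); rewrite dvdn_exp ?prime_gt0 // => /(_ isT).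
      by rewrite prime_coprime // (dvdn_trans d3).
    by rewrite pnatNK; exact: pHall_pgroup sylHP.
  have [K1 KK1 defN] := PP_norm_split PPP.
  have hallK1 := KK_Hall PPP defN.
  have sTN : T \subset 'N_G(P) by rewrite (subset_trans (pHall_sub hallT)) ?setSI.
  have [g Ng sTK] := Hall_subJ solN hallK1 sTN (pHall_pgroup hallT).
  have Gg : g \in G by case/setIP: Ng.
  have sKN : K1 :^ g \subset 'N_G(P).
    by rewrite -(conjGid Ng) conjSg; exact: pHall_sub hallK1.
  exists (K1 :^ g)%G; rewrite ?conjsJ //; split=> //.
  have sT : T \subset H :&: K1 :^ g.
    by rewrite subsetI sTK (subset_trans (pHall_sub hallT)) ?subsetIl.
  apply/eqP; rewrite eqn_dvd -{2}oT cardSg //= andbT.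
  have : #|H :&: K1 :^ g| %| #|'N_H(P)|.
    by rewrite cardSg // subsetI subsetIl (subset_trans (subsetIr _ _)) // (subset_trans sKN) ?subsetIr.
  rewrite oN Gauss_dvdr // rE coprimeXr // coprime_sym prime_coprime //.
  apply/negP=> d3; have := co_q_half.
  move/(coprime_dvdl (_ : 3 %| q)); rewrite dvdn_exp ?prime_gt0 // => /(_ isT).
  rewrite prime_coprime // -(KK_card KK1) -(cardJg K1 g).
  by rewrite (dvdn_trans d3) // cardSg ?subsetIr.
have cK := KK_block KKK.
have n1 : 1 < #|H :&: K| by rewrite oHK.
have c1 : chain [:: K; P].
  rewrite /= cK cP r1 n1 !andbT /= -setI_eq0.
  apply/set0Pn=> -[y /setIP[/suppP[g _ /andP[/andP[nty Ky] _]] /suppP[k _ /andP[/andP[_ Py] _]]]].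
  move: nty; rewrite -order_eq1 -dvdn1 -(eqnP co_q_half) dvdn_gcd => /negP[].
  by rewrite -(PP_card PPP) -(KK_card KKK) -(cardJg P k) -(cardJg K g) !order_dvdG.
have tK : K \in KK :|: DD by rewrite inE KKK.
have [] := torus_shape sHG tK n1; rewrite oHK.
set m1 := #|H : 'N_H(K)|; set a1 := (t * m1)%N => x1 ha1 hm1 m1_0.
have m0h : (9 * m0 <= h)%N.
  rewrite -hm leq_mul2r; apply/orP; right.
  apply: leq_trans (leq_pmulr r t0).
  by case: rmod => // r3; move: le_t t1; clear -r3; lia.
(* A torus not inverted in H leaves room for nothing else *)
case: ha1 => ha1.
  have e1 : m1 = (r * m0)%N.
    by apply/eqP; rewrite -(eqn_pmul2l t0) -/a1 ha1 -hm; apply/eqP; ring.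
  rewrite -e1 in x0.
  case: (chain_ext sHG c1).
    rewrite !big_cons big_nil => hh.
    by clearbody a1; clear -x0 x1 ha1 hh lt_m0 r1; lia.
  case=> A2 c2; have tA2 := chain_tor (s := [:: K]) c1 c2.
  have /and4P[cA2 n2 _ _] := c2.
  have [] := torus_shape sHG tA2 n2.
  move: #|H : 'N_H(A2)| => n_m2; move: (_ * n_m2)%N => a2 x2 ha2 hm2 m2_0.
  have := chain_le c2; rewrite !big_cons big_nil => hh.
  by clearbody a1; clear -x0 x1 ha1 hh m0h x2 ha2 hm2; lia.
(* Now some element of H inverts K. Counting shows that P and K do not exhaust H and that exactly
   one more torus A2 occurs. *)
have e1 : (r * m0 = 2 * m1)%N.
  by apply/eqP; rewrite -(eqn_pmul2l t0) [(t * (2 * m1))%N]mulnCA -/a1 ha1 -hm; apply/eqP; ring.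
rewrite e1 in x0.
have m01 : m0 < m1 by clear -e1 r1 m0_gt0 rmod; nia.
case: (chain_ext sHG c1).
  rewrite !big_cons big_nil => hh.
  by clearbody a1; clear -x0 x1 ha1 hh m01 hm1 m1_0 m0_gt0; lia.
case=> A2 c2; have tA2 := chain_tor (s := [:: K]) c1 c2.
have /and4P[cA2 n2 _ _] := c2.
have [] := torus_shape sHG tA2 n2.
set m2 := #|H : 'N_H(A2)|; set a2 := (_ * m2)%N => x2 ha2 hm2 m2_0.
case: (chain_ext sHG c2); last first.
  case=> A3 c3; have tA3 := chain_tor (s := [:: A2; K]) c2 c3.
  have /and4P[cA3 n3 _ _] := c3.
  have [] := torus_shape sHG tA3 n3.
  move: #|H : 'N_H(A3)| => n_m3; move: (_ * n_m3)%N => a3 x3 ha3 hm3 m3_0.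
  have := chain_le c3; rewrite !big_cons big_nil => hh.
  by clearbody a1 a2; clear -x0 x1 ha1 hh m01 x2 ha2 hm2 x3 ha3 hm3; lia.
rewrite !big_cons big_nil => hh.
have [ha2' e3] : (a2 = a1 /\ m2 + m0 = m1 + 1)%N.
  by clearbody a1 a2; clear -x0 x1 ha1 hh m01 x2 ha2 hm2; lia.
have [mE tE] := dickson_arith e1 ha2' e3 le_t lt_m0 t0.
(* H now has the parameters of PSL(2, 3^f): r = 3^f, t = (r - 1) / 2 and r + 1 Sylow 3-subgroups.
   Since t divides (q - 1) / 2, 3^f - 1 divides 3^p - 1 and f divides p. The value f = 1 contradicts
   t > 1, and f = p makes H as large as G. *)
have df : f %| p.
  apply: pow3_pred_dvd.
    by case: (f) rE r1 => // ->.
  rewrite -rE defq -tE addnK (_ : 8 * e + 3 - 1 = 2 * (4 * e + 1))%N; last by clear; lia.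
  by rewrite dvdn_pmul2l.
have /primeP[_ /(_ f df)/orP[]/eqP fE] := p_pr.
  by move: rE tE; rewrite fE => ->; clear -t1; lia.
case/eqP: neHG; apply/eqP; rewrite eqEcard sHG oG -hm mE rE fE.
have rq : (2 * t + 1 = 8 * e + 3)%N by rewrite tE rE fE.
have -> : t = (4 * e + 1)%N by clear -rq; lia.
by rewrite leq_mul2l defq; apply/orP; right; clear; lia.
Qed.

End Classify.

Theorem classify H : H \subset G -> H :!=: G ->
  (exists2 A, A \in blocks & H \subset 'N(A)) \/
  (exists2 V : {group gT}, V \in 'Syl_2(G) & H \subset 'N(V)).
Proof.
move=> sHG neHG; have [h3|h3] := boolP (3 %| #|H|).
  have [P PPP sylP] := sylow_block sHG.
  exact: classify_div3 sylP neHG.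
by left; exact: (classify_no3 sHG h3).
Qed.

(** * Element orders, involutions and four-groups *)

Lemma q_div3 : 3 %| q.
Proof. by rewrite dvdn_exp // prime_gt0. Qed.

Lemma q_odd : odd q.
Proof. by rewrite oddX orbT. Qed.

Lemma half_coprime3 : coprime 3 (4 * e + 1).
Proof. exact: coprime_dvdl q_div3 co_q_half. Qed.

Lemma half'_coprime3 : coprime 3 (4 * e + 2).
Proof. exact: coprime_dvdl q_div3 co_q_half'. Qed.

Lemma PP_order P y : P \in PP -> y \in P -> y != 1 -> #[y] = 3.
Proof. by move=> PPP; apply: abelem_order_p (PP_abelem PPP). Qed.

Lemma KK_order K y : K \in KK -> y \in K -> #[y] %| 4 * e + 1.
Proof. by move=> KKK Ky; rewrite -(KK_card KKK) order_dvdG. Qed.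

Lemma DD_order D y : D \in DD -> y \in D -> #[y] %| 4 * e + 2.
Proof. by move=> DDD Dy; rewrite -(DD_card DDD) order_dvdG. Qed.

Lemma order3_block y : y \in G -> #[y] = 3 -> exists2 P, P \in PP & y \in P.
Proof.
move=> Gy oy; have nty : y != 1 by rewrite -order_eq1 oy.
have [A cA Ay] := blocks_cover Gy nty; exists A => //.
case/setUP: cA => // /setUP[] fA.
  by have := KK_order fA Ay; rewrite oy; move: half_coprime3; rewrite prime_coprime // => /negP.
by have := DD_order fA Ay; rewrite oy; move: half'_coprime3; rewrite prime_coprime // => /negP.
Qed.

Lemma inv_block t : t \in G -> #[t] = 2 -> exists2 D, D \in DD & t \in D.
Proof.
move=> Gt ot; have ntt : t != 1 by rewrite -order_eq1 ot.
have [A cA At] := blocks_cover Gt ntt; exists A => //.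
case/setUP: cA => [fA|/setUP[] // fA].
  by have := PP_order fA At ntt; rewrite ot.
by have := KK_order fA At; rewrite ot dvdn2 oddD oddM.
Qed.

Lemma DD_inv_uniq D t u : D \in DD -> t \in D -> u \in D -> #[t] = 2 -> #[u] = 2 -> t = u.
Proof.
move=> DDD Dt Du ot ou.
have : <[t]> :==: <[u]>.
  by rewrite (eq_subG_cyclic (torus_cyclic (DD_torus DDD))) ?cycle_subG // -!orderE ot ou.
rewrite (cycle2g ou) => /eqP/setP/(_ t); rewrite cycle_id !inE => /esym/orP[|/eqP //].
by rewrite -order_eq1 ot.
Qed.

Lemma DD_has_inv D : D \in DD -> exists2 t, t \in D & #[t] = 2.
Proof.
move=> DDD; have d2 : 2 %| #|D| by rewrite (DD_card DDD) dvdn2 oddD oddM.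
by have [t Dt ot] := Cauchy (isT : prime 2) d2; exists t.
Qed.

(** Only nonsplit tori have even order; they are conjugate, and each, being cyclic, has a single
    involution. *)
Lemma inv_conj t u : t \in G -> u \in G -> #[t] = 2 -> #[u] = 2 -> exists2 g, g \in G & u = t ^ g.
Proof.
move=> Gt Gu ot ou; have [D DDD Dt] := inv_block Gt ot; have [E DDE Eu] := inv_block Gu ou.
have [g Gg defE] := conjs_trans DDD DDE; exists g => //.
by apply: (DD_inv_uniq DDE); rewrite ?orderJ // defE memJ_conjg.
Qed.

Lemma inv_cent t D : D \in DD -> t \in D -> #[t] = 2 -> 'C_G[t] = 'N_G(D).
Proof.
move=> DDD Dt ot; apply/eqP; rewrite eqEsubset !subsetI !subsetIl /=; apply/andP; split.
  by apply: (torus_cent (DD_torus DDD)); rewrite !inE Dt -order_eq1 ot.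
apply/subsetP=> y /setIP[Gy Ny]; rewrite cent1C; apply/cent1P/commgP/conjg_fixP.
by apply: (DD_inv_uniq DDD); rewrite ?orderJ // memJ_norm.
Qed.

Lemma card_inv_cent t : t \in G -> #[t] = 2 -> #|'C_G[t]| = (8 * e + 4)%N.
Proof.
move=> Gt ot; have [D DDD Dt] := inv_block Gt ot.
by rewrite (inv_cent DDD Dt ot) (DD_card_norm DDD).
Qed.

Lemma inv_cent_odd3 t y : t \in G -> #[t] = 2 -> y \in 'C_G[t] -> #[y] <> 3.
Proof.
move=> Gt ot Cy oy; have := order_dvdG Cy; rewrite card_inv_cent // oy.
have := q_div3; rewrite defq; lia.
Qed.

(** No block has order divisible by 4. This makes the Sylow 2-subgroups, of order 4, elementary
    abelian. *)
Lemma no_order4 y : y \in G -> y ^+ 4 = 1 -> y ^+ 2 = 1.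
Proof.
move=> Gy y4; have [->|nty] := eqVneq y 1; first by rewrite expg1n.
have [A cA Ay] := blocks_cover Gy nty.
have d4 : #[y] %| 4 by rewrite order_dvdn y4.
suff d2 : #[y] %| 2 by apply/eqP; rewrite -order_dvdn.
case/setUP: cA => [fA|/setUP[] fA].
- by move: d4; rewrite (PP_order fA Ay nty).
- have : #[y] %| gcdn 4 (4 * e + 1) by rewrite dvdn_gcd d4 (KK_order fA Ay).
  by rewrite mulnC gcdnMDl gcdn1 => /dvdn_trans->.
have : #[y] %| gcdn 4 (4 * e + 2) by rewrite dvdn_gcd d4 (DD_order fA Ay).
by rewrite mulnC gcdnMDl.
Qed.

Lemma card_VV V : V \in VV -> #|V| = 4.
Proof.
rewrite inE => /card_Hall->; rewrite oG.
rewrite (_ : _ * _ = 4 * (q * (4 * e + 1) * (2 * e + 1)))%N; last by ring.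
rewrite partnM //; last by rewrite !muln_gt0 expn_gt0 !addn_gt0 !orbT.
rewrite [X in (_ * X)%N]part_p'nat ?muln1; first by rewrite p_part.
by rewrite p'natE // dvdn2 negbK !oddM q_odd !addn1 /= !oddM.
Qed.

Lemma VV_sub V : V \in VV -> V \subset G.
Proof. by rewrite inE => /pHall_sub. Qed.

Lemma VV_sq V y : V \in VV -> y \in V -> y ^+ 2 = 1.
Proof.
move=> VVV Vy; apply: no_order4; first exact: subsetP (VV_sub VVV) y Vy.
by apply/eqP; rewrite -order_dvdn -(card_VV VVV) order_dvdG.
Qed.

Lemma VV_abelem V : V \in VV -> 2.-abelem V.
Proof. by move=> VVV; apply/exponent2_abelem/exponentP=> y; exact: VV_sq. Qed.

Lemma VV_inv V y : V \in VV -> y \in V -> y != 1 -> #[y] = 2.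
Proof. by move=> VVV; apply: abelem_order_p (VV_abelem VVV). Qed.

Lemma VV_mem_norm V y : V \in VV -> y \in 'N_G(V) -> y ^+ 4 = 1 -> y \in V.
Proof.
move=> VVV Ny y4; have sVN : V \subset 'N_G(V) by rewrite subsetI normG VV_sub.
have sylV : 2.-Sylow('N_G(V)) V.
  by move: VVV; rewrite inE; apply: pHall_subl; rewrite ?subsetIl.
rewrite (mem_normal_Hall sylV) //; last by rewrite /normal sVN subsetIr.
by rewrite /p_elt (pnat_dvd (_ : _ %| 4)) // order_dvdn y4.
Qed.

Lemma two_elt_order y n : #[y] = n -> n %| 4 -> y ^+ 4 = 1.
Proof. by move=> <- d4; apply/eqP; rewrite -order_dvdn. Qed.

(** An element of odd prime order centralising V would lie in the nonsplit torus of each involution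
    of V. These tori would then coincide, although a torus has only one involution. *)
Lemma VV_cent V : V \in VV -> 'C_G(V) = V.
Proof.
move=> VVV; have abV := abelem_abelian (VV_abelem VVV).
have sVC : V \subset 'C_G(V) by rewrite subsetI VV_sub.
suff C2 : 2.-group 'C_G(V).
  by move: VVV; rewrite inE => sylV; rewrite (sub_pHall sylV C2) ?subsetIl.
apply/pgroupP=> l l_pr /(Cauchy l_pr)[y /setIP[Gy Cy] oy].
have [-> //|l2] := eqVneq l 2; have y2 : y ^+ 2 != 1.
  rewrite -order_dvdn oy; apply: contra l2; by rewrite (dvdn_prime2 l_pr).
have [t Vt ntt] : exists2 t, t \in V & t != 1.
  by apply/trivgPn; rewrite -cardG_gt1 (card_VV VVV).
have [u Vu ntu] : exists2 u, u \in V & u \notin [set 1; t].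
  apply/subsetPn; apply: contraTN isT => /subset_leq_card.
  by rewrite (card_VV VVV) cards2; case: (_ == _).
have uDy z : z \in V -> z != 1 -> exists D, [/\ D \in DD, z \in D, #[z] = 2 & y \in D].
  move=> Vz ntz; have oz := VV_inv VVV Vz ntz; have Gz := subsetP (VV_sub VVV) z Vz.
  have [D DDD Dz] := inv_block Gz oz; exists D; split=> //.
  have Ny : y \in 'N_G(D).
    by rewrite -(inv_cent DDD Dz oz) in_setI Gy cent1C /=; apply/cent1P; exact/commute_sym/(centP Cy).
  by apply: contraR y2 => nDy; apply/eqP/(torus_invol (DD_torus DDD)); rewrite inE nDy.
have [D [DDD Dt ot Dy]] := uDy t Vt ntt.
move: ntu; rewrite !inE negb_or => /andP[ntu utn].
have [E [DDE Eu ou Ey]] := uDy u Vu ntu.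
have nty : y != 1 by apply: contraNneq y2 => ->; rewrite expg1n.
have DE : D = E by apply: (blocks_ti _ _ Dy Ey nty); apply: DD_block.
by case/eqP: utn; apply: (DD_inv_uniq DDE) => //; rewrite -DE.
Qed.

(* Burnside's fusion argument: V and V^g are both Sylow in the centraliser of u = t^g. *)
Lemma VV_orbit V t : V \in VV -> t \in V^# -> t ^: 'N_G(V) = V^#.
Proof.
move=> VVV /setD1P[ntt Vt]; have sVG := VV_sub VVV; have Gt := subsetP sVG t Vt.
have abV := abelem_abelian (VV_abelem VVV).
apply/setP=> u; apply/imsetP/idP=> [[g /setIP[Gg Ng] ->]|/setD1P[ntu Vu]].
  by rewrite !inE conjg_eq1 ntt memJ_norm.
have Gu := subsetP sVG u Vu.
have [g Gg defu] := inv_conj Gt Gu (VV_inv VVV Vt ntt) (VV_inv VVV Vu ntu).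
have sylV : 2.-Sylow(G) V by move: VVV; rewrite inE.
have sC z W : W \subset G -> z \in W -> abelian W -> W \subset 'C_G[z].
  move=> sWG Wz cW; rewrite subsetI sWG /=; apply: subset_trans cW _.
  by rewrite -cent_set1 centS ?sub1set.
have syl1 : 2.-Sylow('C_G[u]) V by apply: pHall_subl sylV; rewrite ?subsetIl ?sC.
have syl2 : 2.-Sylow('C_G[u]) (V :^ g).
  apply: (@pHall_subl _ _ G); rewrite ?subsetIl ?pHallJ //.
  by rewrite (@sC u (V :^ g)%G) ?abelianJ // ?defu ?memJ_conjg // -(conjGid Gg) conjSg.
have [c /setIP[Gc Cc] defV] := Sylow_trans syl2 syl1.
exists (g * c); first by rewrite inE groupM //=; apply/normP; rewrite conjsgM.
by rewrite conjgM -defu; apply/esym/conjg_fixP/commgP; rewrite cent1C in Cc; apply/cent1P.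
Qed.

(** ['N_G(V)] is transitive on the three involutions of V, and the stabiliser of one is V. Indeed an
    element y fixing t fixes or exchanges the other two, so y ^+ 2 centralises V and lies in it;
    hence y ^+ 4 = 1 and y is in V. *)
Lemma VV_card_norm V : V \in VV -> #|'N_G(V)| = 12.
Proof.
move=> VVV; have sVG := VV_sub VVV.
have abV := abelem_abelian (VV_abelem VVV).
have [t Vt ntt] : exists2 t, t \in V & t != 1.
  by apply/trivgPn; rewrite -cardG_gt1 (card_VV VVV).
have t2 := VV_sq VVV Vt.
have CV : 'C_('N_G(V))[t] = V.
  apply/eqP; rewrite eqEsubset andbC; apply/andP; split.
    rewrite !subsetI sVG normG /=; apply: subset_trans abV _.
    by rewrite -cent_set1 centS ?sub1set.
  apply/subsetP=> y /setIP[Ny Cy]; apply: VV_mem_norm => //.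
  have [Gy nVy] := setIP Ny.
  suff : y ^+ 2 \in V by move/(VV_sq VVV); rewrite -expgM.
  rewrite -(VV_cent VVV) inE groupX //=; apply/centP=> u Vu; apply/esym/commgP/conjg_fixP.
  have ty : t ^ y = t by apply/conjg_fixP/commgP; rewrite cent1C in Cy; apply/cent1P.
  have [|ntu] := boolP (u \in [set 1; t]).
    by case/set2P=> ->; rewrite ?conj1g // expgS conjgM ty.
  have uniqV z : z \in V -> z \notin [set 1; t; u] -> z = t * u.
    move=> Vz nz; have : #|V :\: [set 1; t; u]| = 1%N.
      rewrite cardsD (card_VV VVV) (setIidPr _).
        by rewrite setUC cardsU1 ntu cards2 eq_sym ntt.
      by rewrite !subUset !sub1set group1 Vt Vu.
    move/eqP/cards1P=> [w /setP defw].
    move: ntu; rewrite !inE negb_or => /andP[ntu utn].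
    have tV : t^-1 = t by apply/eqP; rewrite eq_invg_mul -expg2 t2.
    have := defw z; rewrite in_setD nz Vz in_set1 => /esym/eqP->; apply/esym/eqP.
    rewrite -in_set1 -defw in_setD groupM // andbT !inE !negb_or -andbA; apply/and3P; split.
    - by rewrite -eq_invg_mul tV eq_sym.
    - by rewrite -{2}[t]mulg1 (inj_eq (mulgI t)).
    - by rewrite -{2}[u]mul1g (inj_eq (mulIg u)).
  have Vuy : u ^ y \in V by rewrite memJ_norm.
  have [uy|nuy] := eqVneq (u ^ y) u; first by rewrite expgS conjgM uy.
  have uy : u ^ y = t * u.
    apply: uniqV => //; rewrite !inE !negb_or nuy conjg_eq1 -{1}ty (inj_eq (conjg_inj y)).
    by move: ntu; rewrite !inE negb_or => /andP[-> ->].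
  by rewrite expgS conjgM uy conjMg ty uy mulgA -expg2 t2 mul1g.
have := index_cent1 'N_G(V) t; rewrite VV_orbit //; last by rewrite !inE ntt.
rewrite CV => oV; rewrite -(Lagrange (_ : V \subset 'N_G(V))); last by rewrite subsetI sVG normG.
by rewrite oV (card_VV VVV); have := cardsD1 1 V; rewrite group1 (card_VV VVV) add1n => -[<-].
Qed.

Lemma PP_norm_odd P : P \in PP -> odd #|'N_G(P)|.
Proof. by move=> PPP; rewrite (PP_card_norm PPP) oddM q_odd oddD oddM. Qed.

(** The normaliser of a Sylow 3-subgroup S of ['N_G(V)] also normalises the block P containing S,
    hence has odd order. Its index in a group of order 12 is therefore 4. *)
Lemma VV_norm_syl3 V : V \in VV -> #|'Syl_3('N_G(V))| = 4.
Proof.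
move=> VVV; have oN := VV_card_norm VVV.
have [S sylS] := Sylow_exists 3 'N_G(V); rewrite (card_Syl sylS).
have oS : #|S| = 3 by rewrite (card_Hall sylS) oN p_part.
have sSG : S \subset G by rewrite (subset_trans (pHall_sub sylS)) ?subsetIl.
have [y Sy nty] : exists2 y, y \in S & y != 1 by apply/trivgPn; rewrite -cardG_gt1 oS.
have oy : #[y] = 3 by apply/prime_nt_dvdP; rewrite ?order_eq1 // -oS order_dvdG.
have Gy := subsetP sSG y Sy; have [P PPP Py] := order3_block Gy oy.
have sSP : S \subset P.
  have /eqP<- : <[y]> == S by rewrite eqEcard cycle_subG Sy -[#|<[y]>|]/#[y] oy oS.
  by rewrite cycle_subG.
have sNN : 'N_('N_G(V))(S) \subset 'N_G(P).
  apply/subsetP=> g /setIP[/setIP[Gg _] nSg]; rewrite inE Gg.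
  apply: (blocks_norm (PP_block PPP) Py nty Gg).
  by rewrite (subsetP sSP) // memJ_norm.
have odd_NN : odd #|'N_('N_G(V))(S)| := dvdn_odd (cardSg sNN) (PP_norm_odd PPP).
have := Lagrange (subsetIl 'N_G(V) 'N(S)); rewrite oN.
have : 3 %| #|'N_('N_G(V))(S)| by rewrite -oS cardSg // subsetI (pHall_sub sylS) normG.
case/dvdnP=> k Ek; move: odd_NN; rewrite Ek oddM andbT => k_odd.
move: #|_ : _| => i E.
have {}E : (k * i = 4)%N by apply/eqP; rewrite -(eqn_pmul2r (isT : 0 < 3)) mulnAC E.
have k4 : k <= 4 by rewrite dvdn_leq // -E dvdn_mulr.
by move: k_odd E; case: k k4 {Ek} => [|[|[|[|[|]]]]] //= _ _; clear; lia.
Qed.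

Lemma VV_norm_isog V : V \in VV -> 'N_G(V) \isog 'Alt_('I_4).
Proof.
by move=> VVV; apply: (isog_Alt4 (VV_card_norm VVV)); exact: VV_norm_syl3.
Qed.

(** * The maximal subgroups and their isomorphism types *)

Definition fams : {set {group gT}} := PP :|: (KK :|: (DD :|: VV)).

Lemma famsE : fams = blocks :|: VV.
Proof. by rewrite /fams /blocks -!setUA. Qed.

Lemma fam_norm_card A : A \in fams ->
  [\/ A \in PP /\ #|'N_G(A)| = (q * (4 * e + 1))%N,
      A \in KK /\ #|'N_G(A)| = (8 * e + 2)%N,
      A \in DD /\ #|'N_G(A)| = (8 * e + 4)%N |
      A \in VV /\ #|'N_G(A)| = 12].
Proof.
case/setUP=> [fA|/setUP[fA|/setUP[fA|fA]]].
- by constructor 1; rewrite PP_card_norm.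
- by constructor 2; rewrite KK_card_norm.
- by constructor 3; rewrite DD_card_norm.
by constructor 4; rewrite VV_card_norm.
Qed.

Lemma norm_card_ltG A : A \in fams -> #|'N_G(A)| < #|G|.
Proof.
move=> fA; have big : (8 * e + 4 < q * (4 * e + 1))%N by rewrite defq; nia.
have q1 : 0 < q by rewrite expn_gt0.
have oG2 : (q * (4 * e + 1) < #|G|)%N.
  by rewrite oG -[X in X < _]muln1 ltn_pmul2l ?muln_gt0 ?q1 //; lia.
case: (fam_norm_card fA) => -[_ ->] //; lia.
Qed.

(** Maximality rests on this: a proper subgroup containing ['N_G(A)] lies in some ['N_G(B)] by
    [classify]. Size and parity settle most cases; 12 does not divide q - 1 or q + 1 because 3
    divides q. *)
Lemma norm_card_dvd A B : A \in fams -> B \in fams ->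
  #|'N_G(A)| %| #|'N_G(B)| -> #|'N_G(A)| = #|'N_G(B)|.
Proof.
have big : (8 * e + 4 < q * (4 * e + 1))%N by rewrite defq; nia.
have oN : odd (q * (4 * e + 1)) by rewrite oddM q_odd oddD oddM.
have ndv n m : ~~ odd n -> odd m -> n %| m -> False.
  by move=> nn mm nm; move: nn; rewrite (dvdn_odd nm mm).
have lt n m : 0 < m -> m < n -> n %| m -> False.
  by move=> m0 mn /(dvdn_leq m0); rewrite leqNgt mn.
have d3 := q_div3; rewrite defq in d3.
move=> fA fB; case: (fam_norm_card fA) => -[_ ->]; case: (fam_norm_card fB) => -[_ ->] // dv; exfalso.
- by apply: lt dv; lia.
- by apply: lt dv; lia.
- by apply: lt dv; lia.
- by apply: ndv oN dv; rewrite oddD oddM.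
- have : 8 * e + 2 %| 2 by rewrite -(dvdn_addr _ (dvdnn (8 * e + 2))) -addnA.
  by apply: lt; lia.
- by apply: lt dv; lia.
- by apply: ndv oN dv; rewrite oddD oddM.
- by apply: lt dv; lia.
- by apply: lt dv; lia.
- by apply: ndv oN dv.
- by have : 3 %| 8 * e + 2; [apply: dvdn_trans dv | lia].
- by have : 3 %| 8 * e + 4; [apply: dvdn_trans dv | lia].
Qed.

Lemma fam_norm_maximal A : A \in fams -> maximal 'N_G(A) G.
Proof.
move=> fA; apply/maxgroupP; split.
  by rewrite properE subsetIl; apply: contraL (norm_card_ltG fA) => /subset_leq_card; rewrite leqNgt.
move=> H prH sNH; have neHG : H :!=: G by apply: contraTneq prH => ->; rewrite properxx.
have [B fB sHB] : exists2 B, B \in fams & H \subset 'N(B).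
  rewrite famsE; case: (classify (proper_sub prH) neHG) => -[B fB sHB]; exists B => //;
  by rewrite inE fB ?orbT.
have sHNB : H \subset 'N_G(B) by rewrite subsetI (proper_sub prH).
have E := norm_card_dvd fA fB (cardSg (subset_trans sNH sHNB)).
by apply/eqP; rewrite eq_sym eqEcard sNH E subset_leq_card.
Qed.

Lemma maximal_fam M : maximal M G -> exists2 A, A \in fams & M = 'N_G(A)%G.
Proof.
move=> maxM; have [prM maxM'] := maxgroupP maxM.
have neMG : M :!=: G by apply: contraTneq prM => ->; rewrite properxx.
have [A fA sMA] : exists2 A, A \in fams & M \subset 'N(A).
  rewrite famsE; case: (classify (proper_sub prM) neMG) => -[A fA sMA]; exists A => //;
  by rewrite inE fA ?orbT.
exists A => //; apply/val_inj/esym/maxM'; last by rewrite subsetI (proper_sub prM).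
by rewrite properE subsetIl; apply: contraL (norm_card_ltG fA) => /subset_leq_card; rewrite leqNgt.
Qed.

Lemma odd_8e2 : odd (8 * e + 2) = false. Proof. by rewrite oddD oddM. Qed.
Lemma odd_8e4 : odd (8 * e + 4) = false. Proof. by rewrite oddD oddM. Qed.

Lemma q1E : (q - 1 = 2 * (4 * e + 1))%N.
Proof. by rewrite defq; clear; lia. Qed.

Lemma q2E : (q + 1 = 2 * (4 * e + 2))%N.
Proof. by rewrite defq; clear; lia. Qed.

(** The orders of the four kinds of normaliser are distinct, so the order of a maximal subgroup
    tells which kind it is; the other types are treated in the same way. *)
Lemma borel_typeE M : maximal M G -> borel_type p G M = (#|M| == q * (4 * e + 1))%N.
Proof.
move=> maxM; apply/existsP/eqP=> [[P /existsP[K /and5P[sylP _ _ _ isoM]]]|oM].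
  by rewrite (card_isog isoM) PP_card_norm // PP_Syl.
have [A fA defM] := maximal_fam maxM; rewrite {M}defM /= in maxM oM *.
have PPA : A \in PP.
  have odd_q : odd (q * (4 * e + 1)) by rewrite oddM q_odd oddD oddM.
  by case: (fam_norm_card fA) => -[fA' oN] //; move: odd_q; rewrite -oM oN ?odd_8e2 ?odd_8e4.
have [K KKK defN] := PP_norm_split PPA.
exists A; apply/existsP; exists K; rewrite -PP_Syl PPA defN eqxx isog_refl /= andbT.
apply/andP; split.
  by rewrite (isog_abelem_card _ (PP_abelem PPA)) Cpow_abelem // card_Cpow // (PP_card PPA) /=.
rewrite (isog_cyclic_card _ (torus_cyclic (KK_torus KKK))) /= (KK_card KKK).
have -> : ((3 ^ p - 1) %/ 2 = 4 * e + 1)%N by rewrite q1E mulKn.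
by rewrite card_Zp ?addn1 // eqxx andbT Zp_cyclic.
Qed.

Lemma dihedralE n M : n \in [:: 4 * e + 1; 4 * e + 2]%N -> maximal M G ->
  dihedral_type (2 * n) M = (#|M| == 2 * n)%N.
Proof.
move=> n_in maxM; apply/idP/eqP=> [isoM|oM].
  rewrite (card_isog isoM) mul2n card_dihedral //.
  by move: n_in; rewrite !inE => /pred2P[]->; clear -e_gt2; lia.
have [A fA defM] := maximal_fam maxM; rewrite {M}defM /= in maxM oM *.
suff [tA A2 oA] : [/\ torus G A, 2 < #|A| & #|A| = n].
  by rewrite /dihedral_type -oA torus_norm_isog.
have n2 : (8 * e + 2 = 2 * n \/ 8 * e + 4 = 2 * n)%N.
  by move: n_in; rewrite !inE => /pred2P[]->; [left | right]; clear; lia.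
case: (fam_norm_card fA) => -[fA' oN].
- have : odd (q * (4 * e + 1)) by rewrite oddM q_odd oddD oddM.
  by rewrite -oN oM oddM.
- split; [exact: KK_torus | exact: K_gt2 |].
  by rewrite (KK_card fA'); move: oM; rewrite oN; clear; lia.
- split; [exact: DD_torus | exact: D_gt2 |].
  by rewrite (DD_card fA'); move: oM; rewrite oN; clear; lia.
by move: oM n2; rewrite oN; clear -e_gt2; lia.
Qed.

Lemma dihedral_q1E M : maximal M G -> dihedral_type (q - 1) M = (#|M| == 8 * e + 2)%N.
Proof.
move=> maxM; rewrite q1E dihedralE ?inE ?eqxx //.
by congr (_ == _); clear; lia.
Qed.

Lemma dihedral_q2E M : maximal M G -> dihedral_type (q + 1) M = (#|M| == 8 * e + 4)%N.
Proof.
move=> maxM; rewrite q2E dihedralE ?inE ?eqxx ?orbT //.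
by congr (_ == _); clear; lia.
Qed.

Lemma A4_typeE M : maximal M G -> A4_type M = (#|M| == 12).
Proof.
move=> maxM; apply/idP/eqP=> [isoM|oM]; first by rewrite (card_isog isoM) card_Alt4.
have [A fA defM] := maximal_fam maxM; rewrite {M}defM /= in maxM oM *.
suff VVA : A \in VV by exact: VV_norm_isog.
case: (fam_norm_card fA) => -[fA' oN] //.
- have : odd (q * (4 * e + 1)) by rewrite oddM q_odd oddD oddM.
  by rewrite -oN oM.
- by move: oN; rewrite oM; clear -e_gt2; lia.
- by move: oN; rewrite oM; clear -e_gt2; lia.
Qed.

Lemma maximal_types M : maximal M G ->
  [|| borel_type p G M, dihedral_type (q - 1) M, dihedral_type (q + 1) M | A4_type M].
Proof.
move=> maxM; rewrite borel_typeE // dihedral_q1E // dihedral_q2E // A4_typeE //.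
have [A fA ->] := maximal_fam maxM.
by case: (fam_norm_card fA) => -[_ /= ->]; rewrite eqxx ?orbT.
Qed.

(** * Counting maximal subgroups *)

Definition fix_in F x : {set {group gT}} := [set A in F | x \in 'N_G(A)].

Lemma in_fix F x A : (A \in fix_in F x) = (A \in F) && (x \in 'N_G(A)).
Proof. by rewrite in_set. Qed.

Lemma PP_norm_mem P y : P \in PP -> y \in 'N_G(P) -> #[y] = 3 -> y \in P.
Proof.
move=> PPP Ny oy; have sPN : P \subset 'N_G(P) by rewrite subsetI normG PP_sub.
have sylP : 3.-Sylow(G) P by move: PPP; rewrite PP_Syl inE.
rewrite (mem_normal_Hall (pHall_subl sPN (subsetIl _ _) sylP)) //.
  by rewrite /p_elt oy.
by rewrite /normal sPN subsetIr.
Qed.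

(** A is recovered from its normaliser: a Sylow 3-subgroup consists of the elements of order 3 and
    1, a four-group of the elements with y ^+ 4 = 1, and a torus contains every element of its
    normaliser of order above 2, in particular a generator of any other torus of the same order with
    that normaliser. *)
Lemma fam_norm_inj A B : A \in fams -> B \in fams -> 'N_G(A) = 'N_G(B) -> A = B.
Proof.
move=> fA fB eN; have oN : #|'N_G(A)| = #|'N_G(B)| by rewrite eN.
have sN C : C \in fams -> C \subset 'N_G(C).
  rewrite famsE => fC; rewrite subsetI normG andbT.
  by case/setUP: fC; [exact: blocks_sub | exact: VV_sub].
have odd_q : odd (q * (4 * e + 1)) by rewrite oddM q_odd oddD oddM.
have tor C E : torus G C -> torus G E -> 2 < #|C| -> #|C| = #|E| -> 'N_G(C) = 'N_G(E) -> C = E.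
  move=> tC tE C2 oCE nCE; apply/val_inj/eqP; rewrite eqEcard oCE leqnn andbT /=.
  have [c defC] := cyclicP (torus_cyclic tC); rewrite defC cycle_subG.
  have : c \in 'N_G(E).
    by rewrite -nCE inE (subsetP (torus_sub tC)) ?defC ?cycle_id // (subsetP (normG _)) // cycle_id.
  move=> Nc; apply: contraLR C2 => nEc; rewrite -leqNgt defC -orderE dvdn_leq //.
  by rewrite order_dvdn; apply/eqP/(torus_invol tE); rewrite inE nEc.
have [[fA' fB']|[[fA' fB']|[[fA' fB']|[fA' fB']]]] : [/\ A \in PP & B \in PP] \/ ([/\ A \in KK & B \in KK] \/
    ([/\ A \in DD & B \in DD] \/ [/\ A \in VV & B \in VV])).
  case: (fam_norm_card fA) => -[fA' oA]; case: (fam_norm_card fB) => -[fB' oB];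
  (have := oN; rewrite oA oB) => E;
  try (by left); try (by right; left); try (by right; right; left); try (by right; right; right);
  exfalso; first [by move: odd_q; rewrite E ?odd_8e2 ?odd_8e4 
               | by move: odd_q; rewrite -E ?odd_8e2 ?odd_8e4
               | by move: E; clear -e_gt2; lia].
- apply/val_inj/eqP; rewrite eq_sym eqEcard (PP_card fA') (PP_card fB') leqnn andbT.
  apply/subsetP=> y By; have [->|nty] := eqVneq y 1; first exact: group1.
  by apply: (PP_norm_mem fA'); [rewrite eN; exact: subsetP (sN B fB) y By | exact: (PP_order fB')].
- by apply: tor eN; rewrite ?(KK_card fA') ?(KK_card fB') //;
    [exact: KK_torus | exact: KK_torus | clear -e_gt2; lia].
- by apply: tor eN; rewrite ?(DD_card fA') ?(DD_card fB') //;
    [exact: DD_torus | exact: DD_torus | clear -e_gt2; lia].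
apply/val_inj/eqP; rewrite /= eq_sym eqEcard (card_VV fA') (card_VV fB') leqnn andbT.
apply/subsetP=> y By; apply: (VV_mem_norm fA'); first by rewrite eN; exact: subsetP (sN B fB) y By.
by apply/eqP; rewrite -order_dvdn -(card_VV fB') order_dvdG.
Qed.

Lemma PP_normE A : A \in fams -> (#|'N_G(A)| == q * (4 * e + 1))%N = (A \in PP).
Proof.
move=> fA; apply/eqP/idP=> [oN|]; last exact: PP_card_norm.
have odd_q : odd (q * (4 * e + 1)) by rewrite oddM q_odd oddD oddM.
by case: (fam_norm_card fA) => -[fA' oN'] //; move: odd_q; rewrite -oN oN' ?odd_8e2 ?odd_8e4.
Qed.

Lemma KK_normE A : A \in fams -> (#|'N_G(A)| == 8 * e + 2)%N = (A \in KK).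
Proof.
move=> fA; apply/eqP/idP=> [oN|]; last exact: KK_card_norm.
have odd_q : odd (q * (4 * e + 1)) by rewrite oddM q_odd oddD oddM.
case: (fam_norm_card fA) => -[fA' oN'] //; rewrite oN in oN'.
- by move: odd_q; rewrite -oN' odd_8e2.
- by move: oN'; clear; lia.
by move: oN'; clear -e_gt2; lia.
Qed.

Lemma DD_normE A : A \in fams -> (#|'N_G(A)| == 8 * e + 4)%N = (A \in DD).
Proof.
move=> fA; apply/eqP/idP=> [oN|]; last exact: DD_card_norm.
have odd_q : odd (q * (4 * e + 1)) by rewrite oddM q_odd oddD oddM.
case: (fam_norm_card fA) => -[fA' oN'] //; rewrite oN in oN'.
- by move: odd_q; rewrite -oN' odd_8e4.
- by move: oN'; clear; lia.
by move: oN'; clear -e_gt2; lia.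
Qed.

Lemma VV_normE A : A \in fams -> (#|'N_G(A)| == 12) = (A \in VV).
Proof.
move=> fA; apply/eqP/idP=> [oN|]; last exact: VV_card_norm.
have odd_q : odd (q * (4 * e + 1)) by rewrite oddM q_odd oddD oddM.
case: (fam_norm_card fA) => -[fA' oN'] //; rewrite oN in oN'.
- by move: odd_q; rewrite -oN'.
- by move: oN'; clear -e_gt2; lia.
by move: oN'; clear -e_gt2; lia.
Qed.

Lemma count_maxE F (T : {group gT} -> bool) n x :
    F \subset fams -> (forall M, maximal M G -> T M = (#|M| == n)) ->
    {in fams, forall A, (#|'N_G(A)| == n) = (A \in F)} ->
  count_max G x T = #|fix_in F x|.
Proof.
move=> sF TE FE; rewrite -(card_in_imset (f := fun A : {group gT} => 'N_G(A)%G)); last first.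
  move=> A B; rewrite !in_fix => /andP[/(subsetP sF) fA _] /andP[/(subsetP sF) fB _].
  by move/(congr1 val)=> /=; exact: fam_norm_inj.
apply: eq_card => M; rewrite !in_set; apply/idP/imsetP=> [/andP[/andP[maxM Mx]]|[A]].
  have [A fA defM] := maximal_fam maxM; rewrite TE // defM FE // => FA.
  by exists A; rewrite // in_fix FA; rewrite defM in Mx.
rewrite in_fix => /andP[FA Nx] ->; have fA := subsetP sF A FA.
by rewrite TE ?FE ?FA ?Nx ?fam_norm_maximal.
Qed.

Lemma max_over_union x : \bigcup_(M in max_over G x) M = \bigcup_(A in fix_in fams x) 'N_G(A).
Proof.
apply/setP=> y; apply/bigcupP/bigcupP=> [[M]|[A]].
  rewrite in_set => /andP[maxM Mx] My; have [A fA defM] := maximal_fam maxM.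
  by exists A; rewrite ?in_fix ?fA; rewrite defM in Mx My.
rewrite in_fix => /andP[fA Nx] Ny.
by exists 'N_G(A)%G; rewrite // in_set (fam_norm_maximal fA).
Qed.

Lemma fix_in_conj F x g :
    {in F & G, forall A g, (A :^ g)%G \in F} -> g \in G -> #|fix_in F (x ^ g)| = #|fix_in F x|.
Proof.
have le z h : {in F & G, forall A g, (A :^ g)%G \in F} -> h \in G -> #|fix_in F z| <= #|fix_in F (z ^ h)|.
  move=> FJ Gh; rewrite -(card_imset _ (act_inj 'JG h)) subset_leq_card //.
  apply/subsetP=> _ /imsetP[A /[!in_fix] /andP[FA /setIP[Gz Nz]] ->].
  by rewrite FJ //= in_setI groupJ // normJ memJ_conjg.
move=> FJ Gg; apply/eqP; rewrite eqn_leq le // andbT -{2}(conjgK g x) le ?groupV //.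
Qed.

(** Counts the pairs (y, A) with y in X normalising A. It is applied to the involutions and to the
    elements of order 3, to find c from the known k. *)
Lemma double_count F (X : {set gT}) c k :
    X \subset G -> {in X, forall y, #|fix_in F y| = c} ->
    {in F, forall A, #|X :&: 'N_G(A)| = k} -> (#|X| * c = #|F| * k)%N.
Proof.
move=> sXG cX kF; rewrite -sum_nat_const -[RHS]sum_nat_const.
rewrite (eq_bigr (fun y => \sum_(A in F | y \in 'N_G(A)) 1)); last first.
  by move=> y Xy; rewrite -(cX y Xy) sum1dep_card.
rewrite (exchange_big_dep (mem F)) /=; last by move=> y A _ /andP[].
apply: eq_bigr => A FA; rewrite -(kF A FA) sum1dep_card; apply: eq_card => y.
by rewrite in_set in_setI FA.
Qed.

Lemma conjs_fixJ A0 : {in conjs G A0 & G, forall A g, (A :^ g)%G \in conjs G A0}.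
Proof. by move=> A g; apply: conjsJ. Qed.

Lemma VV_fixJ : {in VV & G, forall A g, (A :^ g)%G \in VV}.
Proof. by move=> V g; rewrite !inE => sylV Gg; rewrite pHallJ. Qed.

Lemma card_VVs : (#|VV| * 12 = #|G|)%N.
Proof.
have [V sylV] := Sylow_exists 2 G; rewrite (card_Syl sylV) mulnC.
have VVV : V \in VV by rewrite inE.
by rewrite -(VV_card_norm VVV) Lagrange ?subsetIl.
Qed.

(** The order of y divides 12, and y lies in a block. In a split torus it would be 1; in a nonsplit
    one it would divide 4 and put y in V. *)
Lemma VV_norm_order V y : V \in VV -> y \in 'N_G(V) -> y \notin V -> #[y] = 3.
Proof.
move=> VVV Ny nVy; have [Gy _] := setIP Ny.
have nty : y != 1 by apply: contraNneq nVy => ->.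
have d12 : #[y] %| 4 * 3 by rewrite -[(4 * 3)%N](VV_card_norm VVV) order_dvdG.
have [A cA Ay] := blocks_cover Gy nty.
case/setUP: cA => [fA|/setUP[] fA]; first exact: (PP_order fA).
  have dK := KK_order fA Ay; case/eqP: nty; apply/eqP; rewrite -order_eq1 -dvdn1.
  have co : coprime (4 * 3) (4 * e + 1).
    rewrite coprimeMl half_coprime3 andbT (@coprimeXl 2 2) // coprime2n oddD oddM //.
  by rewrite -(eqnP co) dvdn_gcd d12.
have dD := DD_order fA Ay; case/negP: nVy; apply: (VV_mem_norm VVV Ny).
apply: (two_elt_order (erefl _)); rewrite -(Gauss_dvdl _ (_ : coprime _ 3)) //.
by rewrite coprime_sym; apply: coprime_dvdr dD half'_coprime3.
Qed.

(* V :&: W contains z and z^y, which differ as 3 does not divide |C_G(z)| = q + 1. *)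
Lemma VV_separate V W z y : V \in VV -> W \in VV -> z \in V -> z \in W -> #[z] = 2 ->
  y \in 'N_G(V) -> y \in 'N_G(W) -> #[y] = 3 -> V = W.
Proof.
move=> VVV VVW Vz Wz oz NVy NWy oy.
have [Gy nVy] := setIP NVy; have [_ nWy] := setIP NWy; have Gz := subsetP (VV_sub VVV) z Vz.
have nzy : z ^ y != z.
  apply/eqP=> /conjg_fixP/commgP zy; apply: (inv_cent_odd3 Gz oz _ oy).
  by rewrite in_setI Gy; apply/cent1P.
have sub : [set 1; z; z ^ y] \subset V :&: W.
  by rewrite !subUset !sub1set group1 !in_setI Vz Wz !memJ_norm // Vz Wz.
have c3 : #|[set 1; z; z ^ y]| = 3.
  have nz : z != 1 by rewrite -order_eq1 oz.
  by rewrite setUC cardsU1 cards2 in_set2 conjg_eq1 (negPf nzy) [1 == z]eq_sym (negPf nz).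
have d4 : #|V :&: W| %| 4 by rewrite -(card_VV VVV) cardSg ?subsetIl.
have o4 : #|V :&: W| = 4.
  have := subset_leq_card sub; rewrite c3; move: (dvdn_leq (isT : 0 < 4) d4) (d4).
  by case: #|_| => [|[|[|[|[|]]]]].
have E U : U \in VV -> V :&: W \subset U -> V :&: W = U.
  by move=> VVU sU; apply/eqP; rewrite eqEcard sU o4 (card_VV VVU).
by apply/val_inj; rewrite /= -(E V) ?subsetIl // [RHS](esym (E W VVW _)) // subsetIr.
Qed.

(** * Maximal subgroups containing an involution *)

Section Involution.

Variable x : gT.
Hypotheses (Gx : x \in G) (ox : #[x] = 2).

Definition invols : {set gT} := [set y in G | #[y] == 2].

Lemma involsE : invols = x ^: G.
Proof.
apply/setP=> y; rewrite inE; apply/andP/imsetP=> [[Gy /eqP oy]|[g Gg ->]].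
  by have [g Gg ->] := inv_conj Gx Gy ox oy; exists g.
by rewrite groupJ // orderJ ox.
Qed.

Lemma card_invols : #|invols| = (q * (4 * e + 1))%N.
Proof.
rewrite involsE -index_cent1 -divgS ?subsetIl // oG card_inv_cent // mulnK //.
by clear; lia.
Qed.

Lemma invols_fix F : {in F & G, forall A g, (A :^ g)%G \in F} ->
  {in invols, forall y, #|fix_in F y| = #|fix_in F x|}.
Proof. by move=> FJ y; rewrite involsE => /imsetP[g Gg ->]; rewrite fix_in_conj. Qed.

Lemma invols_sub : invols \subset G.
Proof. by apply/subsetP=> y /setIdP[]. Qed.

Lemma torus_invols A : torus G A -> 2 < #|A| ->
  invols :&: 'N_G(A) = ('N_G(A) :\: A) :|: (invols :&: A).
Proof.
move=> tA A2; apply/setP=> y; rewrite in_setU in_setI in_setD in_setI.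
have [Ay|nAy] /= := boolP (y \in A).
  by rewrite (subsetP (torus_sub_norm tA)) // andbT.
rewrite andbF orbF; apply/andP/idP=> [[] //|Ny]; split=> //.
have [Gy _] := setIP Ny; rewrite inE Gy; apply/eqP/nt_prime_order => //.
  by apply: (torus_invol tA); rewrite inE nAy.
by apply: contraNneq nAy => ->.
Qed.

Lemma inv_fix_PP : fix_in PP x = set0.
Proof.
apply/eqP; rewrite -subset0; apply/subsetP=> P; rewrite in_fix => /andP[PPP Nx].
by have := dvdn_odd (order_dvdG Nx) (PP_norm_odd PPP); rewrite ox.
Qed.

Lemma card_torus_norm_diff A : torus G A -> 2 < #|A| -> #|'N_G(A) :\: A| = #|A|.
Proof.
move=> tA A2; rewrite cardsD (setIidPr (torus_sub_norm tA)) (card_torus_norm tA A2).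
by rewrite mul2n -addnn addnK.
Qed.

Lemma KK_invols K : K \in KK -> #|invols :&: 'N_G(K)| = (4 * e + 1)%N.
Proof.
move=> KKK; have tK := KK_torus KKK; have K2 := K_gt2 KKK.
rewrite torus_invols // (_ : invols :&: K = set0).
  by rewrite setU0 card_torus_norm_diff // KK_card.
apply/eqP; rewrite -subset0; apply/subsetP=> y /setIP[/setIdP[_ /eqP oy] Ky].
by have := KK_order KKK Ky; rewrite oy dvdn2 oddD oddM.
Qed.

Lemma DD_invols D : D \in DD -> #|invols :&: D| = 1%N.
Proof.
move=> DDD; have [t Dt ot] := DD_has_inv DDD.
rewrite (_ : _ :&: _ = [set t]) ?cards1 //; apply/setP=> y; rewrite !inE.
apply/andP/eqP=> [[/andP[_ /eqP oy] Dy]|->].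
  exact: (DD_inv_uniq DDD).
by rewrite ot Dt (subsetP (torus_sub (DD_torus DDD))).
Qed.

Lemma DD_norm_invols D : D \in DD -> #|invols :&: 'N_G(D)| = (4 * e + 3)%N.
Proof.
move=> DDD; have tD := DD_torus DDD; have D2 := D_gt2 DDD.
rewrite torus_invols // cardsU DD_invols // card_torus_norm_diff // DD_card //.
rewrite (_ : _ :&: _ = set0) ?cards0; first by clear; lia.
by apply/setP=> y; rewrite !inE; case: (y \in D); rewrite ?andbF.
Qed.

Lemma VV_norm_invols V : V \in VV -> #|invols :&: 'N_G(V)| = 3.
Proof.
move=> VVV; have -> : invols :&: 'N_G(V) = V^#.
  apply/setP=> y; rewrite in_setI in_setD1; apply/andP/andP=> [[/setIdP[Gy /eqP oy] Ny]|[nty Vy]].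
    rewrite -order_eq1 oy; split=> //; apply: (VV_mem_norm VVV Ny).
    exact: two_elt_order oy _.
  have Gy := subsetP (VV_sub VVV) y Vy.
  by rewrite inE Gy (VV_inv VVV) // in_setI Gy (subsetP (normG V)).
by have := cardsD1 1 V; rewrite group1 (card_VV VVV) add1n => -[<-].
Qed.

Lemma inv_fix_KK : #|fix_in KK x| = (4 * e + 2)%N.
Proof.
have E := double_count invols_sub (invols_fix (@conjs_fixJ K0)) KK_invols.
apply/eqP; rewrite -(eqn_pmul2l (_ : 0 < #|invols|)) ?E ?card_invols ?muln_gt0 ?expn_gt0 ?addn1 //.
by rewrite card_KK; apply/eqP; ring.
Qed.

Lemma inv_fix_DD : #|fix_in DD x| = (4 * e + 3)%N.
Proof.
have E := double_count invols_sub (invols_fix (@conjs_fixJ D0)) DD_norm_invols.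
apply/eqP; rewrite -(eqn_pmul2l (_ : 0 < #|invols|)) ?E ?card_invols ?muln_gt0 ?expn_gt0 ?addn1 //.
by rewrite card_DD; apply/eqP; ring.
Qed.

Lemma inv_fix_VV : #|fix_in VV x| = (2 * e + 1)%N.
Proof.
have E := double_count invols_sub (invols_fix VV_fixJ) VV_norm_invols.
apply/eqP; rewrite -(eqn_pmul2l (_ : 0 < #|invols|)) ?E ?card_invols ?muln_gt0 ?expn_gt0 ?addn1 //.
rewrite -(eqn_pmul2r (isT : 0 < 4)) -mulnA -[(3 * 4)%N]/12 card_VVs oG.
by apply/eqP; ring.
Qed.

Lemma inv_fix_sub A y : A \in fix_in fams x -> y \in 'N_G(A) -> y ^+ 2 != 1 ->
  (A \in KK :|: DD) && (y \in A) || (A \in VV) && (#[y] == 3) && (x \in A).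
Proof.
rewrite in_fix => /andP[fA Nx] Ny y2.
have tor : torus G A -> y \in A.
  by move=> tA; apply: contraR y2 => nAy; apply/eqP/(torus_invol tA); rewrite inE nAy.
case/setUP: fA => [fA|/setUP[fA|/setUP[fA|fA]]].
- have : A \in fix_in PP x by rewrite in_fix fA.
  by rewrite inv_fix_PP inE.
- by rewrite in_setU fA tor //; exact: KK_torus.
- by rewrite in_setU fA orbT tor //; exact: DD_torus.
rewrite fA orbC /= (VV_norm_order fA Ny) ?eqxx /=.
  by rewrite (VV_mem_norm fA Nx) //; exact: two_elt_order ox _.
by apply: contra y2 => Ay; apply/eqP; exact: (VV_sq fA).
Qed.

(** If y ^+ 2 is not 1, then by [inv_fix_sub] A is either a torus containing y or a four-group
    containing x with y of order 3, and likewise B. Two tori sharing y are equal, two such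
    four-groups are equal by [VV_separate], and the mixed case fails because tori have no elements
    of order 3. *)
Lemma inv_meet A B y : A \in fix_in fams x -> B \in fix_in fams x -> A != B ->
  y \in 'N_G(A) :&: 'N_G(B) -> y ^+ 2 = 1.
Proof.
move=> fA fB neAB /setIP[Ay By]; apply/eqP; apply: contraR neAB => y2; apply/eqP.
have nty : y != 1 by apply: contraNneq y2 => ->; rewrite expg1n.
have mix C : C \in KK :|: DD -> y \in C -> #[y] == 3 -> False.
  move=> tC Cy /eqP oy; case/setUP: tC => tC.
    by have := KK_order tC Cy; rewrite oy; have := half_coprime3; rewrite prime_coprime // => /negP.
  by have := DD_order tC Cy; rewrite oy; have := half'_coprime3; rewrite prime_coprime // => /negP.
have blk C : C \in KK :|: DD -> C \in blocks by rewrite [_ \in blocks]in_setU => ->; rewrite orbT.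
case/orP: (inv_fix_sub fA Ay y2) => [/andP[tA yA]|/andP[/andP[VA oy] xA]];
case/orP: (inv_fix_sub fB By y2) => [/andP[tB yB]|/andP[/andP[VB oy'] xB]].
- exact: (blocks_ti (blk _ tA) (blk _ tB) yA yB).
- by case: (mix A).
- by case: (mix B).
exact: (VV_separate VA VB xA xB ox Ay By (eqP oy)).
Qed.

(** The intersection has exponent 2 and contains x, so it is a nontrivial subgroup of a
    four-group. *)
Lemma inv_meet_isog A B : A \in fix_in fams x -> B \in fix_in fams x -> A != B ->
  ('N_G(A) :&: 'N_G(B) \isog Zp 2) || ('N_G(A) :&: 'N_G(B) \isog Cpow 2 2).
Proof.
move=> fA fB neAB; set I := [group of 'N_G(A) :&: 'N_G(B)].
have abI : 2.-abelem I by apply/exponent2_abelem/exponentP=> y; exact: inv_meet fA fB neAB.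
have Ix : x \in I by move: fA fB; rewrite !in_fix => /andP[_ xA] /andP[_ xB]; rewrite in_setI xA.
have sIG : I \subset G := subset_trans (subsetIl _ _) (subsetIl _ _).
have [V sylV sIV] := Sylow_superset sIG (abelem_pgroup abI).
have d4 : #|I| %| 4 by rewrite -(card_VV (_ : V \in VV)) ?inE // cardSg.
have d2 : 2 %| #|I| by rewrite -ox order_dvdG.
have [o2|o4] : #|I| = 2 \/ #|I| = 4.
  by move: (dvdn_leq (isT : 0 < 4) d4) (d4) d2; case: #|_| => [|[|[|[|[|]]]]] // _ _ _; [left|right].
- apply/orP; left; rewrite (isog_cyclic_card _ (prime_cyclic (_ : prime #|I|))) ?o2 //.
  by rewrite Zp_cyclic card_Zp.
by apply/orP; right; rewrite (isog_abelem_card _ abI) Cpow_abelem // card_Cpow // o4.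
Qed.

End Involution.

Lemma sum_fixU F F' x (f : {group gT} -> nat) : [disjoint F & F'] ->
  (\sum_(A in fix_in (F :|: F') x) f A = \sum_(A in fix_in F x) f A + \sum_(A in fix_in F' x) f A)%N.
Proof.
move=> dF; rewrite -bigU; last first.
  apply: disjointW dF; apply/subsetP=> A; by rewrite in_fix => /andP[].
by apply: eq_bigl => A; rewrite [RHS]inE /= !in_fix in_setU andb_orl.
Qed.

Lemma disjoint_card F F' n m : {in F, forall A, #|A| = n} -> {in F', forall A, #|A| = m} ->
  n != m -> [disjoint F & F'].
Proof.
move=> Fn Fm nm; rewrite -setI_eq0; apply: contraR nm => /set0Pn[A /setIP[FA FA']].
by rewrite -(Fn A FA) (Fm A FA').
Qed.

Lemma sum_fix x (f : {group gT} -> nat) :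
  (\sum_(A in fix_in fams x) f A =
   \sum_(A in fix_in PP x) f A + (\sum_(A in fix_in KK x) f A +
     (\sum_(A in fix_in DD x) f A + \sum_(A in fix_in VV x) f A)))%N.
Proof.
have cP := PP_card; have cK := KK_card; have cD := DD_card; have cV := card_VV.
have d1 : [disjoint DD & VV] by apply: disjoint_card cD cV _; clear -e_gt2; lia.
have d2 : [disjoint KK & DD] by apply: disjoint_card cK cD _; clear -e_gt2; lia.
have d3 : [disjoint KK & VV] by apply: disjoint_card cK cV _; clear -e_gt2; lia.
have d4 : [disjoint PP & KK] by apply: disjoint_card cP cK _; rewrite defq; clear -e_gt2; lia.
have d5 : [disjoint PP & DD] by apply: disjoint_card cP cD _; rewrite defq; clear -e_gt2; lia.
have d6 : [disjoint PP & VV] by apply: disjoint_card cP cV _; rewrite defq; clear -e_gt2; lia.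
have dU F1 F2 F3 : [disjoint F1 & F2] -> [disjoint F1 & F3] -> [disjoint F1 & F2 :|: F3].
  by rewrite -!setI_eq0 setIUr => /eqP-> /eqP->; rewrite setU0.
by rewrite !sum_fixU // !dU.
Qed.

Lemma sum_fix_const F x (f : {group gT} -> nat) n : {in F, forall A, f A = n} ->
  \sum_(A in fix_in F x) f A = (#|fix_in F x| * n)%N.
Proof.
move=> Fn; rewrite -sum_nat_const; apply: eq_bigr => A.
by rewrite in_fix => /andP[/Fn].
Qed.

Lemma fam_norm_sol A : A \in fams -> solvable 'N_G(A).
Proof.
have quo B r : B \subset G -> solvable B -> prime r -> #|'N_G(B)| = (r * #|B|)%N -> solvable 'N_G(B).
  move=> sBG solB r_pr oN; have nBN : B <| 'N_G(B) by rewrite /normal subsetI sBG normG subsetIr.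
  rewrite (series_sol nBN) solB /=; apply: (@pgroup_sol _ r).
  rewrite /pgroup card_quotient ?subsetIr // -divgS ?normal_sub // oN mulnK ?cardG_gt0 //.
  exact: pnat_id.
case/setUP=> [fA|/setUP[fA|/setUP[fA|fA]]].
- exact: PP_norm_sol.
- have tA := KK_torus fA; apply: (@quo A 2); rewrite ?(torus_sub tA) //.
    exact: abelian_sol (torus_abelian tA).
  by rewrite (card_torus_norm tA) // K_gt2.
- have tA := DD_torus fA; apply: (@quo A 2); rewrite ?(torus_sub tA) //.
    exact: abelian_sol (torus_abelian tA).
  by rewrite (card_torus_norm tA) // D_gt2.
apply: (@quo A 3); rewrite ?(VV_sub fA) //.
  exact: abelian_sol (abelem_abelian (VV_abelem fA)).
by rewrite (VV_card_norm fA) (card_VV fA).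
Qed.

(* A nontrivial k in K0 acts on P0 without fixed points, so P0 = [P0, k] lies in the
   derived subgroup, which therefore contains all the Sylow 3-subgroups. *)
Lemma not_solvable_G : ~~ solvable G.
Proof.
apply/negP=> solG.
have ntG : G :!=: 1.
  rewrite -cardG_gt1; apply: leq_trans (_ : #|P0| <= _); last by rewrite subset_leq_card // sub_P0_G.
  by rewrite (psl_oP data) defq; clear -e_gt2; lia.
have prG : G^`(1) \proper G := sol_der1_proper solG (subxx G) ntG.
have [nPK sKN defN nPK' tiPK] := sdprod_context (psl_defNP data).
have cP : abelian P0 := abelem_abelian (psl_abelP data).
have sPG := sub_P0_G.
have [k Kk ntk] : exists2 k, k \in K0 & k != 1.
  by apply/trivgPn; rewrite -cardG_gt1 (psl_oK data); clear -e_gt2; lia.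
have Gk : k \in G by rewrite (subsetP (torus_sub (psl_torK data))).
have nPk : k \in 'N(P0) by rewrite (subsetP nPK').
have sP0 : P0 \subset G^`(1).
  have inj : {in P0 &, injective (fun u => [~ u, k])}.
    move=> u v Pu Pv E; apply/eqP; rewrite eq_mulVg1 -eq_invg_mul invgK.
    apply: contraR ntk => nuv; set w := v * u^-1; have Pw : w \in P0 by rewrite groupM ?groupV.
    have ntw : w != 1 by rewrite /w -eq_mulgV1 eq_sym.
    have wk : w ^ k = w.
      move: E; rewrite !commgEl => E.
      rewrite /w conjMg conjVg.
      have -> : v ^ k = v * u^-1 * u ^ k by rewrite -mulgA E mulKVg.
      by rewrite mulgK.
    have : k \in P0.
      apply: (subsetP (psl_centP data (x := w) _)); first by rewrite in_setD1 ntw.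
      by rewrite in_setI Gk /= cent1C; apply/cent1P/commgP/conjg_fixP.
    by move=> Pk; rewrite -in_set1 -[[set 1]]/(1 : {set gT}) -tiPK inE Pk.
  have <- : [set [~ u, k] | u in P0] = P0.
    apply/eqP; rewrite eqEcard card_in_imset // leqnn andbT.
    by apply/subsetP=> _ /imsetP[u Pu ->]; rewrite commgEl groupM ?groupV ?memJ_norm.
  by apply/subsetP=> _ /imsetP[u Pu ->]; rewrite mem_commg // (subsetP sPG).
have sP P : P \in PP -> P \subset G^`(1).
  case/conjsP=> g Gg ->; have /normP <- : g \in 'N(G^`(1)).
    by rewrite (subsetP (der_norm 1 G)).
  by rewrite /= conjSg.
have neG : G^`(1) :!=: G by apply: contraTneq prG => ->; rewrite properxx.
(* A maximal subgroup containing the derived subgroup has order divisible by q, so it normalises a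
   Sylow 3-subgroup and contains no other one, while all 8e + 4 of them lie in the derived
   subgroup. *)
case: (maximal_exists (proper_sub prG)) => [E|[M maxM sGM]]; first by rewrite E eqxx in neG.
have [A fA defM] := maximal_fam maxM; rewrite {M maxM}defM /= in sGM.
have dq : q %| #|'N_G(A)|.
  by rewrite -(psl_oP data) cardSg // (subset_trans sP0).
have PPA : A \in PP.
  case: (fam_norm_card fA) => -[fA' oN] //; move: dq; rewrite oN defq.
  - by move/(dvdn_leq (ltn_addl _ (isT : 0 < 2))); clear; lia.
  - rewrite (_ : 8 * e + 4 = 8 * e + 3 + 1)%N; last by clear; lia.
    by rewrite dvdn_addr // dvdn1; clear; lia.
  by move/(dvdn_leq (isT : 0 < 12)); clear -e_gt2; lia.
have : #|PP| <= 1.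
  rewrite -(cards1 A) subset_leq_card //; apply/subsetP=> P PPP; rewrite inE.
  apply/eqP/val_inj/eqP; rewrite /= eqEcard (PP_card PPP) (PP_card PPA) leqnn andbT.
  apply/subsetP=> y Py; have [->|nty] := eqVneq y 1; first exact: group1.
  apply: (PP_norm_mem PPA); last exact: (PP_order PPP).
  exact: subsetP (subset_trans (sP P PPP) sGM) y Py.
by rewrite card_PP; clear; lia.
Qed.

Lemma Sol_union x : x \in G -> Sol G x = \bigcup_(M in max_over G x) M.
Proof.
move=> Gx; apply/setP=> y; apply/setIdP/bigcupP=> [[Gy soly]|[M]].
  have sxy : <<[set x; y]>> \subset G by rewrite gen_subG subUset !sub1set Gx.
  case: (maximal_exists sxy) => [E|[M maxM sM]].
    by have /negP[] := not_solvable_G; rewrite -E.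
  have [xM yM] : x \in M /\ y \in M.
    by split; apply: (subsetP sM); rewrite mem_gen ?set21 ?set22.
  by exists M; rewrite // inE maxM.
rewrite inE => /andP[maxM Mx] My; have [A fA defM] := maximal_fam maxM.
have sMG := proper_sub (maxgroupp maxM).
split; first exact: subsetP sMG y My.
apply: solvableS (fam_norm_sol fA); rewrite gen_subG subUset !sub1set.
by rewrite defM in Mx My; rewrite Mx.
Qed.

(** * The order of the solubilizer of an involution *)

Section Involution.

Variable x : gT.
Hypotheses (Gx : x \in G) (ox : #[x] = 2).

(* Every involution y lies in a maximal subgroup containing x, since x inverts the
   product x * y and hence normalises the block containing it. *)
Lemma inv_card_Sol : #|Sol G x| = (q * (q + 1))%N.
Proof.
rewrite Sol_union // max_over_union.
set C := [set 1] :|: invols.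
have sC : C \subset \bigcup_(A in fix_in fams x) 'N_G(A).
  have blk A : A \in blocks -> A \in fams by rewrite famsE => fA; rewrite in_setU fA.
  apply/subsetP=> y /setU1P Cy; have {Cy}[Gy yy] : y \in G /\ y ^+ 2 = 1.
    case: Cy => [->|/setIdP[Gy /eqP oy]]; first by rewrite group1 expg1n.
    by rewrite Gy; split=> //; apply/eqP; rewrite -order_dvdn oy.
  have [xy1|ntxy] := eqVneq (x * y) 1.
    have [D DDD Dx] := inv_block Gx ox.
    have Nx : x \in 'N_G(D) by rewrite (subsetP (torus_sub_norm (DD_torus DDD))).
    apply/bigcupP; exists D; first by rewrite in_fix blk // DD_block.
    by move/eqP: xy1; rewrite -eq_invg_mul => /eqP<-; rewrite groupV.
  have [A bA Axy] := blocks_cover (groupM Gx Gy) ntxy.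
  have xV : x^-1 = x by apply/eqP; rewrite eq_invg_mul -expg2 -order_dvdn ox.
  have yV : y^-1 = y by apply/eqP; rewrite eq_invg_mul -expg2 yy.
  have Nx : x \in 'N_G(A).
    rewrite inE Gx; apply: (blocks_norm bA Axy ntxy Gx).
    have -> : (x * y) ^ x = (x * y)^-1 by rewrite conjgE -mulgA mulKg invMg xV yV.
    by rewrite groupV.
  apply/bigcupP; exists A; first by rewrite in_fix blk.
  rewrite -[y](mulKg x) groupM ?groupV // inE groupM //= (subsetP (normG A)) //.
rewrite (card_bigcup_common sC); last first.
  move=> A B fA fB neAB; apply/subsetP=> y Iy; have y2 := inv_meet ox fA fB neAB Iy.
  have Gy : y \in G by case/setIP: Iy => /setIP[].
  rewrite !inE Gy; have [//|nty] := eqVneq y 1; apply/eqP.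
  exact: nt_prime_order.
have n1 : 1 \notin invols by rewrite in_set group1 order1.
have oC A : #|'N_G(A) :\: C| = (#|'N_G(A)| - #|invols :&: 'N_G(A)|.+1)%N.
  rewrite cardsD; congr (_ - _)%N; rewrite /C setIUr (setIidPr _) ?sub1G //.
  by rewrite cardsU1 in_setI (negPf n1) andbF [_ :&: invols]setIC.
have oC1 : #|C| = (q * (4 * e + 1)).+1.
  by rewrite cardsU1 n1 (card_invols Gx ox).
rewrite sum_fix (inv_fix_PP ox) big_set0 oC1.
(* The values 4e, 4e and 8 are the numbers of elements of order above 2 in normalisers of split
   tori, nonsplit tori and four-groups. *)
rewrite (@sum_fix_const KK x _ (4 * e)); last first.
  by move=> K KKK; rewrite oC KK_card_norm // KK_invols //; clear; lia.
rewrite (@sum_fix_const DD x _ (4 * e)); last first.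
  by move=> D DDD; rewrite oC DD_card_norm // DD_norm_invols //; clear; lia.
rewrite (@sum_fix_const VV x _ 8); last first.
  by move=> V VVV; rewrite oC VV_card_norm // VV_norm_invols.
rewrite (inv_fix_KK Gx ox) (inv_fix_DD Gx ox) (inv_fix_VV Gx ox) defq.
rewrite -addn1; ring.
Qed.

End Involution.

(** * Elements of order 3 *)

Section Order3.

Variable x : gT.
Hypotheses (Gx : x \in G) (ox : #[x] = 3).

Definition elts3 : {set gT} := [set y in G | #[y] == 3].

Let nonreal y : y \in G -> #[y] = 3 -> y^-1 \notin y ^: G.
Proof.
move=> Gy oy; apply/imsetP=> -[g Gg yg].
have nty : y != 1 by rewrite -order_eq1 oy.
have [P PPP Py] := order3_block Gy oy.
have Ng : g \in 'N_G(P).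
  rewrite inE Gg; apply: (blocks_norm (PP_block PPP) Py nty Gg).
  by rewrite -yg groupV.
have og : odd #[g] := dvdn_odd (order_dvdG Ng) (PP_norm_odd PPP).
(* g ^+ 2 centralises y, and g, having odd order, is a power of g ^+ 2; so g both centralises and
   inverts y. *)
have yg2 : y ^ (g ^+ 2) = y by rewrite expgS conjgM -yg conjVg -yg invgK.
have gg2 : g = (g ^+ 2) ^+ (#[g].+1)./2.
  by rewrite -expgM mul2n halfK /= og /= subn0 expgS expg_order mulg1.
have : y ^ g = y.
  rewrite gg2; apply/conjg_fixP/commgP/commuteX.
  by apply/commgP/conjg_fixP.
move=> yy; have : y ^+ 2 = 1 by rewrite expg2 -{1}[y]invgK yg yy mulVg.
by move/eqP; rewrite -order_dvdn oy.
Qed.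

Lemma card_elts3 : #|elts3| = ((8 * e + 2) * (8 * e + 4))%N.
Proof.
have -> : elts3 = supp G P0.
  apply/setP=> y; rewrite inE; apply/andP/suppP=> [[Gy /eqP oy]|[g Gg /andP[/andP[nty Py] Gy]]].
    have [P /conjsP[g Gg defP] Py] := order3_block Gy oy.
    by exists g; rewrite // -order_eq1 oy Gy -[_ :^ g]/(gval (P0 :^ g)%G) -defP Py.
  by rewrite Gy (PP_order (P := (P0 :^ g)%G)) // conjsJ ?conjs_refl.
have cP := PP_block (conjs_refl G P0).
have GP : G :&: P0 = P0 by apply/setIidPr; exact: sub_P0_G.
rewrite card_supp //; last by rewrite GP (blocks_nt cP).
rewrite GP (psl_oP data) -card_conjs card_PP defq.
by congr (_ * _)%N; clear; lia.
Qed.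

Lemma card_class3 y : y \in G -> #[y] = 3 -> #|y ^: G| = ((4 * e + 1) * (8 * e + 4))%N.
Proof.
move=> Gy oy; have nty : y != 1 by rewrite -order_eq1 oy.
have [P PPP Py] := order3_block Gy oy.
have CP : 'C_G[y] = P.
  apply/eqP; rewrite eqEsubset (PP_cent PPP) ?in_setD1 ?nty //= subsetI PP_sub //=.
  apply: subset_trans (abelem_abelian (PP_abelem PPP)) _.
  by rewrite -cent_set1 centS ?sub1set.
rewrite -index_cent1 CP -divgS ?PP_sub // oG PP_card // -mulnA mulKn //.
by rewrite expn_gt0.
Qed.

(* x is not conjugate to its inverse: an element inverting x normalises the Sylow
   3-subgroup of x, whose normaliser has odd order. *)
Lemma elts3E : elts3 = x ^: G :|: x^-1 ^: G.
Proof.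
apply/esym/eqP; rewrite eqEcard; apply/andP; split.
  rewrite subUset; apply/andP; split; apply/subsetP=> _ /imsetP[g Gg ->];
  by rewrite inE groupJ ?groupV // orderJ ?orderV ox.
have oxV : #[x^-1] = 3 by rewrite orderV.
rewrite cardsU !card_class3 ?groupV // card_elts3 (_ : _ :&: _ = set0).
  by rewrite cards0 subn0 leq_eqVlt; apply/orP; left; apply/eqP; ring.
apply/eqP; rewrite -subset0; apply/subsetP=> y /setIP[xy xVy].
have /negP[] := nonreal Gx ox.
by rewrite -(class_eqP xy) (class_eqP xVy) class_refl.
Qed.

(** The elements of order 3 form two classes, but x and its inverse lie in the same subgroups. *)
Lemma elts3_fix F : {in F & G, forall A g, (A :^ g)%G \in F} ->
  {in elts3, forall y, #|fix_in F y| = #|fix_in F x|}.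
Proof.
move=> FJ y; rewrite elts3E => /setUP[] /imsetP[g Gg ->]; rewrite fix_in_conj //.
by apply: eq_card => A; rewrite !in_fix groupV.
Qed.

Lemma elts3_sub : elts3 \subset G.
Proof. by apply/subsetP=> y /setIdP[]. Qed.

Lemma VV_norm_elts3 V : V \in VV -> #|elts3 :&: 'N_G(V)| = 8.
Proof.
move=> VVV; have -> : elts3 :&: 'N_G(V) = 'N_G(V) :\: V.
  apply/setP=> y; rewrite in_setI in_setD andbC; have [Ny|] := boolP (y \in 'N_G(V)); last by rewrite andbF.
  have [Gy _] := setIP Ny; rewrite inE Gy andbT; apply/eqP/idP=> [oy|].
    by apply/negP=> Vy; have := order_dvdG Vy; rewrite oy (card_VV VVV).
  exact: VV_norm_order.
have sVN : V \subset 'N_G(V) by rewrite subsetI VV_sub ?normG.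
by rewrite cardsD (setIidPr sVN) (VV_card_norm VVV) (card_VV VVV).
Qed.

Lemma fix3_VV : (3 * #|fix_in VV x| = q)%N.
Proof.
have E := double_count elts3_sub (elts3_fix (@VV_fixJ)) VV_norm_elts3.
have pos : 0 < 4 * ((8 * e + 2) * (8 * e + 4)) by rewrite !muln_gt0 !addn_gt0 !orbT.
apply/eqP; rewrite -(eqn_pmul2l pos) -{1}card_elts3.
rewrite (_ : 4 * #|elts3| * (3 * #|fix_in VV x|) = 12 * (#|elts3| * #|fix_in VV x|))%N; last by ring.
rewrite E mulnA [(12 * _)%N]mulnC card_VVs oG.
apply/eqP; ring.
Qed.

Lemma fix3_PP : exists2 P, P \in PP & fix_in PP x = [set P].
Proof.
have [P PPP Px] := order3_block Gx ox; exists P => //.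
have ntx : x != 1 by rewrite -order_eq1 ox.
apply/setP=> B; rewrite in_fix in_set1; apply/andP/eqP=> [[PPB Nx]|->].
  have Bx := PP_norm_mem PPB Nx ox.
  exact: (blocks_ti (PP_block PPB) (PP_block PPP) Bx Px).
by rewrite PPP inE Gx (subsetP (normG P)).
Qed.

Lemma fix3_KK : fix_in KK x = set0.
Proof.
apply/eqP; rewrite -subset0; apply/subsetP=> K; rewrite in_fix => /andP[KKK Nx].
have := order_dvdG Nx; rewrite ox KK_card_norm //.
by have := q_div3; rewrite defq; clear; lia.
Qed.

Lemma fix3_DD : fix_in DD x = set0.
Proof.
apply/eqP; rewrite -subset0; apply/subsetP=> K; rewrite in_fix => /andP[DDK Nx].
have := order_dvdG Nx; rewrite ox DD_card_norm //.
by have := q_div3; rewrite defq; clear; lia.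
Qed.

Lemma fix3_sub A : A \in fix_in fams x -> A \in fix_in PP x \/ A \in fix_in VV x.
Proof.
move=> fA; have := fA; rewrite in_fix => /andP[/setUP[fA'|/setUP[fA'|/setUP[fA'|fA']]] Nx].
- by left; rewrite in_fix fA'.
- by have : A \in fix_in KK x; [rewrite in_fix fA' | rewrite fix3_KK inE].
- by have : A \in fix_in DD x; [rewrite in_fix fA' | rewrite fix3_DD inE].
by right; rewrite in_fix fA'.
Qed.

(** A common involution would force A and B to be four-groups containing it, equal by [VV_separate];
    so the intersection has odd order. Only one Sylow 3-subgroup is normalised by x, so A or B is a
    four-group and the order divides 12, hence 3. *)
Lemma meet3 A B : A \in fix_in fams x -> B \in fix_in fams x -> A != B ->
  'N_G(A) :&: 'N_G(B) = <[x]>.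
Proof.
move=> fA fB neAB; set I := [group of 'N_G(A) :&: 'N_G(B)].
have xA : x \in 'N_G(A) by move: fA; rewrite in_fix => /andP[].
have xB : x \in 'N_G(B) by move: fB; rewrite in_fix => /andP[].
have oddI : odd #|I|.
  have [//|] := boolP (odd #|I|); rewrite -dvdn2 => /(Cauchy (isT : prime 2))[z /setIP[zA zB] oz].
  have inV C : C \in fix_in fams x -> z \in 'N_G(C) -> C \in VV /\ z \in C.
    move=> fC zC; case: (fix3_sub fC); rewrite in_fix => /andP[fC' _].
      by have := dvdn_odd (order_dvdG zC) (PP_norm_odd fC'); rewrite oz.
    by split=> //; apply: (VV_mem_norm fC' zC); exact: two_elt_order oz _.
  have [VA Az] := inV A fA zA; have [VB Bz] := inV B fB zB.
  by case/eqP: neAB; exact: (VV_separate VA VB Az Bz oz xA xB ox).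
have d12 : #|I| %| 12.
  case: (fix3_sub fA) => fA'; last first.
    rewrite -(VV_card_norm (V := A)) ?cardSg ?subsetIl //.
    by move: fA'; rewrite in_fix => /andP[].
  case: (fix3_sub fB) => fB'; last first.
    rewrite -(VV_card_norm (V := B)) ?cardSg ?subsetIr //.
    by move: fB'; rewrite in_fix => /andP[].
  have [P _ defP] := fix3_PP; case/eqP: neAB.
  by move: fA' fB'; rewrite defP !inE => /eqP-> /eqP->.
apply/esym/eqP; rewrite eqEcard cycle_subG in_setI xA xB -orderE ox dvdn_leq //.
have : coprime #|I| (2 ^ 2) by rewrite coprimeXr // coprimen2.
by move/Gauss_dvdr <-.
Qed.

Lemma meet3_isog A B : A \in fix_in fams x -> B \in fix_in fams x -> A != B ->
  'N_G(A) :&: 'N_G(B) \isog Zp 3.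
Proof.
move=> fA fB neAB; rewrite (meet3 fA fB neAB) isog_cyclic_card ?cycle_cyclic //.
by rewrite Zp_cyclic card_Zp // -orderE ox.
Qed.

Lemma card_Sol3 : #|Sol G x| = ((q * (q + 5)) %/ 2)%N.
Proof.
rewrite Sol_union // max_over_union.
have [P PPP defP] := fix3_PP.
have sC : <[x]> \subset \bigcup_(A in fix_in fams x) 'N_G(A).
  have PP_x : x \in 'N_G(P) by move/setP/(_ P): defP; rewrite in_set1 eqxx in_fix => /andP[].
  apply: (bigcup_max P); last by rewrite cycle_subG.
  by rewrite in_fix PP_x andbT in_setU PPP.
rewrite (card_bigcup_common sC); last by move=> A B fA fB neAB; rewrite (meet3 fA fB neAB).
rewrite -orderE ox sum_fix fix3_KK fix3_DD !big_set0 defP big_set1 !add0n.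
have oC A : A \in fix_in fams x -> #|'N_G(A) :\: <[x]>| = (#|'N_G(A)| - 3)%N.
  rewrite in_fix => /andP[_]; rewrite -cycle_subG => sxN.
  by rewrite cardsD (setIidPr sxN) -orderE ox.
have sub F A : F \subset fams -> A \in fix_in F x -> A \in fix_in fams x.
  by move=> sF; rewrite !in_fix => /andP[/(subsetP sF)-> ->].
rewrite oC; last first.
  by apply: (@sub PP); rewrite ?subsetUl // defP in_set1.
rewrite PP_card_norm //.
rewrite (eq_bigr (fun _ => 9)); last first.
  move=> V fV; rewrite oC; last by apply: (@sub VV) => //; rewrite /fams !setUA subsetUr.
  by move: fV; rewrite in_fix => /andP[VVV _]; rewrite VV_card_norm.
rewrite sum_nat_const -[9]/(3 * 3)%N mulnA [(#|_| * 3)%N]mulnC fix3_VV addnA subnKC.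
  have -> : (q * (q + 5) = 2 * (q * (4 * e + 1) + q * 3))%N.
    by rewrite {2}defq; ring.
  by rewrite mulKn.
by rewrite defq; clear; lia.
Qed.

End Order3.

(** * Elements of a split torus *)

Section Torus.

Variables (x : gT) (K : {group gT}).
Hypotheses (KKK : K \in KK) (Kx : x \in K) (ntx : x != 1).

Let Gx : x \in G := subsetP (torus_sub (KK_torus KKK)) x Kx.
Let ox := KK_order KKK Kx.

Let odd_x : odd #[x].
Proof. by apply: dvdn_odd ox _; rewrite oddD oddM. Qed.

Let x2 : x ^+ 2 != 1.
Proof.
rewrite -order_dvdn; apply: contra ntx => d2; rewrite -order_eq1.
by have := dvdn_leq (isT : 0 < 2) d2; move: d2 odd_x; case: #[x] => [|[|[|]]].
Qed.

Lemma fixK_KK : fix_in KK x = [set K].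
Proof.
apply/setP=> B; rewrite in_fix in_set1; apply/andP/eqP=> [[KKB Nx]|->].
  have Bx : x \in B.
    by apply: contraR x2 => nBx; apply/eqP/(torus_invol (KK_torus KKB)); rewrite in_setD nBx.
  exact: (blocks_ti (KK_block KKB) (KK_block KKK) Bx Kx).
by rewrite KKK in_setI Gx (subsetP (normG K)).
Qed.

Lemma fixK_DD : fix_in DD x = set0.
Proof.
apply/eqP; rewrite -subset0; apply/subsetP=> D; rewrite in_fix => /andP[DDD Nx].
have Dx : x \in D.
  by apply: contraR x2 => nBx; apply/eqP/(torus_invol (DD_torus DDD)); rewrite in_setD nBx.
have := blocks_ti (DD_block DDD) (KK_block KKK) Dx Kx ntx.
move=> E; have := DD_card DDD; rewrite E (KK_card KKK); clear; lia.
Qed.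

Lemma fixK_VV : fix_in VV x = set0.
Proof.
apply/eqP; rewrite -subset0; apply/subsetP=> V; rewrite in_fix => /andP[VVV Nx].
have [Vx|nVx] := boolP (x \in V); first by have := x2; rewrite (VV_sq VVV Vx) eqxx.
have o3 := VV_norm_order VVV Nx nVx.
by have := ox; rewrite o3; have := half_coprime3; rewrite prime_coprime // => /negP.
Qed.

(** The split tori in ['N_G(P)] are its Hall 3'-subgroups, hence conjugate in it. They are
    self-normalising there, since the elements inverting a torus are involutions and ['N_G(P)] has
    odd order. *)
Lemma PP_norm_KK P : P \in PP ->
  #|[set B in KK | B \subset 'N_G(P)]| = q.
Proof.
move=> PPP; have [K1 KK1 defN] := PP_norm_split PPP.
have hallK1 := KK_Hall PPP defN.
have solN := PP_norm_sol PPP.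
have sKN := pHall_sub hallK1.
have K1_2 := K_gt2 KK1; have tK1 := KK_torus KK1.
have -> : [set B in KK | B \subset 'N_G(P)] = conjs 'N_G(P) K1.
  apply/setP=> B; rewrite inE; apply/andP/conjsP=> [[KKB sBN]|[g Ng ->]].
    have p3 : 3^'.-group B.
      rewrite /pgroup (KK_card KKB) p'natE //.
      by have := half_coprime3; rewrite prime_coprime.
    have [g Ng sBK] := Hall_subJ solN hallK1 sBN p3; exists g => //.
    apply/val_inj/eqP; rewrite eqEcard sBK /= cardJg.
    by rewrite (KK_card KKB) (KK_card KK1).
  rewrite conjsJ ?(subsetP (subsetIl _ _) _ Ng) //.
  by rewrite /= -(conjGid Ng) conjSg.
rewrite card_conjs (_ : 'N_('N_G(P))(K1) = K1).
  rewrite -divgS // PP_card_norm // KK_card // mulnK //.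
  by rewrite addn1.
apply/esym/eqP; rewrite eqEsubset subsetI sKN normG /=; apply/subsetP=> y /setIP[Ny nKy].
apply: contraT => nK1y; have [Gy _] := setIP Ny.
have y2 : y ^+ 2 = 1 by apply: (torus_invol tK1); rewrite in_setD nK1y in_setI Gy.
have := dvdn_odd (order_dvdG Ny) (PP_norm_odd PPP).
rewrite (nt_prime_order (isT : prime 2) y2) //.
by apply: contraNneq nK1y => ->.
Qed.

(** If x normalises P, then it lies in a Hall 3'-subgroup of ['N_G(P)]; this is a split torus
    sharing x with K, hence K itself. *)
Lemma fixK_PPE : fix_in PP x = [set P in PP | K \subset 'N_G(P)].
Proof.
apply/setP=> P; rewrite in_fix [RHS]in_set; apply/andP/andP=> -[PPP]; last first.
  by move=> sKN; split=> //; exact: subsetP sKN x Kx.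
move=> Nx; split=> //; have [K1 KK1 defN] := PP_norm_split PPP.
have hallK1 := KK_Hall PPP defN.
have p3 : 3^'.-group <[x]>.
  rewrite /pgroup -orderE p'natE //; apply/negP=> d3.
  by have := dvdn_trans d3 ox; have := half_coprime3; rewrite prime_coprime // => /negP.
have sxN : <[x]> \subset 'N_G(P) by rewrite cycle_subG.
have [g Ng] := Hall_subJ (PP_norm_sol PPP) hallK1 sxN p3.
rewrite cycle_subG => K1x; have Gg : g \in G by case/setIP: Ng.
have E := blocks_ti (KK_block KKK) (KK_block (conjsJ KK1 Gg)) Kx K1x ntx.
by rewrite E /= -(conjGid Ng) conjSg (pHall_sub hallK1).
Qed.

(* Pairs of a split torus and a Sylow 3-subgroup that it normalises. *)
Lemma fixK_PP : #|fix_in PP x| = 2.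
Proof.
rewrite fixK_PPE.
have cst B : B \in KK -> #|[set P in PP | B \subset 'N_G(P)]| = #|[set P in PP | K \subset 'N_G(P)]|.
  move=> KKB; have [g Gg ->] := conjs_trans KKK KKB.
  rewrite -[RHS](card_imset _ (act_inj 'JG g)); apply: eq_card => P; rewrite in_set.
  apply/andP/imsetP=> [[PPP sBN]|[R /[!in_set] /andP[PPR sKN] ->]].
    exists (P :^ g^-1)%G; last by apply: val_inj; rewrite /= conjsgKV.
    rewrite in_set conjsJ ?groupV //= normJ -[X in X :&: _](conjGid (groupVr Gg)) -conjIg.
    by rewrite -[gval K](conjsgK g) conjSg.
  by rewrite conjsJ //= normJ -[X in X :&: _](conjGid Gg) -conjIg conjSg.
have E : (#|KK| * #|[set P in PP | K \subset 'N_G(P)]| = #|PP| * q)%N.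
  rewrite -!sum_nat_const (eq_bigr (fun B : {group gT} => \sum_(P in PP | B \subset 'N_G(P)) 1)); last first.
    by move=> B KKB; rewrite -(cst B KKB) sum1dep_card; apply: eq_card => P; rewrite !in_set.
  rewrite (exchange_big_dep (mem PP)) /=; last by move=> ? ? _ /andP[].
  apply: eq_bigr => P PPP; rewrite -(PP_norm_KK PPP) sum1dep_card; apply: eq_card => B.
  by rewrite !in_set PPP.
have pos : 0 < #|KK| by rewrite card_KK muln_gt0 expn_gt0 addn_gt0 orbT.
apply/eqP; rewrite -(eqn_pmul2l pos) E card_KK card_PP; apply/eqP; ring.
Qed.

End Torus.

Section Split.

Variables (x : gT) (K : {group gT}).
Hypotheses (KKK : K \in KK) (Kx : x \in K) (ntx : x != 1).

Let tK := KK_torus KKK.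
Let Gx : x \in G := subsetP (torus_sub tK) x Kx.

Lemma fixK_sub A : A \in fix_in fams x ->
  (A \in PP /\ K \subset 'N_G(A)) \/ A = K.
Proof.
move=> fA; have := fA; rewrite in_fix => /andP[/setUP[fA'|/setUP[fA'|/setUP[fA'|fA']]] Nx].
- have : A \in fix_in PP x by rewrite in_fix fA'.
  by rewrite (fixK_PPE KKK Kx ntx) => /setIdP[_ sKN]; left.
- have : A \in fix_in KK x by rewrite in_fix fA'.
  by rewrite (fixK_KK KKK Kx ntx) in_set1 => /eqP->; right.
- have : A \in fix_in DD x by rewrite in_fix fA'.
  by rewrite (fixK_DD KKK Kx ntx) in_set0.
have : A \in fix_in VV x by rewrite in_fix fA'.
by rewrite (fixK_VV KKK Kx ntx) in_set0.
Qed.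

(** For two Sylow 3-subgroups, the intersection I contains K and meets A trivially, so that the
    product of A and I inside ['N_G(A)] bounds the order of I by that of K. If one of A, B is K,
    parity excludes the elements inverting K. *)
Lemma meetK A B : A \in fix_in fams x -> B \in fix_in fams x -> A != B ->
  'N_G(A) :&: 'N_G(B) = K.
Proof.
have tor P : P \in PP -> K \subset 'N_G(P) -> 'N_G(P) :&: 'N_G(K) = K.
  move=> PPP sKN; apply/eqP; rewrite eqEsubset subsetI sKN (torus_sub_norm tK) !andbT.
  apply/subsetP=> y /setIP[Py Ny]; apply: contraT => nKy.
  have y2 : y ^+ 2 = 1 by apply: (torus_invol tK); rewrite in_setD nKy.
  have := dvdn_odd (order_dvdG Py) (PP_norm_odd PPP).
  rewrite (nt_prime_order (isT : prime 2) y2) //.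
  by apply: contraNneq nKy => ->.
move=> /fixK_sub[[PPA sKA]|->] /fixK_sub[[PPB sKB]|->] neAB; last by rewrite eqxx in neAB.
- set I := [group of 'N_G(A) :&: 'N_G(B)].
  have tiIA : A :&: I = 1.
    apply/trivgP/subsetP=> y /setIP[Ay /setIP[_ By]]; rewrite in_set1.
    apply: contraR neAB => nty; apply/eqP.
    have By' := PP_norm_mem PPB By (PP_order PPA Ay nty).
    exact: (blocks_ti (PP_block PPA) (PP_block PPB) Ay By' nty).
  apply/esym/eqP; rewrite eqEcard subsetI sKA sKB (KK_card KKK) /=.
  rewrite -[#|_ :&: _|]/#|I| -(leq_pmul2l (_ : 0 < q)) ?expn_gt0 //.
  rewrite -(PP_card PPA) -(TI_cardMg tiIA) (PP_card PPA) -(PP_card_norm PPA).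
  rewrite subset_leq_card // mul_subG ?subsetIl // subsetI normG (PP_sub PPA) //.
- exact: tor.
by rewrite setIC; exact: tor.
Qed.

Lemma meetK_isog A B : A \in fix_in fams x -> B \in fix_in fams x -> A != B ->
  'N_G(A) :&: 'N_G(B) \isog Zp ((q - 1) %/ 2).
Proof.
move=> fA fB neAB; rewrite (meetK fA fB neAB) isog_cyclic_card ?(torus_cyclic tK) //.
by rewrite Zp_cyclic q1E mulKn // card_Zp ?(KK_card KKK) ?eqxx // addn1.
Qed.

Lemma card_SolK : #|Sol G x| = (q * (q - 1))%N.
Proof.
rewrite Sol_union // max_over_union.
have sNK A : A \in fix_in fams x -> K \subset 'N_G(A).
  by case/fixK_sub=> [[] //|->]; exact: torus_sub_norm tK.
have fK : K \in fix_in fams x.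
  by rewrite in_fix !in_setU KKK orbT (subsetP (torus_sub_norm tK)).
have sC : K \subset \bigcup_(A in fix_in fams x) 'N_G(A).
  by apply: (bigcup_max K) => //; exact: sNK.
rewrite (card_bigcup_common sC); last by move=> A B fA fB neAB; rewrite (meetK fA fB neAB).
rewrite sum_fix (fixK_KK KKK Kx ntx) (fixK_DD KKK Kx ntx) (fixK_VV KKK Kx ntx).
rewrite !big_set0 big_set1 addn0.
have oC A : A \in fix_in fams x -> #|'N_G(A) :\: K| = (#|'N_G(A)| - (4 * e + 1))%N.
  by move=> fA; rewrite cardsD (setIidPr (sNK A fA)) (KK_card KKK).
rewrite oC // (KK_card_norm KKK) (KK_card KKK).
rewrite (eq_bigr (fun _ => (q * (4 * e + 1) - (4 * e + 1)))%N); last first.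
  move=> P fP; rewrite oC; last by move: fP; rewrite !in_fix in_setU => /andP[-> ->].
  by move: fP; rewrite in_fix => /andP[PPP _]; rewrite PP_card_norm.
rewrite sum_nat_const (fixK_PP KKK Kx ntx) q1E defq.
rewrite (_ : (8 * e + 3) * (4 * e + 1) = (8 * e + 2) * (4 * e + 1) + (4 * e + 1))%N; last by ring.
rewrite addnK (_ : 8 * e + 2 - (4 * e + 1) = 4 * e + 1)%N; last by clear; lia.
ring.
Qed.

End Split.

(** * Elements of a nonsplit torus of order above 2 *)

Section Nonsplit.

Variables (x : gT) (D : {group gT}).
Hypotheses (DDD : D \in DD) (Dx : x \in D) (x2 : x ^+ 2 != 1).

Let tD := DD_torus DDD.
Let Gx : x \in G := subsetP (torus_sub tD) x Dx.
Let ox := DD_order DDD Dx.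
Let ntx : x != 1. Proof. by apply: contraNneq x2 => ->; rewrite expg1n. Qed.

Lemma fixD_PP : fix_in PP x = set0.
Proof.
apply/eqP; rewrite -subset0; apply/subsetP=> P; rewrite in_fix => /andP[PPP Nx].
have := order_dvdG Nx; rewrite (PP_card_norm PPP) => d1.
have co : coprime (q * (4 * e + 1)) (4 * e + 2).
  by rewrite coprimeMl co_q_half' co_halves.
have : #[x] %| 1 by rewrite -(eqnP co) dvdn_gcd d1 ox.
by rewrite dvdn1 order_eq1 (negPf ntx).
Qed.

Lemma fixD_KK : fix_in KK x = set0.
Proof.
apply/eqP; rewrite -subset0; apply/subsetP=> K; rewrite in_fix => /andP[KKK Nx].
have Kx : x \in K.
  by apply: contraR x2 => nKx; apply/eqP/(torus_invol (KK_torus KKK)); rewrite in_setD nKx.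
have E := blocks_ti (DD_block DDD) (KK_block KKK) Dx Kx ntx.
by have := DD_card DDD; rewrite E (KK_card KKK); clear; lia.
Qed.

Lemma fixD_DD : fix_in DD x = [set D].
Proof.
apply/setP=> B; rewrite in_fix in_set1; apply/andP/eqP=> [[DDB Nx]|->].
  have Bx : x \in B.
    by apply: contraR x2 => nBx; apply/eqP/(torus_invol (DD_torus DDB)); rewrite in_setD nBx.
  exact: (blocks_ti (DD_block DDB) (DD_block DDD) Bx Dx).
by rewrite DDD (subsetP (torus_sub_norm tD)).
Qed.

Lemma fixD_VV : fix_in VV x = set0.
Proof.
apply/eqP; rewrite -subset0; apply/subsetP=> V; rewrite in_fix => /andP[VVV Nx].
have [Vx|nVx] := boolP (x \in V); first by have := x2; rewrite (VV_sq VVV Vx) eqxx.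
have o3 := VV_norm_order VVV Nx nVx.
by have := ox; rewrite o3; have := half'_coprime3; rewrite prime_coprime // => /negP.
Qed.

Lemma card_SolD : #|Sol G x| = (q + 1)%N.
Proof.
rewrite Sol_union // max_over_union.
have -> : fix_in fams x = [set D].
  rewrite -fixD_DD; apply/setP=> A; rewrite !in_fix !in_setU.
  have /setP/(_ A) := fixD_PP; have /setP/(_ A) := fixD_KK; have /setP/(_ A) := fixD_VV.
  rewrite !in_fix !in_set0; case: (x \in _); rewrite ?andbF // !andbT => -> -> ->.
  by rewrite orbF.
by rewrite big_set1 (DD_card_norm DDD) defq; clear; lia.
Qed.

End Nonsplit.

(** * Assembly of the four cases *)

Lemma meets_in_fix x (T : {set gT} -> bool) :
    {in fix_in fams x &, forall A B, A != B -> T ('N_G(A) :&: 'N_G(B))} ->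
  meets_in G x T.
Proof.
move=> TP M N; rewrite !in_set => /andP[maxM Mx] /andP[maxN Nx] neMN.
have [A fA defM] := maximal_fam maxM; have [B fB defN] := maximal_fam maxN.
rewrite {M maxM}defM in Mx neMN *; rewrite {N maxN}defN in Nx neMN *.
apply: TP; rewrite ?in_fix ?fA ?fB //.
by apply: contraNneq neMN => ->.
Qed.

Lemma psl2_data_counts x :
  [/\ count_max G x (borel_type p G) = #|fix_in PP x|,
      count_max G x (dihedral_type (q - 1)) = #|fix_in KK x|,
      count_max G x (dihedral_type (q + 1)) = #|fix_in DD x|
    & count_max G x (@A4_type _) = #|fix_in VV x|].
Proof.
have sP : PP \subset fams by rewrite subsetUl.
have sK : KK \subset fams by rewrite /fams setUCA subsetUl.
have sD : DD \subset fams by rewrite /fams setUA setUCA subsetUl.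
have sV : VV \subset fams by rewrite /fams !setUA subsetUr.
split.
- exact: (count_maxE x sP borel_typeE PP_normE).
- exact: (count_maxE x sK dihedral_q1E KK_normE).
- exact: (count_maxE x sD dihedral_q2E DD_normE).
- exact: (count_maxE x sV A4_typeE VV_normE).
Qed.

Lemma order_cases x : x \in G -> x != 1 ->
  [\/ #[x] = 2, #[x] = 3,
      #[x] <> 2 /\ exists2 K, K \in KK & x \in K |
      #[x] <> 2 /\ exists2 D, D \in DD & x \in D].
Proof.
move=> Gx ntx; have [A cA Ax] := blocks_cover Gx ntx.
have [->|o2] := eqVneq #[x] 2; first by constructor 1.
case/setUP: cA => [fA|/setUP[fA|fA]].
- by constructor 2; exact: (PP_order fA).
- by constructor 3; split; [exact/eqP | exists A].
- by constructor 4; split; [exact/eqP | exists A].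
Qed.

Theorem psl2_data_main :
  (forall M : {group gT}, maximal M G ->
     [|| borel_type p G M, dihedral_type (q - 1) M, dihedral_type (q + 1) M
       | A4_type M]) /\
  (forall x : gT, x \in G -> x != 1 ->
     [/\ [\/ #[x] = 2, #[x] = 3, #[x] <> 2 /\ #[x] %| q - 1
           | #[x] <> 2 /\ #[x] %| q + 1],
         Sol G x = \bigcup_(M in max_over G x) M
       & [/\ #[x] = 2 ->
               [/\ count_max G x (borel_type p G) = 0,
                   count_max G x (dihedral_type (q - 1)) = (q + 1) %/ 2,
                   count_max G x (dihedral_type (q + 1)) = (q + 3) %/ 2,
                   count_max G x (@A4_type _) = (q + 1) %/ 4
                 & meets_in G x (fun I => (I \isog Zp 2) || (I \isog Cpow 2 2))
                   /\ #|Sol G x| = (q * (q + 1))%N],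
             #[x] = 3 ->
               [/\ count_max G x (borel_type p G) = 1%N,
                   count_max G x (dihedral_type (q - 1)) = 0,
                   count_max G x (dihedral_type (q + 1)) = 0,
                   count_max G x (@A4_type _) = q %/ 3
                 & meets_in G x (fun I => I \isog Zp 3)
                   /\ #|Sol G x| = ((q * (q + 5)) %/ 2)%N],
             #[x] <> 2 -> #[x] %| q - 1 ->
               [/\ count_max G x (borel_type p G) = 2,
                   count_max G x (dihedral_type (q - 1)) = 1%N,
                   count_max G x (dihedral_type (q + 1)) = 0,
                   count_max G x (@A4_type _) = 0
                 & meets_in G x (fun I => I \isog Zp ((q - 1) %/ 2))
                   /\ #|Sol G x| = (q * (q - 1))%N]
           & #[x] <> 2 -> #[x] %| q + 1 ->
               [/\ count_max G x (borel_type p G) = 0,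
                   count_max G x (dihedral_type (q - 1)) = 0,
                   count_max G x (dihedral_type (q + 1)) = 1%N,
                   count_max G x (@A4_type _) = 0
                 & #|Sol G x| = (q + 1)%N]]]).
Proof.
split=> [M|x Gx ntx]; first exact: maximal_types.
have [-> -> -> ->] := psl2_data_counts x.
split; last split.
- case: (order_cases Gx ntx) => [o2|o3|[o2 [K KKK Kx]]|[o2 [D DDD Dx]]].
  + by constructor 1.
  + by constructor 2.
  + constructor 3; split=> //; rewrite q1E dvdn_mull //.
    exact: (KK_order KKK Kx).
  constructor 4; split=> //; rewrite q2E dvdn_mull //.
  exact: (DD_order DDD Dx).
- exact: Sol_union.
- move=> ox; split.
  + by rewrite (inv_fix_PP ox) cards0.
  + by rewrite (inv_fix_KK Gx ox) q2E mulKn.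
  + rewrite (inv_fix_DD Gx ox) defq (_ : 8 * e + 3 + 3 = 2 * (4 * e + 3))%N ?mulKn //.
    by clear; lia.
  + rewrite (inv_fix_VV Gx ox) defq (_ : 8 * e + 3 + 1 = 4 * (2 * e + 1))%N ?mulKn //.
    by clear; lia.
  split; last exact: (inv_card_Sol Gx ox).
  by apply: meets_in_fix => A B fA fB; exact: (inv_meet_isog ox fA fB).
- move=> ox; split.
  + by have [P _ ->] := fix3_PP Gx ox; rewrite cards1.
  + by rewrite (fix3_KK ox) cards0.
  + by rewrite (fix3_DD ox) cards0.
  + by rewrite -(fix3_VV Gx ox) mulKn.
  split; last exact: (card_Sol3 Gx ox).
  by apply: meets_in_fix => A B fA fB; exact: (meet3_isog Gx ox fA fB).
(* Order 3 does not divide q - 1, and in a nonsplit torus the order would divide both q - 1 and q +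
   1, hence 2. *)
- move=> o2 dq; have [K KKK Kx] : exists2 K, K \in KK & x \in K.
    case: (order_cases Gx ntx) => [//|o3|[_ //]|[_ [D DDD Dx]]].
      by have := q_div3; move: dq; rewrite o3 defq; clear; lia.
    have d2 : #[x] %| 2.
      have := dvdn_mull 2 (DD_order DDD Dx); rewrite -q2E.
      have -> : (q + 1 = q - 1 + 2)%N by rewrite defq; clear; lia.
      by rewrite dvdn_addr.
    have := dvdn_leq (isT : 0 < 2) d2; have := order_gt0 x; move: ntx; rewrite -order_eq1.
    by case: #[x] o2 => [|[|[|]]].
  split.
  + exact: (fixK_PP KKK Kx ntx).
  + by rewrite (fixK_KK KKK Kx ntx) cards1.
  + by rewrite (fixK_DD KKK Kx ntx) cards0.
  + by rewrite (fixK_VV KKK Kx ntx) cards0.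
  split; last exact: (card_SolK KKK Kx ntx).
  by apply: meets_in_fix => A B fA fB; exact: (meetK_isog KKK Kx ntx fA fB).
move=> o2 dq.
have x2 : x ^+ 2 != 1.
  by rewrite -order_dvdn; apply/negP=> d2; apply: o2; apply/prime_nt_dvdP; rewrite ?order_eq1.
have [D DDD Dx] : exists2 D, D \in DD & x \in D.
  case: (order_cases Gx ntx) => [//|o3|[_ [K KKK Kx]]|[_ //]].
    by have := q_div3; move: dq; rewrite o3 defq; clear; lia.
  have d2 : #[x] %| 2.
    have := dvdn_mull 2 (KK_order KKK Kx); rewrite -q1E => d1.
    by move: dq; have -> : (q + 1 = q - 1 + 2)%N; [rewrite defq; clear; lia | rewrite dvdn_addr].
  by move: x2; rewrite -order_dvdn d2.
split.
- by rewrite (fixD_PP DDD Dx x2) cards0.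
- by rewrite (fixD_KK DDD Dx x2) cards0.
- by rewrite (fixD_DD DDD Dx x2) cards1.
- by rewrite (fixD_VV DDD Dx x2) cards0.
exact: (card_SolD DDD Dx x2).
Qed.

End Dickson.

(** * SL(2,q) and PSL(2,q) *)

Section TwoByTwo.

Local Open Scope ring_scope.
Import GRing.Theory.

Variable R : comNzRingType.

Definition mx2 (a b c d : R) : 'M[R]_2 :=
  \matrix_(i < 2, j < 2) if i == 0 then (if j == 0 then a else b) else (if j == 0 then c else d).

Lemma ord2P (i : 'I_2) : i = 0 \/ i = 1.
Proof. by case: i => [[|[|]]] // ?; [left | right]; apply: val_inj. Qed.

Lemma mx2_eta (M : 'M[R]_2) : M = mx2 (M 0 0) (M 0 1) (M 1 0) (M 1 1).
Proof.
by apply/matrixP=> i j; rewrite mxE; case: (ord2P i) => ->; case: (ord2P j) => ->.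
Qed.

Lemma mx2_inj a b c d a' b' c' d' : mx2 a b c d = mx2 a' b' c' d' ->
  [/\ a = a', b = b', c = c' & d = d'].
Proof.
move/matrixP=> E.
by have := E 0 0; have := E 0 1; have := E 1 0; have := E 1 1; rewrite !mxE /= => -> -> -> ->.
Qed.

Lemma mulmx2 a b c d a' b' c' d' :
  mx2 a b c d *m mx2 a' b' c' d' =
  mx2 (a * a' + b * c') (a * b' + b * d') (c * a' + d * c') (c * b' + d * d').
Proof.
apply/matrixP=> i j; rewrite !mxE !big_ord_recl big_ord0 !mxE addr0.
by case: (ord2P i) => ->; case: (ord2P j) => ->.
Qed.

Lemma det_mx2 a b c d : \det (mx2 a b c d) = a * d - b * c.
Proof.
rewrite (expand_det_row _ 0) !big_ord_recl big_ord0 addr0 /cofactor !det_mx11 !mxE /=.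
by rewrite expr0 mul1r expr1 mulN1r mulrN.
Qed.

Lemma mx2_1 : mx2 1 0 0 1 = 1%:M.
Proof.
by apply/matrixP=> i j; rewrite !mxE; case: (ord2P i) => ->; case: (ord2P j) => ->.
Qed.

End TwoByTwo.

Section PSL.

Local Open Scope ring_scope.
Import GRing.Theory.

Variable F : finFieldType.
Implicit Types (a b c d : F) (u v : {'GL_2[F]}) (x y : coset_of 'Z(SL2 F)).

Local Notation SL := (SL2 F).
Local Notation Z := 'Z(SL2 F)%g.
Local Notation G := (PSL2 F).

(** Total in the entries: a matrix that is not invertible is replaced by 1, so the lemmas on [sl]
    ask for determinant 1. *)
Definition sl a b c d : {'GL_2[F]} := insubd (1%g : {'GL_2[F]}) (mx2 a b c d).

Lemma slE a b c d : a * d - b * c = 1 -> GLval (sl a b c d) = mx2 a b c d.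
Proof.
move=> det1; rewrite /sl -[GLval _]/(val _) insubdK //.
by rewrite unfold_in /= -[_ \is a GRing.unit]/(_ \in unitmx) unitmxE det_mx2 det1 unitr1.
Qed.

Lemma sl_in a b c d : a * d - b * c = 1 -> sl a b c d \in SL.
Proof. by move=> det1; rewrite inE slE // det_mx2 det1. Qed.

Lemma slP u : u \in SL -> exists a b c d, a * d - b * c = 1 /\ u = sl a b c d.
Proof.
rewrite inE [GLval u]mx2_eta det_mx2 => /eqP det1.
exists (GLval u 0 0), (GLval u 0 1), (GLval u 1 0), (GLval u 1 1); split=> //.
by apply: val_inj; rewrite /= slE // -mx2_eta.
Qed.

Lemma slM a b c d a' b' c' d' : a * d - b * c = 1 -> a' * d' - b' * c' = 1 ->
  (sl a b c d * sl a' b' c' d')%g =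
  sl (a * a' + b * c') (a * b' + b * d') (c * a' + d * c') (c * b' + d * d').
Proof.
move=> det1 det1'; have det2 : (a * a' + b * c') * (c * b' + d * d')
    - (a * b' + b * d') * (c * a' + d * c') = 1.
  rewrite (_ : _ - _ = (a * d - b * c) * (a' * d' - b' * c')); last by ring.
  by rewrite det1 det1' mulr1.
by apply: val_inj; rewrite -[LHS]/(GLval _ *m GLval _) -[RHS]/(GLval _) !slE // mulmx2.
Qed.

Lemma sl_inj a b c d a' b' c' d' : a * d - b * c = 1 -> a' * d' - b' * c' = 1 ->
  sl a b c d = sl a' b' c' d' -> [/\ a = a', b = b', c = c' & d = d'].
Proof. by move=> det1 det1' /(congr1 (fun u => GLval u)); rewrite !slE //; apply: mx2_inj. Qed.

Lemma sl1 : sl 1 0 0 1 = 1%g.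
Proof. by apply: val_inj; rewrite /= slE ?mulr1 ?mulr0 ?subr0 // mx2_1. Qed.

Lemma slN1_in : sl (-1) 0 0 (-1) \in SL.
Proof. by apply: sl_in; ring. Qed.

(** Commuting with [1 1; 0 1] and [1 0; 1 1] makes a matrix scalar, and determinant 1 leaves only
    the two signs. *)
Lemma mem_Z u : (u \in Z) = (u == 1%g) || (u == sl (-1) 0 0 (-1)).
Proof.
apply/idP/orP=> [/centerP[/slP[a [b [c [d [det1 ->]]]]] cu]|[]/eqP->]; last first.
- apply/centerP; split=> [|_ /slP[a [b [c [d [det1 ->]]]]]]; first exact: slN1_in.
  by rewrite /commute !slM //; try ring; congr sl; ring.
- exact: group1.
have d1 : 1 * 1 - 1 * 0 = 1 :> F by ring.
have d2 : 1 * 1 - 0 * 1 = 1 :> F by ring.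
have := cu _ (sl_in d1); rewrite /commute !slM // => /sl_inj[].
- by apply: etrans det1; ring.
- by apply: etrans det1; ring.
move=> e1 e2 _ _; have := cu _ (sl_in d2); rewrite /commute !slM // => /sl_inj[].
- by apply: etrans det1; ring.
- by apply: etrans det1; ring.
move=> e3 _ _ _.
have b0 : b = 0.
  by apply: (addrI (a * 1)); rewrite addr0; move: e3; rewrite !(mulr1, mul1r, mulr0, mul0r, addr0).
have c0 : c = 0.
  by apply/esym; apply: (addrI (a * 1)); rewrite addr0; move: e1; rewrite !(mulr1, mul1r, mulr0, mul0r, addr0).
have ad : a = d.
  by move: e2; rewrite b0 !(mulr1, mul1r, mulr0, mul0r, addr0, add0r).
rewrite b0 c0 -ad in det1 *; have : a ^+ 2 = 1 by apply: etrans det1; ring.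
move/eqP; rewrite sqrf_eq1 => /orP[]/eqP->; [left | right]; last by [].
by rewrite sl1.
Qed.

End PSL.

(** As 9 is congruent to 1 modulo 8, odd powers of 3 are congruent to 3. *)
Lemma pow3_mod8 p : odd p -> (3 ^ p = 8 * (3 ^ p %/ 8) + 3)%N.
Proof.
move=> p_odd; rewrite {1}(divn_eq (3 ^ p) 8) mulnC; congr (_ + _)%N.
rewrite -[p]odd_double_half p_odd add1n expnS -mul2n expnM -modnMmr -modnXm.
by rewrite exp1n.
Qed.

(** If a^2 = -1, then a^q = a^(8k + 3) = -a, whereas a^q = a; in characteristic 3 this gives a =
    0. *)
Lemma sqrt_N1_free (F : finFieldType) p : odd p -> #|F| = (3 ^ p)%N ->
  forall a : F, (a ^+ 2 != -1)%R.
Proof.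
move=> p_odd cardF a; apply/eqP=> a2.
have := expf_card a; rewrite cardF pow3_mod8 //.
set k := (3 ^ p %/ 8)%N; rewrite GRing.exprD (_ : 8 * k = 2 * (2 * (2 * k)))%N; last by ring.
rewrite !GRing.exprM a2 GRing.sqrrN !GRing.expr1n GRing.mul1r.
rewrite GRing.exprS a2 GRing.mulrN1 => aa.
have ch3 : (3%:R = 0 :> F)%R by apply: GRing.pcharf0; exact: card_finPcharP cardF _.
have a0 : (a = 0)%R.
  have : (a *+ 3 = 0)%R by rewrite -GRing.mulr_natr ch3 GRing.mulr0.
  by rewrite GRing.mulrS GRing.mulr2n -{1}aa GRing.addKr.
by move/eqP: a2; rewrite a0 GRing.expr0n /= eq_sym GRing.oppr_eq0 GRing.oner_eq0.
Qed.

(** * Unipotent subgroup, split and nonsplit tori of SL(2,q) *)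

Section Subgroups.

Local Open Scope ring_scope.
Import GRing.Theory.

Variables (F : finFieldType) (p : nat).
Hypotheses (p_odd : odd p) (cardF : #|F| = (3 ^ p)%N).
Implicit Types (a b c d : F) (u v : {'GL_2[F]}) (x y : coset_of 'Z(SL2 F)).

Local Notation SL := (SL2 F).
Local Notation Z := 'Z(SL2 F)%g.
Local Notation G := (PSL2 F).
Local Notation q := (3 ^ p)%N.

Let N1 := sqrt_N1_free p_odd cardF.

Lemma char3 : 1 + 1 + 1 = 0 :> F.
Proof.
have : 3%:R = 0 :> F by apply: GRing.pcharf0; exact: card_finPcharP cardF _.
by rewrite -[RHS]/(0 : F) => <-; ring.
Qed.

Lemma two_eq : 1 + 1 = -1 :> F.
Proof. by apply/eqP; rewrite -subr_eq0 opprK char3. Qed.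

Lemma opp_fix a : - a = a -> a = 0.
Proof.
move=> aa; have : a * (1 + 1 + 1) = 0 by rewrite char3 mulr0.
by rewrite (_ : a * _ = a + (a + a)); [rewrite -{2}aa addNr addr0 | ring].
Qed.

Lemma sum_sq_neq0 a b : a ^+ 2 + b ^+ 2 = 0 -> a = 0 /\ b = 0.
Proof.
have [->|b0] := eqVneq b 0; first by rewrite expr0n addr0 => /eqP; rewrite sqrf_eq0 => /eqP.
move=> E; have := N1 (a / b); rewrite expr_div_n (_ : a ^+ 2 = - b ^+ 2).
  by rewrite mulNr divff ?eqxx // sqrf_eq0.
by apply/eqP; rewrite -subr_eq0 opprK E.
Qed.

Definition uni b := sl 1 b 0 1.
Definition tor a := sl a 0 0 a^-1.
(** The matrix [a b; -b a] of a + b i in the quadratic extension F(i), which exists since -1 is not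
    a square; [circle] is the norm one group and [cmul] the multiplication. *)
Definition rot (w : F * F) := sl w.1 w.2 (- w.2) w.1.

Lemma uni_det b : 1 * 1 - b * 0 = 1 :> F. Proof. by ring. Qed.
Lemma tor_det a : a != 0 -> a * a^-1 - 0 * 0 = 1 :> F.
Proof. by move=> a0; rewrite divff // mulr0 subr0. Qed.

Definition circle : {set F * F} := [set w | w.1 ^+ 2 + w.2 ^+ 2 == 1].
Lemma rot_det w : w \in circle -> w.1 * w.1 - w.2 * (- w.2) = 1 :> F.
Proof. by rewrite inE => /eqP <-; ring. Qed.

Definition Uset := [set uni b | b in [set: F]].
Definition Tset := [set tor a | a in [set a : F | a != 0]].
Definition Sset := [set rot w | w in circle].

Lemma uniM b c : (uni b * uni c)%g = uni (b + c).
Proof. by rewrite /uni slM ?uni_det //; congr sl; ring. Qed.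

Lemma torM a b : a != 0 -> b != 0 -> (tor a * tor b)%g = tor (a * b).
Proof. by move=> a0 b0; rewrite /tor slM ?tor_det // invfM; congr sl; ring. Qed.

Definition cmul (w z : F * F) := (w.1 * z.1 - w.2 * z.2, w.1 * z.2 + w.2 * z.1).

Lemma rotM w z : w \in circle -> z \in circle -> (rot w * rot z)%g = rot (cmul w z).
Proof. by move=> cw cz; rewrite /rot slM ?rot_det //; congr sl; rewrite /=; ring. Qed.

Lemma cmul_circle w z : w \in circle -> z \in circle -> cmul w z \in circle.
Proof.
rewrite !inE => /eqP ew /eqP ez; rewrite (_ : _ + _ = (w.1 ^+ 2 + w.2 ^+ 2) * (z.1 ^+ 2 + z.2 ^+ 2)).
  by rewrite ew ez mulr1.
by rewrite /=; ring.
Qed.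

Lemma Uset_group : group_set Uset.
Proof.
apply/group_setP; split=> [|_ _ /imsetP[b _ ->] /imsetP[c _ ->]].
  by apply/imsetP; exists 0; rewrite // /uni sl1.
by rewrite uniM imset_f.
Qed.
Canonical Ugroup := Group Uset_group.

Lemma Tset_group : group_set Tset.
Proof.
apply/group_setP; split=> [|_ _ /imsetP[b /[!inE] b0 ->] /imsetP[c /[!inE] c0 ->]].
  by apply/imsetP; exists 1; rewrite ?inE ?oner_eq0 // /tor invr1 sl1.
by rewrite torM // imset_f // inE mulf_neq0.
Qed.
Canonical Tgroup := Group Tset_group.

Lemma Sset_group : group_set Sset.
Proof.
apply/group_setP; split=> [|_ _ /imsetP[w cw ->] /imsetP[z cz ->]].
  apply/imsetP; exists (1, 0); rewrite ?inE /= ?expr1n ?expr0n ?addr0 //.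
  by rewrite /rot /= oppr0 sl1.
by rewrite rotM // imset_f // cmul_circle.
Qed.
Canonical Sgroup := Group Sset_group.

Lemma card_U : #|Uset| = q.
Proof.
rewrite card_imset ?cardsT // => b c /(sl_inj (uni_det b) (uni_det c)).
by case.
Qed.

Lemma card_T : #|Tset| = q.-1.
Proof.
rewrite card_in_imset; last first.
  move=> a b /[!inE] a0 b0 /(sl_inj (tor_det a0) (tor_det b0)).
  by case.
rewrite -cardF -(cardC1 (0 : F)) cardsE; apply: eq_card => a.
by rewrite !inE.
Qed.

(* (a, b) = ((1 - t^2) / (1 + t^2), 2t / (1 + t^2)) with t = b / (1 + a) parametrises
   all the points of the circle but (-1, 0), which is the value at None. *)
Lemma card_S : #|Sset| = q.+1.
Proof.
rewrite card_in_imset; last first.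
  move=> [a b] [c d] cw cz /(sl_inj (rot_det cw) (rot_det cz)) /= [-> -> _ _] //.
pose f (o : option F) :=
  if o is Some t then ((1 - t ^+ 2) / (1 + t ^+ 2), (t + t) / (1 + t ^+ 2)) else (-1, 0).
have den (t : F) : 1 + t ^+ 2 != 0.
  by have := N1 t; apply: contra; rewrite addrC addr_eq0.
have two0 : 1 + 1 != 0 :> F by rewrite two_eq oppr_eq0 oner_eq0.
have f1 t : (f (Some t)).1 + 1 = (1 + 1) / (1 + t ^+ 2) by rewrite /=; field.
have f2 t : (f (Some t)).2 / ((f (Some t)).1 + 1) = t.
  by rewrite f1 /=; field; rewrite den -[2%:R]/(1 + 1) two0.
have inj : injective f.
  have ne t : f (Some t) <> f None.
    move=> E; have := f1 t; rewrite E /= addNr => /esym/eqP.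
    by rewrite mulf_eq0 invr_eq0 (negPf two0) (negPf (den t)).
  case=> [t|] [s|] // E.
  - by rewrite -(f2 t) E f2.
  - by case: (ne t).
  - by case: (ne s).
rewrite -cardF -card_option -(card_imset _ inj); apply: eq_card => -[a b].
apply/idP/imsetP=> [|[[t|] _ ->]]; last 2 first.
- by rewrite inE /=; apply/eqP; field.
- by rewrite inE /=; apply/eqP; ring.
rewrite inE /= => /eqP ab1; have [a1|na1] := eqVneq (1 + a) 0.
  exists None => //; have aN1 : a = -1 by apply/eqP; rewrite -addr_eq0 addrC a1.
  rewrite aN1 in ab1 *; congr (_, _); apply/eqP; rewrite -sqrf_eq0; apply/eqP.
  by apply: (addrI ((-1) ^+ 2)); rewrite ab1; ring.
exists (Some (b / (1 + a))) => //; rewrite /f; set t := b / (1 + a).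
have et : 1 + t ^+ 2 = (1 + 1) / (1 + a).
  apply: (mulIf (expf_neq0 2 na1)); rewrite mulrDl mul1r -exprMn divfK //.
  rewrite (_ : (1 + 1) / (1 + a) * (1 + a) ^+ 2 = 1 + a + a + 1); last by field.
  by rewrite -{3}ab1; ring.
have et' : 1 - t ^+ 2 = (1 + 1) / (1 + a) * a.
  by rewrite (_ : 1 - t ^+ 2 = 1 + 1 - (1 + t ^+ 2)); [rewrite et; field | ring].
by rewrite et et' /t; congr (_, _); field; rewrite na1 ?two0 //.
Qed.

End Subgroups.

(** Supplies a field in whose multiplicative group the nonsplit torus embeds through a + b i, which
    makes it cyclic. *)
Lemma sqrt_N1_ext (F : finFieldType) :
  exists (L : fieldType) (f : {rmorphism F -> L}) (i : L), (i ^+ 2 = -1)%R.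
Proof.
have nz : ('X^2 + 1%:P : {poly F})%R != 0%R by rewrite -size_poly_eq0 size_XnaddC.
have [L [rs Drs _]] := FinSplittingFieldFor nz.
exists L, (GRing.in_alg L); case: rs Drs => [|z rs].
  rewrite big_nil => /eqp_size; rewrite size_map_poly size_XnaddC // size_poly1 //.
rewrite big_cons => /eqp_root/(_ z); rewrite rootM root_XsubC eqxx /=.
rewrite /root GRing.rmorphD /= map_polyXn map_polyC /= GRing.scale1r !hornerE => /eqP z2.
by exists z; apply/eqP; rewrite -GRing.addr_eq0 z2.
Qed.

(** * Centre, cyclicity of the tori and order of SL(2,q) *)

Section Orders.

Local Open Scope ring_scope.
Import GRing.Theory.

Variables (F : finFieldType) (p : nat).
Hypotheses (p_odd : odd p) (cardF : #|F| = (3 ^ p)%N).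
Implicit Types (a b c d : F) (u v : {'GL_2[F]}) (x y : coset_of 'Z(SL2 F)).

Local Notation SL := (SL2 F).
Local Notation Z := 'Z(SL2 F)%g.
Local Notation G := (PSL2 F).
Local Notation q := (3 ^ p)%N.

Lemma T_sub_SL : Tset F \subset SL.
Proof. by apply/subsetP=> _ /imsetP[a a0 ->]; rewrite inE in a0; rewrite /tor sl_in ?tor_det. Qed.
Lemma U_sub_SL : Uset F \subset SL.
Proof. by apply/subsetP=> _ /imsetP[b _ ->]; rewrite /uni sl_in ?uni_det. Qed.
Lemma S_sub_SL : Sset F \subset SL.
Proof. by apply/subsetP=> _ /imsetP[w cw ->]; rewrite /rot sl_in ?rot_det. Qed.

Lemma Z_sub_T : Z \subset Tset F.
Proof.
apply/subsetP=> u; rewrite mem_Z => /orP[]/eqP->; first exact: (group1 (Tgroup F)).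
apply/imsetP; exists (-1); first by rewrite inE oppr_eq0 oner_eq0.
by rewrite /tor invrN1.
Qed.

Lemma Z_sub_S : Z \subset Sset F.
Proof.
apply/subsetP=> u; rewrite mem_Z => /orP[]/eqP->; first exact: (group1 (Sgroup F)).
apply/imsetP; exists (-1, 0); first by rewrite inE /=; apply/eqP; ring.
by congr sl; rewrite /= oppr0.
Qed.

Lemma N1_neq1 : -1 != 1 :> F.
Proof. by apply/eqP=> /(opp_fix cardF)/eqP; rewrite oner_eq0. Qed.

Lemma slN1_neq1 : sl (-1) 0 0 (-1) != 1%g :> {'GL_2[F]}.
Proof.
apply/eqP; rewrite -[RHS]sl1 => /sl_inj[]; try ring.
by move/eqP; rewrite (negPf N1_neq1).
Qed.

Lemma card_Z : #|Z| = 2.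
Proof.
have -> : Z = [set 1%g; sl (-1) 0 0 (-1)] :> {set _}.
  by apply/setP=> u; rewrite mem_Z !inE.
by rewrite cards2 eq_sym slN1_neq1.
Qed.

Lemma T_cyclic : cyclic (Tgroup F).
Proof.
apply: (@field_mul_group_cyclic _ _ F (fun u => GLval u 0 0)) => [|u].
  move=> _ _ /imsetP[a a0 ->] /imsetP[b b0 ->]; rewrite !inE in a0 b0.
  by rewrite torM // /tor !slE ?tor_det ?mulf_neq0 // !mxE.
case/imsetP=> a a0 ->; rewrite inE in a0; rewrite /tor slE ?tor_det // mxE /=.
split=> [->|]; first by rewrite invr1 sl1.
by rewrite -[RHS]sl1 => /sl_inj[]; rewrite ?tor_det //; ring.
Qed.

Lemma S_cyclic : cyclic (Sgroup F).
Proof.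
have [L [phi [i i2]]] := sqrt_N1_ext F.
apply: (@field_mul_group_cyclic _ _ L (fun u => phi (GLval u 0 0) + phi (GLval u 0 1) * i)) => [|u].
  move=> _ _ /imsetP[w cw ->] /imsetP[z cz ->].
  rewrite rotM // /rot !slE ?rot_det ?cmul_circle // !mxE /=.
  rewrite rmorphB rmorphD !rmorphM.
  set a := phi w.1; set b := phi w.2; set c := phi z.1; set d := phi z.2.
  rewrite (_ : (a + b * i) * (c + d * i) = a * c + b * d * i ^+ 2 + (a * d + b * c) * i); last by ring.
  by rewrite i2 mulrN1.
case/imsetP=> -[a b] cw ->; rewrite /rot slE ?rot_det // !mxE /=.
split=> [E|]; last first.
  have det1 : a * a - b * - b = 1 := rot_det cw.
  rewrite -[RHS]sl1 => /(sl_inj det1)[]; first by ring.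
  by move=> /= -> -> _ _; rewrite rmorph1 rmorph0 mul0r addr0.
(* From a + b i = 1 follows (a - 1)^2 + b^2 = 0, and over F a sum of two squares vanishes only
   trivially. *)
have E2 : phi ((a - 1) ^+ 2 + b ^+ 2) = 0.
  rewrite rmorphD !rmorphXn rmorphB rmorph1 /=.
  have -> : phi a - 1 = - (phi b * i) by rewrite -E opprD addrA subrr add0r.
  by rewrite sqrrN exprMn i2 mulrN1 addNr.
have /(sum_sq_neq0 p_odd cardF)[/eqP w1 w2] : (a - 1) ^+ 2 + b ^+ 2 = 0.
  by move/eqP: E2; rewrite fmorph_eq0 => /eqP.
move: w1; rewrite subr_eq0 => /eqP w1.
by rewrite w1 w2 -sl1; congr sl; rewrite /= oppr0.
Qed.

(* The diagonal matrices diag(a,1) form a complement to SL(2,q) in GL(2,q). *)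
Definition dg a : {'GL_2[F]} := insubd (1%g : {'GL_2[F]}) (mx2 a 0 0 1).

Lemma dgE a : a != 0 -> GLval (dg a) = mx2 a 0 0 1.
Proof.
move=> a0; rewrite /dg -[GLval _]/(val _) insubdK //.
rewrite unfold_in /= -[_ \is a GRing.unit]/(_ \in unitmx) unitmxE det_mx2.
by rewrite mulr1 mulr0 subr0 unitfE.
Qed.

Definition Dset := [set dg a | a in [set a : F | a != 0]].

Lemma Dset_group : group_set Dset.
Proof.
apply/group_setP; split=> [|_ _ /imsetP[b b0 ->] /imsetP[c c0 ->]]; last rewrite !inE in b0 c0.
  apply/imsetP; exists 1; rewrite ?inE ?oner_eq0 //; apply: val_inj.
  by rewrite -[RHS]/(GLval (dg 1)) dgE ?oner_eq0 // mx2_1.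
apply/imsetP; exists (b * c); first by rewrite inE mulf_neq0.
apply: val_inj; rewrite -[LHS]/(GLval _ *m GLval _) -[RHS]/(GLval (dg (b * c))).
by rewrite !dgE ?mulf_neq0 // mulmx2; congr mx2; ring.
Qed.
Canonical Dgroup := Group Dset_group.

Lemma card_D : #|Dset| = q.-1.
Proof.
rewrite card_in_imset; last first.
  move=> a b /[!inE] a0 b0 /(congr1 (fun u => GLval u)); rewrite !dgE //.
  by case/mx2_inj.
rewrite -cardF -(cardC1 (0 : F)) cardsE; apply: eq_card => a.
by rewrite !inE.
Qed.

Lemma card_SL : #|SL| = (q * q.-1 * q.+1)%N.
Proof.
have tiSD : SL :&: Dset = 1%g.
  apply/trivgP/subsetP=> u /setIP[Su /imsetP[a a0 defu]]; rewrite inE in a0.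
  move: Su; rewrite inE defu dgE // det_mx2 mulr1 mulr0 subr0 => /eqP a1.
  apply/set1gP/val_inj; rewrite -[LHS]/(GLval (dg a)) dgE // a1 mx2_1 //.
have mulSD : (SL * Dset)%g = [set: {'GL_2[F]}].
  apply/setP=> u; rewrite inE; apply/mulsgP.
  have d0 : \det (GLval u) != 0 by exact: GL_det.
  have Dd : dg (\det (GLval u)) \in Dset by apply/imsetP; exists (\det (GLval u)); rewrite ?inE.
  exists (u * (dg (\det (GLval u)))^-1)%g (dg (\det (GLval u))) => //; last by rewrite mulgKV.
  have: \det (GLval (u * (dg (\det (GLval u)))^-1 * dg (\det (GLval u)))%g) =
    \det (GLval u) by rewrite mulgKV.
  rewrite GL_MxE det_mulmx dgE // det_mx2 mulr1 mulr0 subr0 inE => E.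
  by apply/eqP; apply: (mulIf d0); rewrite E mul1r.
have := TI_cardMg tiSD; rewrite mulSD card_D => E.
have q0 : (0 < q.-1)%N.
  by rewrite -subn1 subn_gt0 -{1}(expn0 3) ltn_exp2l // odd_gt0.
apply/eqP; rewrite -(eqn_pmul2r q0) -E -[[set: _]]/('GL_2[F]) card_GL_2 cardF.
by apply/eqP; ring.
Qed.

End Orders.

(** * Passage to PSL(2,q) *)

Section Quotient.

Local Open Scope ring_scope.
Import GRing.Theory.

Variables (F : finFieldType) (p : nat).
Hypotheses (p_odd : odd p) (p_gt1 : (1 < p)%N) (cardF : #|F| = (3 ^ p)%N).
Implicit Types (a b c d f g s : F) (u v : {'GL_2[F]}) (x y : coset_of 'Z(SL2 F)).

Local Notation SL := (SL2 F).
Local Notation Z := 'Z(SL2 F)%g.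
Local Notation G := (PSL2 F).
Local Notation q := (3 ^ p)%N.

Let opp0 := opp_fix cardF.
Let N1 := sqrt_N1_free p_odd cardF.

Definition psl a b c d : coset_of Z := coset Z (sl a b c d).

Lemma psl_ext a b c d a' b' c' d' :
  a = a' -> b = b' -> c = c' -> d = d' -> psl a b c d = psl a' b' c' d'.
Proof. by move=> -> -> -> ->. Qed.

Lemma SL_norm_Z : SL \subset 'N(Z)%g.
Proof. exact: normal_norm (center_normal (SL2_group F)). Qed.

Lemma psl_in a b c d : a * d - b * c = 1 -> psl a b c d \in G.
Proof. by move=> det1; rewrite mem_quotient // sl_in. Qed.

Lemma pslP x : x \in G -> exists a b c d, a * d - b * c = 1 /\ x = psl a b c d.
Proof.
by case/morphimP=> u _ /slP[a [b [c [d [det1 ->]]]]] ->; exists a, b, c, d.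
Qed.

Lemma quoP (A : {set {'GL_2[F]}}) x : x \in (A / Z)%g -> exists2 u, u \in A & x = coset Z u.
Proof. by case/morphimP=> u _ Au ->; exists u. Qed.

Lemma quo_in (A : {group {'GL_2[F]}}) u : u \in A -> coset Z u \in (A / Z)%g.
Proof. exact: mem_quotient. Qed.

Lemma pslM a b c d a' b' c' d' : a * d - b * c = 1 -> a' * d' - b' * c' = 1 ->
  (psl a b c d * psl a' b' c' d')%g =
  psl (a * a' + b * c') (a * b' + b * d') (c * a' + d * c') (c * b' + d * d').
Proof.
move=> det1 det1'; rewrite /psl -slM // morphM //; apply: (subsetP SL_norm_Z); exact: sl_in.
Qed.

Lemma psl_eq a b c d a' b' c' d' : a * d - b * c = 1 -> a' * d' - b' * c' = 1 ->
    psl a b c d = psl a' b' c' d' ->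
  exists s, (s = 1 \/ s = -1) /\ [/\ a = s * a', b = s * b', c = s * c' & d = s * d'].
Proof.
move=> det1 det1' /rcoset_kercosetP H.
have /rcosetP[z Zz E] := H (subsetP SL_norm_Z _ (sl_in det1)) (subsetP SL_norm_Z _ (sl_in det1')).
move: Zz E; rewrite mem_Z => /orP[]/eqP->.
  by rewrite mul1g => /sl_inj[] // -> -> -> ->; exists 1; rewrite !mul1r; split; [left|].
have detN : -1 * -1 - 0 * 0 = 1 :> F by ring.
rewrite slM // => /sl_inj[] //; first by apply: etrans det1'; ring.
by move=> -> -> -> ->; exists (-1); split; [right | split; ring].
Qed.

Lemma pslN a b c d : a * d - b * c = 1 -> psl (- a) (- b) (- c) (- d) = psl a b c d.
Proof.
move=> det1; have detN : -1 * -1 - 0 * 0 = 1 :> F by ring.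
have -> : psl (- a) (- b) (- c) (- d) = (psl (-1) 0 0 (-1) * psl a b c d)%g.
  by rewrite pslM //; apply: psl_ext; ring.
by rewrite /psl (coset_id (_ : sl (-1) 0 0 (-1) \in Z)) ?mul1g // mem_Z eqxx orbT.
Qed.

Lemma psl1 : psl 1 0 0 1 = 1%g.
Proof. by rewrite /psl sl1 morph1. Qed.

Lemma pslN1 : psl (-1) 0 0 (-1) = 1%g.
Proof. by rewrite -psl1 -[RHS]pslN ?oppr0 //; ring. Qed.

Definition P0 := (Ugroup F / Z)%G.
Definition K0 := (Tgroup F / Z)%G.
Definition D0 := (Sgroup F / Z)%G.

Lemma P0P x : reflect (exists b, x = psl 1 b 0 1) (x \in P0).
Proof.
apply: (iffP idP) => [/quoP[_ /imsetP[b _ ->] ->]|[b ->]]; first by exists b.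
by apply: quo_in; exact: imset_f.
Qed.

Lemma K0P x : reflect (exists2 a, a != 0 & x = psl a 0 0 a^-1) (x \in K0).
Proof.
apply: (iffP idP) => [/quoP[_ /imsetP[a a0 ->] ->]|[a a0 ->]].
  by exists a; rewrite // inE in a0.
by apply: quo_in; apply: imset_f; rewrite inE.
Qed.

Lemma D0P x : reflect (exists a b, a ^+ 2 + b ^+ 2 = 1 /\ x = psl a b (- b) a) (x \in D0).
Proof.
apply: (iffP idP) => [/quoP[_ /imsetP[[a b] cw ->] ->]|[a [b [ab ->]]]].
  by exists a, b; split=> //; move: cw; rewrite inE => /eqP.
by apply: quo_in; apply/imsetP; exists (a, b); rewrite // inE ab.
Qed.

Let e := (3 ^ p %/ 8)%N.
Let qE : (q = 8 * e + 3)%N := pow3_mod8 p_odd.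

Lemma card_PSL : #|G| = (q * (4 * e + 1) * (8 * e + 4))%N.
Proof.
rewrite card_quotient ?SL_norm_Z // -divgS ?center_sub // (card_SL p_odd cardF) (card_Z cardF) qE.
rewrite (_ : (8 * e + 3).-1 = 2 * (4 * e + 1))%N; last by clear; lia.
rewrite (_ : _ * _ = (8 * e + 3) * (4 * e + 1) * (8 * e + 4) * 2)%N ?mulnK //.
by rewrite (_ : (8 * e + 3).+1 = 8 * e + 4)%N; [ring | clear; lia].
Qed.

Lemma card_K0 : #|K0| = (4 * e + 1)%N.
Proof.
rewrite card_quotient ?(subset_trans (T_sub_SL F)) ?SL_norm_Z //.
rewrite -divgS ?Z_sub_T //= (card_T cardF) (card_Z cardF) qE.
by rewrite (_ : (8 * e + 3).-1 = 2 * (4 * e + 1))%N ?mulKn //; clear; lia.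
Qed.

Lemma card_D0 : #|D0| = (4 * e + 2)%N.
Proof.
rewrite card_quotient ?(subset_trans (S_sub_SL F)) ?SL_norm_Z //.
rewrite -divgS ?Z_sub_S //= (card_S p_odd cardF) (card_Z cardF) qE.
by rewrite (_ : (8 * e + 3).+1 = 2 * (4 * e + 2))%N ?mulKn //; clear; lia.
Qed.

Lemma card_P0 : #|P0| = q.
Proof.
rewrite -(card_U cardF); apply/esym/card_isog/quotient_isog.
  exact: subset_trans (U_sub_SL F) SL_norm_Z.
apply/trivgP/subsetP=> u /setIP[/=]; rewrite mem_Z => /orP[/eqP->|/eqP->]; first by rewrite !group1.
case/imsetP=> b _ /sl_inj[]; rewrite ?uni_det //; first by ring.
by move/eqP; rewrite (negPf (N1_neq1 cardF)).
Qed.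

Lemma P0_abelem : 3.-abelem P0.
Proof.
apply/abelemP=> //; split.
  apply/centsP=> _ /P0P[b ->] _ /P0P[c ->]; rewrite /commute !pslM ?uni_det //.
  by apply: psl_ext; ring.
move=> _ /P0P[b ->]; rewrite !expgS expg0 mulg1 !pslM ?uni_det //; last by ring.
rewrite -psl1; apply: psl_ext; try ring.
by rewrite (_ : _ + _ = b * (1 + 1 + 1)); [rewrite (char3 cardF) mulr0 | ring].
Qed.

(* Relations in PSL(2,q) hold for matrices up to the sign s. *)
Lemma pslC a b c d a' b' c' d' f g h k :
    a * d - b * c = 1 -> a' * d' - b' * c' = 1 -> f * k - g * h = 1 ->
    (psl a' b' c' d' ^ psl a b c d)%g = psl f g h k ->
  exists s, (s = 1 \/ s = -1) /\
    [/\ a' * a + b' * c = s * (a * f + b * h), a' * b + b' * d = s * (a * g + b * k),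
        c' * a + d' * c = s * (c * f + d * h) & c' * b + d' * d = s * (c * g + d * k)].
Proof.
move=> det1 det1' det2 E.
have M (x y z w x' y' z' w' : F) : x * w - y * z = 1 -> x' * w' - y' * z' = 1 ->
    (x * x' + y * z') * (z * y' + w * w') - (x * y' + y * w') * (z * x' + w * z') = 1 :> F.
  move=> e1 e2; rewrite (_ : _ - _ = (x * w - y * z) * (x' * w' - y' * z')); last by ring.
  by rewrite e1 e2 mulr1.
have : (psl a' b' c' d' * psl a b c d = psl a b c d * psl f g h k)%g by rewrite -E conjgC.
by rewrite !pslM //; apply: psl_eq; apply: M.
Qed.

(** The conjugate of [1 1; 0 1] must again be upper unipotent up to sign; the first column of the
    relation gives a + c = a for s = 1 and c = -c for s = -1. *)
Lemma norm_P0_upper a b c d : a * d - b * c = 1 -> psl a b c d \in 'N(P0)%g -> c = 0.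
Proof.
move=> det1 Ny; have Px : psl 1 1 0 1 \in P0 by apply/P0P; exists 1.
have /P0P[b' E] : (psl 1%R 1%R 0%R 1%R ^ psl a b c d)%g \in P0 by rewrite memJ_norm.
have [s [s1 [e1 _ e3 _]]] := pslC det1 (uni_det 1) (uni_det b') E.
case: s1 e1 e3 => -> e1 e3.
  have {}e1 : a + c = a by apply: etrans (etrans e1 _); ring.
  by apply: (addrI a); rewrite e1 addr0.
by apply: opp0; apply: esym; apply: etrans (etrans e3 _); ring.
Qed.

Lemma P0_cent : {in P0^#, forall x, 'C_G[x]%g \subset P0}.
Proof.
move=> x /setD1P[nt /P0P[b defx]]; rewrite {x}defx in nt *.
have b0 : b != 0 by apply: contraNneq nt => ->; rewrite psl1.
apply/subsetP=> y /setIP[/pslP[a [c [d [f [det1 ->]]]]] /cent1P cxy].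
have E : (psl 1%R b 0%R 1%R ^ psl a c d f)%g = psl 1 b 0 1.
  by apply/conjg_fixP/commgP/commute_sym.
have [s [s1 [e1 e2 e3 e4]]] := pslC det1 (uni_det b) (uni_det b) E.
case: s1 e1 e2 e3 e4 => -> e1 e2 e3 e4.
  have d0 : d = 0.
    apply: (mulfI b0); rewrite mulr0; apply: (addrI a); rewrite addr0.
    by apply: etrans (etrans e1 _); ring.
  have fa : f = a.
    apply: (mulfI b0); apply: (addrI c).
    by apply: etrans (etrans e2 _); ring.
  rewrite d0 fa in det1 *; have : a ^+ 2 = 1 by apply: etrans det1; ring.
  move/eqP; rewrite sqrf_eq1 => /orP[]/eqP->; apply/P0P; first by exists c.
  by exists (- c); rewrite -pslN ?oppr0 ?opprK //; ring.
(* For s = -1, [1 b; 0 1] would be conjugate to its negative, against their traces; here the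
   relation annihilates the first column of y. *)
have d0 : d = 0 by apply: opp0; apply: esym; apply: etrans (etrans e3 _); ring.
have a0 : a = 0.
  rewrite d0 in e1; by apply: opp0; apply: esym; apply: etrans (etrans e1 _); ring.
by move: det1; rewrite d0 a0 mul0r mulr0 subr0 => /eqP; rewrite eq_sym oner_eq0.
Qed.

Lemma K0_norm_P0 : K0 \subset 'N(P0)%g.
Proof.
apply/subsetP=> _ /K0P[a a0 ->]; rewrite inE; apply/subsetP=> _ /imsetP[_ /P0P[b ->] ->].
apply/P0P; exists (b / a ^+ 2); apply: (mulgI (psl a 0 0 a^-1)).
rewrite -conjgC !pslM ?uni_det ?tor_det //.
by apply: psl_ext; field.
Qed.

Lemma P0_sdprod : P0 ><| K0 = 'N_G(P0)%g.
Proof.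
have tiPK : P0 :&: K0 = 1%g.
  apply: coprime_TIg; rewrite card_P0 card_K0 coprimeXl // prime_coprime //.
  have d3 : (3 %| q)%N by rewrite dvdn_exp // odd_gt0.
  by move: d3; rewrite qE; clear; lia.
rewrite sdprodE ?K0_norm_P0 //; apply/eqP; rewrite eqEsubset; apply/andP; split.
  rewrite mul_subG // subsetI ?normG ?K0_norm_P0 andbT; apply/subsetP=> x.
    by case/P0P=> b ->; rewrite psl_in // uni_det.
  by case/K0P=> a a0 ->; rewrite psl_in // tor_det.
apply/subsetP=> y /setIP[/pslP[a [b [c [d [det1 ->]]]]]] /(norm_P0_upper det1) c0.
rewrite {}c0 mulr0 subr0 in det1 *.
have a0 : a != 0 by apply: contra_eq_neq det1 => ->; rewrite mul0r eq_sym oner_eq0.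
have -> : d = a^-1 by apply: (mulfI a0); rewrite det1 divff.
apply/mulsgP; exists (psl 1 (a * b) 0 1) (psl a 0 0 a^-1).
- by apply/P0P; exists (a * b).
- by apply/K0P; exists a.
by rewrite pslM ?uni_det ?tor_det //; apply: psl_ext; field.
Qed.

Lemma K0_in a : a != 0 -> psl a 0 0 a^-1 \in K0.
Proof. by move=> a0; apply/K0P; exists a. Qed.

Lemma D0_in a b : a ^+ 2 + b ^+ 2 = 1 -> psl a b (- b) a \in D0.
Proof. by move=> ab; apply/D0P; exists a, b. Qed.

Lemma circ_det a b : a ^+ 2 + b ^+ 2 = 1 -> a * a - b * - b = 1.
Proof. by move=> <-; ring. Qed.

Lemma sq_neq1 a : a != 0 -> psl a 0 0 a^-1 != 1%g -> a ^+ 2 != 1.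
Proof.
move=> a0; apply: contra; rewrite sqrf_eq1 => /orP[]/eqP->; first by rewrite invr1 psl1.
by rewrite invrN1 pslN1.
Qed.

Lemma K0_diag a b c d t : t != 0 -> t ^+ 2 != 1 -> a * d - b * c = 1 ->
  t * b = b / t -> t * c = c / t -> psl a b c d \in K0.
Proof.
move=> t0 t2 det1 eb ec.
have z w : t * w = w / t -> w = 0.
  move=> ew; have : (t ^+ 2 - 1) * w = 0.
    by rewrite mulrBl mul1r expr2 -mulrA ew mulrC divfK // subrr.
  by move/eqP; rewrite mulf_eq0 subr_eq0 (negPf t2) => /eqP.
rewrite (z b) // (z c) // in det1 *; rewrite mulr0 subr0 in det1.
have a0 : a != 0 by apply: contra_eq_neq det1 => ->; rewrite mul0r eq_sym oner_eq0.
by rewrite (_ : d = a^-1) ?K0_in //; apply: (mulfI a0); rewrite det1 divff.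
Qed.

Lemma K0_torus : torus G K0.
Proof.
have sKG : K0 \subset G by rewrite quotientS ?T_sub_SL.
split=> //.
- by rewrite quotient_cyclic // T_cyclic.
- move=> x /setD1P[nt /K0P[t t0 defx]]; rewrite {x}defx in nt *.
  have t2 := sq_neq1 t0 nt.
  apply/subsetP=> y /setIP[/pslP[a [b [c [d [det1 ->]]]]] /cent1P cxy].
  have E : (psl t 0%R 0%R (t^-1)%R ^ psl a b c d)%g = psl t 0 0 t^-1.
    by apply/conjg_fixP/commgP/commute_sym.
  have [s [s1 [e1 e2 e3 e4]]] := pslC det1 (tor_det t0) (tor_det t0) E.
  apply: (subsetP (normG K0)); case: s1 e1 e2 e3 e4 => -> e1 e2 e3 e4.
    apply: (K0_diag t0 t2 det1).
      by apply: etrans (etrans e2 _); ring.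
    by apply: etrans (etrans (esym e3) _); ring.
  (* For s = -1, diag(t, 1/t) would be conjugate to its negative by a matrix off the diagonal,
     whence t^2 = -1, which is impossible. *)
  have a0 : a = 0.
    apply: (mulfI t0); rewrite mulr0; apply: opp0; apply: esym.
    by apply: etrans (etrans e1 _); ring.
  have eb : t * b = - (b / t) by apply: etrans (etrans e2 _); ring.
  have b0 : b != 0.
    by apply: contra_eq_neq det1 => ->; rewrite a0 !mul0r subr0 eq_sym oner_eq0.
  have /eqP[] := N1 t; apply: (mulfI b0).
  have -> : b * t ^+ 2 = t * b * t by ring.
  by rewrite eb mulNr divfK // mulrN1.
- move=> y /setDP[/setIP[/pslP[a [b [c [d [det1 ->]]]]] Ny] nKy].
  have [x Kx ntx] : exists2 x, x \in K0 & x != 1%g.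
    apply/trivgPn; rewrite -cardG_gt1 card_K0.
    suff: (3 ^ 2 <= q)%N by rewrite qE; clear; lia.
    by rewrite leq_exp2l.
  have /K0P[t t0 defx] := Kx; rewrite {x}defx in Kx ntx.
  have t2 := sq_neq1 t0 ntx.
  have /K0P[t' t'0 E] : (psl t 0%R 0%R (t^-1)%R ^ psl a b c d)%g \in K0 by rewrite memJ_norm.
  have [s [s1 [e1 e2 e3 e4]]] := pslC det1 (tor_det t0) (tor_det t'0) E.
  have ss : s * s = 1 by case: s1 => ->; ring.
  have s0 : s != 0 by apply: contra_eq_neq ss => ->; rewrite mul0r eq_sym oner_eq0.
  have {}e1 : t * a = s * t' * a by apply: etrans (etrans e1 _); ring.
  have {}e2 : t * b = s / t' * b by apply: etrans (etrans e2 _); ring.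
  have {}e3 : t^-1 * c = s * t' * c by apply: etrans (etrans e3 _); ring.
  have {}e4 : t^-1 * d = s / t' * d by apply: etrans (etrans e4 _); ring.
  have sV : s^-1 = s by apply: (mulfI s0); rewrite ss divff.
  (* If a is not 0, then t = s t' and y is diagonal. Otherwise y is antidiagonal of determinant 1,
     and its square is -1, trivial in PSL. *)
  have [a0|a0] := eqVneq a 0; last first.
    case/negP: nKy; have et : t = s * t' by apply: (mulIf a0).
    have et' : t^-1 = s / t' by rewrite et invfM sV.
    apply: (K0_diag t0 t2 det1); first by rewrite mulrC [RHS]mulrC et' mulrC.
    by rewrite -mulrC [c / t]mulrC e3 et mulrC.
  have b0 : b != 0.
    by apply: contra_eq_neq det1 => ->; rewrite a0 !mul0r subr0 eq_sym oner_eq0.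
  have et : t = s / t' by apply: (mulIf b0).
  have d0 : d = 0.
    move: e4; rewrite -et => e4; apply/eqP; apply: contraR t2 => d0.
    have : t^-1 = t by apply: (mulIf d0).
    by move=> tV; rewrite expr2 -{1}tV mulVf.
  rewrite a0 d0 in det1 *; rewrite expgS expg1 pslM //.
  rewrite -pslN1; apply: psl_ext; try ring.
    by rewrite -det1; ring.
  by rewrite -det1; ring.
pose w := psl 0 1 (-1) 0.
have detw : 0 * 0 - 1 * -1 = 1 :> F by ring.
apply/subsetPn; exists w.
  rewrite inE psl_in //= inE; apply/subsetP=> _ /imsetP[_ /K0P[a a0 ->] ->].
  apply/K0P; exists a^-1; first by rewrite invr_eq0.
  apply: (mulgI w); rewrite -conjgC !pslM ?tor_det ?invr_eq0 //.
  by apply: psl_ext; rewrite ?invrK; ring.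
apply/K0P=> -[a a0 /psl_eq[]]; rewrite ?tor_det //.
by move=> s [s1 [_ + _ _]]; rewrite mulr0 => /eqP; rewrite oner_eq0.
Qed.

Lemma D0_torus : torus G D0.
Proof.
have sDG : D0 \subset G by rewrite quotientS ?S_sub_SL.
have in_norm c d : c * - c - d * d = 1 -> psl c d d (- c) \in 'N(D0)%g.
  move=> det1; rewrite inE; apply/subsetP=> _ /imsetP[_ /D0P[m [n [mn ->]]] ->].
  have mn' : m ^+ 2 + (- n) ^+ 2 = 1 by rewrite sqrrN.
  apply/D0P; exists m, (- n); split=> //.
  apply: (mulgI (psl c d d (- c))); rewrite -conjgC !pslM ?circ_det //.
  by apply: psl_ext; ring.
have in_D c d f g : c * g - d * f = 1 -> f = - d -> g = c -> psl c d f g \in D0.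
  by move=> det1 fE gE; rewrite fE gE in det1 *; apply: D0_in; rewrite -det1; ring.
split=> //.
- by rewrite quotient_cyclic // (S_cyclic p_odd cardF).
- move=> x /setD1P[nt /D0P[a [b [ab defx]]]]; rewrite {x}defx in nt *.
  have b0 : b != 0.
    apply: contraNneq nt => b0; rewrite b0 expr0n addr0 in ab *.
    have /eqP := ab; rewrite sqrf_eq1 oppr0 => /orP[]/eqP->; by rewrite ?psl1 ?pslN1.
  apply/subsetP=> y /setIP[/pslP[c [d [f [g [det1 ->]]]]] /cent1P cxy].
  have E : (psl a b (- b)%R a ^ psl c d f g)%g = psl a b (- b) a.
    by apply/conjg_fixP/commgP/commute_sym.
  have [s [s1 [e1 e2 e3 e4]]] := pslC det1 (circ_det ab) (circ_det ab) E.
  case: s1 e1 e2 e3 e4 => -> e1 e2 e3 e4.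
    apply: (subsetP (normG D0)); apply: in_D => //; apply: (mulfI b0).
      by apply: (addrI (a * c)); apply: etrans (etrans e1 _); ring.
    by apply: (addrI (a * d)); apply: etrans (etrans e2 _); ring.
  (* For s = -1, combining the relations in pairs removes b. If a is not 0, y is in [D0]; if a = 0,
     the given element is the involution of the torus, which is also centralised by the symmetric
     matrices [c d; d -c] inverting the torus. *)
  have e14 : a * (c - g) = 0.
    apply: opp0.
    have E1 : a * c + b * f + (a * c - d * b) = 0 by rewrite e1; ring.
    have E4 : - b * d + a * g + (f * b + g * a) = 0 by rewrite e4; ring.
    have : a * (c - g) * (1 + 1) = 0.
      transitivity ((a * c + b * f + (a * c - d * b)) - (- b * d + a * g + (f * b + g * a))); first by ring.
      by rewrite E1 E4 subrr.
    by rewrite (two_eq cardF) mulrN1 => /eqP; rewrite oppr_eq0 => /eqP->; rewrite oppr0.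
  have e23 : a * (d + f) = 0.
    have E2 : a * d + b * g + (c * b + d * a) = 0 by rewrite e2; ring.
    have E3 : - b * c + a * f + (f * a - g * b) = 0 by rewrite e3; ring.
    have : a * (d + f) * (1 + 1) = 0.
      transitivity ((a * d + b * g + (c * b + d * a)) + (- b * c + a * f + (f * a - g * b))); first by ring.
      by rewrite E2 E3 addr0.
    by rewrite (two_eq cardF) mulrN1 => /eqP; rewrite oppr_eq0 => /eqP.
  have [a0|a0] := eqVneq a 0; last first.
    apply: (subsetP (normG D0)); apply: in_D => //.
      by move/eqP: e23; rewrite mulf_eq0 (negPf a0) /= addrC addr_eq0 => /eqP.
    by move/eqP: e14; rewrite mulf_eq0 (negPf a0) /= subr_eq0 => /eqP.
  rewrite a0 in e1 e2.
  have fE : f = d by apply: (mulfI b0); apply: etrans (etrans e1 _); ring.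
  have gE : g = - c by apply: (mulfI b0); apply: etrans (etrans e2 _); ring.
  by rewrite fE gE in det1 *; exact: in_norm.
- move=> y /setDP[/setIP[/pslP[c [d [f [g [det1 ->]]]]] Ny] nDy].
  (* It is enough to conjugate the involution [0 1; -1 0]. Up to sign, A is half the trace of the
     conjugate, so it vanishes; then B = 1 puts y in [D0], and B = -1 makes y symmetric of trace 0,
     with square 1 in PSL. *)
  have w1 : 0 ^+ 2 + 1 ^+ 2 = 1 :> F by ring.
  have Dw := D0_in w1.
  have /D0P[a' [b' [ab' E]]] : (psl 0%R 1%R (- 1)%R 0%R ^ psl c d f g)%g \in D0 by rewrite memJ_norm.
  have [s [s1 [e1 e2 e3 e4]]] := pslC det1 (circ_det w1) (circ_det ab') E.
  have ss : s * s = 1 by case: s1 => ->; ring.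
  pose A := s * a'; pose B := s * b'.
  have {}e1 : f = c * A - d * B by apply: etrans (etrans e1 _); rewrite /A /B; ring.
  have {}e2 : g = c * B + d * A by apply: etrans (etrans e2 _); rewrite /A /B; ring.
  have {}e3 : - c = f * A - g * B by apply: etrans (etrans e3 _); rewrite /A /B; ring.
  have {}e4 : - d = f * B + g * A by apply: etrans (etrans e4 _); rewrite /A /B; ring.
  have AB : A ^+ 2 + B ^+ 2 = 1.
    transitivity (s * s * (a' ^+ 2 + b' ^+ 2)); first by rewrite /A /B; ring.
    by rewrite ss ab' mulr1.
  have eA1 : A = f * g + c * d.
    transitivity ((c * g - d * f) * A); first by rewrite det1 mul1r.
    transitivity (g * (c * A - d * B) - d * (f * A - g * B)); first by ring.
    by rewrite -e1 -e3; ring.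
  have eA2 : A = - (f * g + c * d).
    transitivity ((c * g - d * f) * A); first by rewrite det1 mul1r.
    transitivity (c * (f * B + g * A) - f * (c * B + d * A)); first by ring.
    by rewrite -e2 -e4; ring.
  have A0 : A = 0 by apply: opp0; rewrite {1}eA2 opprK -eA1.
  rewrite A0 expr0n add0r in AB; rewrite A0 !mulr0 ?addr0 ?add0r in e1 e2 e3 e4.
  move/eqP: AB; rewrite sqrf_eq1 => /orP[]/eqP B1; rewrite B1 in e1 e2.
    by case/negP: nDy; apply: in_D; rewrite // ?e1 ?e2; ring.
  have fE : f = d by rewrite e1; ring.
  have gE : g = - c by rewrite e2; ring.
  rewrite fE gE in det1 *; rewrite expgS expg1 pslM //.
  rewrite -pslN1; apply: psl_ext; try ring.
    by rewrite -det1; ring.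
  by rewrite -det1; ring.
(* In characteristic 3, the matrix [1 1; 1 -1] has determinant -2 = 1. It normalises [D0] and lies
   outside it. *)
have det1 : 1 * - 1 - 1 * 1 = 1 :> F.
  by apply: etrans (_ : _ = - (1 + 1)) _; [ring | rewrite (two_eq cardF) opprK].
apply/subsetPn; exists (psl 1 1 1 (- 1)).
  by rewrite inE psl_in //= in_norm.
apply/D0P=> -[a [b [ab /psl_eq[]]]]; rewrite ?circ_det //.
move=> s [_ [_ e2 e3 _]]; have : (- 1 : F) = 1 by rewrite {1}e2 e3; ring.
by move/eqP; rewrite (negPf (N1_neq1 cardF)).
Qed.

End Quotient.

Lemma PSL2_data (F : finFieldType) p : prime p -> odd p -> #|F| = (3 ^ p)%N ->
  psl2_data (PSL2 F) (P0 F) (K0 F) (D0 F) p (3 ^ p %/ 8).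
Proof.
move=> p_pr p_odd cardF; have qE := pow3_mod8 p_odd.
have p3 : 2 < p by case: p p_pr p_odd {cardF qE} => [|[|[|]]].
have p_gt1 : 1 < p by apply: ltnW.
split=> //.
(* As p is at least 3, q is at least 27, so that e is at least 3. *)
- rewrite -(ltn_pmul2l (isT : 0 < 8)) -(ltn_add2r 3) -qE.
  by apply: (@leq_trans (3 ^ 3)%N); rewrite ?leq_exp2l.
- exact: card_PSL.
- exact: (P0_abelem cardF).
- exact: card_P0.
- exact: (P0_sdprod p_odd cardF).
- exact: (P0_cent cardF).
- exact: (K0_torus p_odd p_gt1 cardF).
- exact: (card_K0 p_odd cardF).
- exact: (D0_torus p_odd cardF).
- exact: (card_D0 p_odd cardF).
Qed.

Theorem theorem3p2 (p : nat) (F : finFieldType)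
    (p_prime : prime p) (p_odd : odd p) (cardF : #|F| = (3 ^ p)%N) :
  let q := (3 ^ p)%N in
  let G := PSL2 F in
  (forall M : {group coset_of 'Z(SL2 F)}, maximal M G ->
     [|| borel_type p G M, dihedral_type (q - 1) M, dihedral_type (q + 1) M
       | A4_type M]) /\
  (forall x : coset_of 'Z(SL2 F), x \in G -> x != 1 ->
     [/\ [\/ #[x] = 2, #[x] = 3, #[x] <> 2 /\ #[x] %| q - 1
           | #[x] <> 2 /\ #[x] %| q + 1],
         Sol G x = \bigcup_(M in max_over G x) M
       & [/\ #[x] = 2 ->
               [/\ count_max G x (borel_type p G) = 0,
                   count_max G x (dihedral_type (q - 1)) = (q + 1) %/ 2,
                   count_max G x (dihedral_type (q + 1)) = (q + 3) %/ 2,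
                   count_max G x (@A4_type _) = (q + 1) %/ 4
                 & meets_in G x (fun I => (I \isog Zp 2) || (I \isog Cpow 2 2))
                   /\ #|Sol G x| = (q * (q + 1))%N],
             #[x] = 3 ->
               [/\ count_max G x (borel_type p G) = 1%N,
                   count_max G x (dihedral_type (q - 1)) = 0,
                   count_max G x (dihedral_type (q + 1)) = 0,
                   count_max G x (@A4_type _) = q %/ 3
                 & meets_in G x (fun I => I \isog Zp 3)
                   /\ #|Sol G x| = ((q * (q + 5)) %/ 2)%N],
             #[x] <> 2 -> #[x] %| q - 1 ->
               [/\ count_max G x (borel_type p G) = 2,
                   count_max G x (dihedral_type (q - 1)) = 1%N,
                   count_max G x (dihedral_type (q + 1)) = 0,
                   count_max G x (@A4_type _) = 0
                 & meets_in G x (fun I => I \isog Zp ((q - 1) %/ 2))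
                   /\ #|Sol G x| = (q * (q - 1))%N]
           & #[x] <> 2 -> #[x] %| q + 1 ->
               [/\ count_max G x (borel_type p G) = 0,
                   count_max G x (dihedral_type (q - 1)) = 0,
                   count_max G x (dihedral_type (q + 1)) = 1%N,
                   count_max G x (@A4_type _) = 0
                 & #|Sol G x| = (q + 1)%N]]]).
Proof. exact: psl2_data_main (PSL2_data p_prime p_odd cardF). Qed.
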